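(* Let $D$ be a nonempty diagram, and let $B \subseteq D$ be a special transversal. (a) The diagram $D$ branches completely with respect to $B$ if and only if $D \setminus \{b\}$ branches completely for all $b \in B$ and $B$ is an exact hitting set for the maximal rectangles of $D$. (b) If $D$ branches completely, then the generalized Garnir relations together with the one-column relations generate all the relations in $S^D$. That is, letting $n=|D|$ and letting $F$ be the complex vector space with basis the symbols $[T]$, for $T$ an injective tableau of shape $D$, the kernel of the linear map $F \to S^D$, $[T]\mapsto e_T$, is spanned by the elements $[T\sigma]-\operatorname{sgn}(\sigma)[T]$ (for $T$ an injective tableau of shape $D$ and $\sigma\in C_D$) together with the elements $\sum_{\pi\in \operatorname{Stab}_A}\operatorname{sgn}(\pi)[T\pi]$ (for $T$ an injective tableau of shape $D$ and $A$ a Garnir family in $D$).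
   Context: Let $\mathbf N$ be the positive integers. A diagram is a finite subset $D\subset \mathbf N\times\mathbf N$; its elements are called boxes, and $(i,j)$ is the box in row $i$ and column $j$. Let $n=|D|$. A tableau of shape $D$ is a function $T$ assigning to each box $x\in D$ a nonnegative integer label $T_x$; it is injective if each of $1,\dots,n$ appears exactly once as a label. Fix a bijection of $D$ with $\{1,\dots,n\}$, through which the symmetric group $\mathfrak S_n$ is identified with the group of permutations of the boxes of $D$. This group acts on the right on tableaux of shape $D$ by $(T\sigma)_x=T_{\sigma(x)}$, while $\mathfrak S_n$ acts on the left on injective tableaux by permuting the labels $1,\dots,n$. Elements of $\mathbf C[\mathfrak S_n]$ are identified with formal $\mathbf C$-linear combinations of injective tableaux of shape $D$ (a permutation $w$ corresponds to the tableau in which the box numbered $a$ has label $w(a)$), compatibly with left and right multiplication. Let $R_D$ (resp. $C_D$) be the subgroup of permutations of the boxes preserving each row (resp. each column) of $D$, and let $R(D)=\sum_{\sigma\in R_D}\sigma$, $\overline C(D)=\sum_{\sigma\in C_D}\operatorname{sgn}(\sigma)\sigma$. The Specht module is the left ideal $S^D=\mathbf C[\mathfrak S_n]\,\overline C(D)R(D)$. For an injective tableau $T$ of shape $D$, $e_T=T\cdot\overline C(D)R(D)$; these span $S^D$. A subset $B\subseteq D$ is a special transversal if its elements can be ordered $b_1=(i_1,j_1), b_2=(i_2,j_2),\dots$ so that $(i_p,j_q)\notin D$ for all $p<q$. A nonempty diagram $D$ with $n$ boxes branches with respect to $B\subseteq D$ (and $B$ is a branching set of $D$) if $B$ is a special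 transversal of $D$ and $\operatorname{Res}^{\mathfrak S_n}_{\mathfrak S_{n-1}}S^D\cong\bigoplus_{x\in B}S^{D\setminus\{x\}}$, where $\mathfrak S_{n-1}$ acts on the labels $1,\dots,n-1$. Recursively, a nonempty diagram $D$ branches completely with respect to $B$ if $B$ is a branching set of $D$ and $D\setminus\{b\}$ branches completely for all $b\in B$; a nonempty diagram branches completely if it does so with respect to some $B$, and the empty diagram is considered to branch completely. A rectangle in $D$ is a subset of $D$ of the form $P_1\times P_2$ with $P_1,P_2\subseteq\mathbf N$; a maximal rectangle is one that is maximal under inclusion. A subset $B\subseteq D$ is an exact hitting set for the maximal rectangles of $D$ if every maximal rectangle contains exactly one element of $B$. A Garnir family in $D$ is a tuple $A=(A_1,\dots,A_m)$, $m\ge1$, of disjoint sets of boxes of $D$ for which there are distinct columns $j_1,\dots,j_{m+1}$ of $D$ such that each $A_i$ is contained in the union of columns $j_i$ and $j_{i+1}$, and $\sum_{i=1}^m|A_i|>c_{j_1}+\dots+c_{j_{m+1}}-c$, where $c_j$ is the number of boxes of $D$ in column $j$ and $c$ is the number of rows having boxes of $D$ in all of the columns $j_1,\dots,j_{m+1}$. $\operatorname{Stab}_A\subseteq\mathfrak S_n$ is the group of permutations of the boxes of $D$ that map each $A_i$ to itself and fix every box outside $\bigcup_i A_i$. The generalized Garnir relations are the relations $\sum_{\pi\in\operatorname{Stab}_A}\operatorname{sgn}(\pi)e_{T\pi}=0$ for Garnir families $A$, and the one-column relations are $e_{T\sigma}=\operatorname{sgn}(\sigma)e_T$ for $\sigma\in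 C_D$; both hold in $S^D$ for all injective tableaux $T$. *)

(* Defs.v *)
From HB Require Import structures.
From mathcomp Require Import all_boot all_order all_fingroup all_algebra finmap.
From mathcomp Require Import reals.
From mathcomp Require Import complex.

Set Implicit Arguments.
Unset Strict Implicit.
Unset Printing Implicit Defensive.

Import GRing.Theory.
Local Open Scope ring_scope.
Local Open Scope fset_scope.

Notation posnat := {k : nat | (0 < k)%N}.

(* The box in row i and column j is the pair (i, j). *)
Notation box := (posnat * posnat)%type.
Notation diagram := {fset box}.

Section BoxPermutations.

Variable D : diagram.

Definition row_of (x : D) : posnat := (fsval x).1.
Definition col_of (x : D) : posnat := (fsval x).2.

Definition row_group : {set {perm D}} :=
  [set s : {perm D} | [forall x, row_of (s x) == row_of x]].
Definition col_group : {set {perm D}} :=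
  [set s : {perm D} | [forall x, col_of (s x) == col_of x]].

End BoxPermutations.

(* Only used with n = #|` D |, so that these are the bijective fillings of D;
   the label k + 1 in {1, ..., n} is represented by k : 'I_n.  Keeping n a
   parameter makes 'S_n act on the tableaux of every diagram with n boxes. *)
Notation itab D n := {T : {ffun fset_sub_type D -> 'I_n} | injectiveb T}.

Section InjectiveTableaux.

Variables (D : diagram) (n : nat).

Fact tab_perm_subproof (T : itab D n) (s : {perm D}) :
  injectiveb [ffun x => val T (s x)].
Proof.
apply/injectiveP=> x y; rewrite !ffunE => /(injectiveP _ (valP T)).
exact: perm_inj.
Qed.

(* The right action (T s)_x = T_(s x). *)
Definition tab_perm (T : itab D n) (s : {perm D}) : itab D n :=
  Sub [ffun x => val T (s x)] (tab_perm_subproof T s).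

Fact perm_tab_subproof (w : 'S_n) (T : itab D n) :
  injectiveb [ffun x => w (val T x)].
Proof.
by apply/injectiveP=> x y; rewrite !ffunE => /perm_inj /(injectiveP _ (valP T)).
Qed.

(* The left action, permuting labels. *)
Definition perm_tab (w : 'S_n) (T : itab D n) : itab D n :=
  Sub [ffun x => w (val T x)] (perm_tab_subproof w T).

End InjectiveTableaux.

(* Formal K-linear combinations of injective tableaux.  For n = #|` D | this is
   K['S_n] after a choice of numbering of the boxes of D, with the left
   multiplication given by label permutations and the right multiplication by
   box permutations. *)
Notation tabspace K D n := {ffun itab D n -> K^o}.

Section Specht.

Variables (K : fieldType) (D : diagram) (n : nat).

Definition tabvec (T : itab D n) : tabspace K D n := [ffun U => (U == T)%:R].

Definition lact (w : 'S_n) (a : tabspace K D n) : tabspace K D n :=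
  \sum_T a T *: tabvec (perm_tab w T).

Definition ract (a : tabspace K D n) (s : {perm D}) : tabspace K D n :=
  \sum_T a T *: tabvec (tab_perm T s).

(* Right multiplication by
   (\sum_(s in C_D) sgn(s) s) * (\sum_(t in R_D) t). *)
Definition mulCR (a : tabspace K D n) : tabspace K D n :=
  \sum_(s in col_group D) \sum_(t in row_group D)
    (-1) ^+ s *: ract (ract a s) t.

Fact ract_is_linear s : linear (ract ^~ s).
Proof.
move=> k a b; rewrite /ract scaler_sumr -big_split; apply: eq_bigr => T _ /=.
by rewrite !ffunE scalerDl scalerA.
Qed.

Fact mulCR_is_linear : linear mulCR.
Proof.
move=> k a b; rewrite /mulCR scaler_sumr -big_split; apply: eq_bigr => s _ /=.
rewrite scaler_sumr -big_split; apply: eq_bigr => t _ /=.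
by rewrite !ract_is_linear scalerDr !scalerA mulrC.
Qed.

HB.instance Definition _ :=
  GRing.isLinear.Build K (tabspace K D n) (tabspace K D n) *:%R mulCR
    mulCR_is_linear.

(* e_T is mulCR (tabvec T). *)
Definition specht : {vspace tabspace K D n} := limg (linfun mulCR).

End Specht.

(* The embedding of 'S_n in 'S_n.+1 as the stabilizer of the last label. *)
Definition emb_perm n (w : 'S_n) : 'S_n.+1 := lift_perm ord_max ord_max w.

(* Isomorphism of 'S_n-modules between the restriction of S^D and the direct sum
   of the S^(D \ {x}) for x in B, given by its components f x; a finite direct
   sum is the module of families (u x) with u x in S^(D \ {x}).  The values of
   the f x outside S^D are irrelevant. *)
Definition branching_iso (K : fieldType) (D : diagram) (B : {fset box})
    (n : nat) : Prop :=
  exists f : forall x : B, 'Hom(tabspace K D n.+1, tabspace K (D `\ fsval x) n),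
  [/\ forall x v, v \in specht K D n.+1 ->
        f x v \in specht K (D `\ fsval x) n,
      forall x (w : 'S_n) v, v \in specht K D n.+1 ->
        f x (lact (emb_perm w) v) = lact w (f x v)
    & forall u : forall x : B, tabspace K (D `\ fsval x) n,
        (forall x, u x \in specht K (D `\ fsval x) n) ->
        exists! v, v \in specht K D n.+1 /\ forall x, f x v = u x].

Definition special_transversal (D : diagram) (B : {fset box}) : Prop :=
  B `<=` D /\
  exists s : seq box, [/\ uniq s, s =i B
    & pairwise (fun b c : box => (b.1, c.2) \notin D) s].

Definition branching_set (K : fieldType) (D : diagram) (B : {fset box}) : Prop :=
  special_transversal D B /\
  exists2 n, #|` D| = n.+1 & branching_iso K D B n.

Inductive branches_completely (K : fieldType) : diagram -> Prop :=
| branches_completely_empty : branches_completely K fset0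
| branches_completely_nonempty (D : diagram) (B : {fset box}) :
    branches_completely_wrt K D B -> branches_completely K D
with branches_completely_wrt (K : fieldType) : diagram -> {fset box} -> Prop :=
| Branches_completely_wrt (D : diagram) (B : {fset box}) :
    D != fset0 -> branching_set K D B ->
    (forall b, b \in B -> branches_completely K (D `\ b)) ->
    branches_completely_wrt K D B.

Definition is_rectangle (D : diagram) (E : {fset box}) : Prop :=
  E `<=` D /\
  exists P1 P2 : pred posnat, forall b : box, (b \in E) = P1 b.1 && P2 b.2.

Definition is_max_rectangle (D : diagram) (E : {fset box}) : Prop :=
  is_rectangle D E /\
  forall E' : {fset box}, is_rectangle D E' -> E `<=` E' -> E' = E.

Definition exact_hitting_set (D : diagram) (B : {fset box}) : Prop :=
  B `<=` D /\
  forall E : {fset box}, is_max_rectangle D E -> #|` B `&` E| = 1%N.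

Definition col_size (D : diagram) (j : posnat) : nat :=
  #|` [fset b in D | b.2 == j]|.

Definition common_rows (D : diagram) (m : nat) (j : 'I_m -> posnat) : nat :=
  #|` [fset i in [fset b.1 | b in D] | [forall k, (i, j k) \in D]]|.

(* common_rows D j is at most each col_size D (j k), so the subtraction in the
   last clause is not truncated; the clause forces every column j k to be
   nonempty. *)
Definition garnir_family (D : diagram) (m : nat) (A : 'I_m -> {set D}) : Prop :=
  [/\ (0 < m)%N,
      forall i k, i != k -> [disjoint A i & A k]%B
    & exists j : 'I_m.+1 -> posnat,
      [/\ injective j,
          forall i x, x \in A i ->
            col_of x = j (widen_ord (leqnSn m) i) \/ col_of x = j (lift ord0 i)
        & (\sum_k col_size D (j k) - common_rows D j < \sum_i #|A i|)%N]].

Definition garnir_stab (D : diagram) (m : nat) (A : 'I_m -> {set D}) :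
    {set {perm D}} :=
  [set p : {perm D} |
    [forall i, p @: A i == A i] && perm_on (\bigcup_i A i) p].

Section Relations.

Variables (K : fieldType) (D : diagram) (n : nat).

Definition one_column_relation (v : tabspace K D n) : Prop :=
  exists T : itab D n, exists2 s, s \in col_group D &
    v = tabvec K (tab_perm T s) - (-1) ^+ s *: tabvec K T.

Definition garnir_relation (v : tabspace K D n) : Prop :=
  exists (T : itab D n) (m : nat) (A : 'I_m -> {set D}),
    garnir_family A /\
    v = \sum_(p in garnir_stab A) (-1) ^+ p *: tabvec K (tab_perm T p).

End Relations.

Definition spanned_by (K : fieldType) (V : vectType K) (U : {vspace V})
    (P : V -> Prop) : Prop :=
  forall v, v \in U <->
    exists2 s : seq V, (forall u, u \in s -> P u) & v \in <<s>>%VS.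

(* Main.v *)
Require Import Defs.
From HB Require Import structures.
From mathcomp Require Import all_boot all_order all_fingroup all_algebra finmap.
From mathcomp Require Import reals.
From mathcomp Require Import complex.

Set Implicit Arguments.
Unset Strict Implicit.
Unset Printing Implicit Defensive.

Local Open Scope ring_scope.

Import Order.TTheory GRing.Theory Num.Theory.

(** The proof rests on a determinantal description of the Specht module.  List
the boxes of [D] as [d 0, ..., d (n - 1)].  Given, for each label [l], a vector
[w l] indexed by columns and a vector [y l] indexed by rows, put
   [pairing d w y = \det (y l (row of d k) * w l (column of d k))_(l, k)].
Up to sign, the coefficient of a tableau [U] in [e_T] is the pairing of the
column word of [T] (the column of each label) with the row word of [U]
([mulCR_tabvec_pairing]).  Hence S^D is the image of this pairing, the
relations of S^D are its left radical, and restriction to the stabilizer of the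
last label is governed by Laplace expansion ([pairing_laplace]).

Relations.  Let H(P) be the space of the vectors that are supported on a set
[P] of columns and have coordinate sum zero.  If the vectors of the labels in a
set [X] lie in H(P), their rows in the matrix above are supported on the boxes
in the columns [P] and sum to zero along each row of [D] that is full on [P]; so
they are dependent, and the pairing vanishes, as soon as [X] is larger than the
number of these boxes minus the number of these full rows ([pairing_eq0]).  For
every ordering j_1, j_2, ... of [P] the space H(P) has the basis of the
differences e_(j_i) - e_(j_(i+1)), so tensors of such differences suffice.
Averaging over the label permutations that preserve the difference attached to
each label turns such a tensor into a combination of Garnir relations
([garnir_average]).  So the Garnir and one-column relations generate all
relations if the space [word_relations] of the relations just found is the whole
radical ([spanned_relations]).

Upper bound.  Suppose that [B] hits every maximal rectangle.  Let P1 be the rows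
full on [P], and [b] in [B] a box with row in P1 and column [r] containing P1.
Modulo relations a label can be moved from a column of [P] to the column [r]
([move_label]).  Consequently the words in which the last label lies in a column
of [B] span, and a relation of [D] minus [b] lifts to [D] modulo the words that
come from boxes after [b] ([insert_relations_sub]).  The codimension of the
relations of [D] is therefore at most the sum of those of the diagrams [D]
minus [b] ([codim_word_relations]).

Lower bound.  If [B] is a special transversal, the tableaux with the last label
in [b], restricted to that position, form a block triangular system whose
diagonal blocks are the modules S^(D minus b), so the dimension of S^D is at
least the sum of their dimensions ([lower_bound]).

If the relations of every [D] minus [b] are word relations, the two bounds meet
([hitting_branches]).  This shows that the relations of [D] are word relations
too; and equality of dimensions gives the branching isomorphism, by Maschke's
averaging along the filtration of S^D behind the lower bound
([dim_branching_iso]).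

Conversely, let P1 x P2 be a maximal rectangle not hit by [B].  From vectors of
H(P2) one builds an element of S^D whose coefficients vanish unless the last
label is in a row of P1, and dually, from H(P1), a functional that vanishes on
[e_T] unless the last label of [T] is in a column of P2.  Their pairing is a
unitriangular determinant ([rect_vec_det]), hence not zero, and the two fit into
the triangular system of the lower bound as one more row and column: the
dimension of S^D exceeds the sum, and [D] does not branch with respect to [B]
([unhit_dim]). *)

(** * Two determinants *)

(** Each permutation maps some element of [X] into [Q], by counting, so every
term of the Leibniz formula contains a zero entry. *)
Lemma det_zero_block (K : fieldType) (n : nat) (A : 'M[K]_n) (X Q : {set 'I_n}) :
  (forall l k, l \in X -> k \in Q -> A l k = 0) -> (n < #|X| + #|Q|)%N ->
  \det A = 0.
Proof.
move=> A0 ltn; rewrite /determinant big1 // => s _.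
have [l lX slQ] : exists2 l, l \in X & s l \in Q.
  apply/exists_inP; apply: contraLR ltn; rewrite negb_exists_in -leqNgt.
  move=> /forall_inP sX.
  have : [disjoint s @: X & Q].
    rewrite disjoint_subset; apply/subsetP => _ /imsetP[l lX ->].
    by rewrite inE sX.
  move=> dis; rewrite -(card_imset _ (@perm_inj _ s)).
  move: dis; rewrite -setI_eq0 => /eqP dis.
  have := cardsU (s @: X) Q; rewrite dis cards0 subn0 => <-.
  by rewrite -[leqRHS]card_ord max_card.
by rewrite (bigD1 l) //= A0 // mul0r mulr0.
Qed.

(** A permutation with a nonzero term in the Leibniz formula nowhere decreases
[f]; as it preserves the sum of all values of [f], it is the identity.  This
form spares an enumeration of the indices along which the matrix is
triangular. *)
Lemma det_unitriangular (K : fieldType) (n : nat) (A : 'M[K]_n)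
    (f : 'I_n -> nat) :
  (forall l, A l l = 1) ->
  (forall l k, A l k != 0 -> l != k -> (f l < f k)%N) -> \det A = 1.
Proof.
move=> A1 Af; rewrite /determinant (bigD1 1%g) //= odd_perm1 mul1r.
rewrite big1 ?mul1r => [|l _]; last by rewrite perm1 A1.
rewrite big1 ?addr0 // => s s1.
have [/forallP As|] := boolP [forall l, A l (s l) != 0]; last first.
  rewrite negb_forall => /existsP[l]; rewrite negbK => /eqP Al.
  by rewrite (bigD1 l) //= Al mul0r mulr0.
have le l : (f l <= f (s l))%N.
  by have [<-//|/(Af _ _ (As l))/ltnW] := eqVneq l (s l).
have sumE : (\sum_l f l = \sum_l f (s l))%N.
  by rewrite (reindex_inj (@perm_inj _ s)).
case/negP: s1; apply/eqP/permP => l; rewrite perm1; apply/eqP.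
apply: contraT => sl.
have lt : (f l < f (s l))%N by rewrite Af // eq_sym.
have : (\sum_l f l < \sum_l f (s l))%N.
  rewrite (bigD1 l) //= [ltnRHS](bigD1 l) //= -addSn leq_add //.
  by apply: leq_sum => i _; apply: le.
by rewrite sumE ltnn.
Qed.

(** * The pairing of column tensors with row tensors *)

Section Pairing.

Variables (K : fieldType) (I J : finType).

Section FixedSize.

Variable n : nat.
Implicit Types (d : 'I_n -> I * J) (w : 'I_n -> J -> K) (y : 'I_n -> I -> K).
Implicit Types (P : {set J}).

(** Row [l] is the restriction to the boxes [d] of the rank one function
(i, j) |-> y_l(i) w_l(j). *)
Definition pairing_mx d w y : 'M[K]_n :=
  \matrix_(l, k) (y l (d k).1 * w l (d k).2).

Definition pairing d w y : K := \det (pairing_mx d w y).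

Definition word_vec (T : finType) (phi : {ffun 'I_n -> T}) : 'I_n -> T -> K :=
  fun l j => (j == phi l)%:R.

(** The coordinates of the pure tensor of the vectors [w l] in the basis of
words. *)
Definition tensor w : {ffun {ffun 'I_n -> J} -> K^o} :=
  [ffun phi : {ffun 'I_n -> J} => \prod_l w l (phi l)].

Definition count_boxes d P : nat := #|[set k | (d k).2 \in P]|.
Definition full_rows d P : {set I} := [set i | [forall j in P, (i, j) \in codom d]].

Lemma sum_word (T : finType) (u : 'I_n -> T -> K) (f : {ffun 'I_n -> T}) :
  \sum_(phi : {ffun 'I_n -> T})
     (\prod_l u l (phi l)) * \prod_l word_vec phi l (f l) = \prod_l u l (f l).
Proof.
have ff : \prod_l word_vec f l (f l) = 1.
  by rewrite big1 // => l _; rewrite /word_vec eqxx.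
rewrite (bigD1 f) //= ff mulr1.
rewrite [X in _ + X]big1 ?addr0 // => phi /eqP/ffunP neq.
have [/forallP eq|] := boolP [forall l, phi l == f l].
  by case: neq => l; apply/eqP.
rewrite negb_forall => /existsP[l neql].
by rewrite [X in _ * X](bigD1 l) //= /word_vec eq_sym (negPf neql) mul0r mulr0.
Qed.

Lemma pairing_expand_col d w y :
  pairing d w y = \sum_(phi : {ffun 'I_n -> J})
     (\prod_l w l (phi l)) * pairing d (word_vec phi) y.
Proof.
rewrite /pairing /determinant.
under [RHS]eq_bigr do rewrite mulr_sumr.
rewrite exchange_big /=; apply: eq_bigr => s _.
under [RHS]eq_bigr do rewrite mulrCA.
rewrite -mulr_sumr; congr (_ * _).
under eq_bigr do rewrite mxE.
rewrite big_split /= mulrC.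
transitivity (\sum_(phi : {ffun 'I_n -> J}) \prod_l y l (d (s l)).1 *
    ((\prod_l w l (phi l)) * \prod_l word_vec phi l (d (s l)).2)); last first.
  apply: eq_bigr => phi _; rewrite mulrCA; congr (_ * _).
  by rewrite -big_split; apply: eq_bigr => l _; rewrite mxE.
rewrite -mulr_sumr [LHS]mulrC; congr (_ * _).
have := sum_word w [ffun l => (d (s l)).2].
under eq_bigr do rewrite ffunE; move=> <-.
by apply: eq_bigr => phi _; congr (_ * _); apply: eq_bigr => l _; rewrite ffunE.
Qed.

Definition transpose_boxes d : 'I_n -> J * I := fun k => ((d k).2, (d k).1).

(** The rows indexed by [X] vanish outside the columns [P] and on the sum of the
boxes of each full row.  Adding, inside each full row, the other columns of [P]
to a chosen column [js] turns this into a block of zeros that is too large for a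
nonsingular matrix.  The hypotheses are on products of [y] and [w], because one
of the labels may owe the vanishing of its row sums to [y] instead of [w]. *)
Lemma pairing_eq0 (d : 'I_n -> I * J) w y (X : {set 'I_n}) P :
  injective d -> P != set0 ->
  (forall l j, l \in X -> j \notin P -> w l j = 0) ->
  (forall l i, l \in X -> i \in full_rows d P -> y l i * \sum_(j in P) w l j = 0) ->
  (count_boxes d P < #|X| + #|full_rows d P|)%N -> pairing d w y = 0.
Proof.
move=> dI /set0Pn[js jsP] w0 yw0 lt.
pose cp (z : 'I_n) := ((d z).2 == js) && ((d z).1 \in full_rows d P).
(* Right multiplication by 1 + F performs these column operations. *)
pose F : 'M[K]_n := \matrix_(x, z) [&& cp z, (d x).1 == (d z).1,
  (d x).2 \in P & (d x).2 != js]%:R.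
have FF : F *m F = 0.
  apply/matrixP => x z; rewrite !mxE big1 // => t _; rewrite !mxE.
  by rewrite /cp; case: (eqVneq (d t).2 js) => _; rewrite /= ?andbF ?mulr0 ?mul0r.
have detE : \det (1%:M + F) != 0.
  rewrite -unitfE -unitmxE.
  have /mulmx1_unit[] // : (1%:M + F) *m (1%:M - F) = 1%:M.
  by rewrite mulmxBr mulmxDl !mulmxDl !mulmx1 !mul1mx FF addr0 addrK.
(* The columns that are zero on X after the operations. *)
pose Q := [set z | ((d z).2 \notin P) || cp z].
have ltQ : (n < #|X| + #|Q|)%N.
  have cardQ : (n - count_boxes d P + #|full_rows d P| <= #|Q|)%N.
    have -> : Q = ~: [set k | (d k).2 \in P] :|: [set z | cp z].
      by apply/setP => z; rewrite !inE.
    rewrite cardsU; have -> : ~: [set k | (d k).2 \in P] :&: [set z | cp z] = set0.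
      apply/setP => z; rewrite !inE /cp.
      by case: eqP => [->|]; rewrite ?jsP ?andbF.
    rewrite cards0 subn0; apply: leq_add.
      by rewrite cardsCs setCK card_ord.
    apply: leq_trans (leq_imset_card (fun z => (d z).1) _).
    apply/subset_leq_card/subsetP => i iC.
    have := iC; rewrite inE => /forall_inP/(_ _ jsP)/codomP[z dz].
    by apply/imsetP; exists z; rewrite ?inE /cp -?dz ?eqxx.
  have le : (count_boxes d P <= n)%N by rewrite -[leqRHS]card_ord max_card.
  apply: leq_trans (leq_add (leqnn _) cardQ).
  by rewrite addnCA -[in ltnLHS](subnK le) ltn_add2l.
have/eqP : \det (pairing_mx d w y *m (1%:M + F)) = 0.
  apply: det_zero_block ltQ => l z lX; rewrite inE => zQ.
  rewrite mulmxDr mulmx1 mxE [X in _ + X]mxE.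
  case/orP: zQ => [zP|cz].
    rewrite mxE w0 // mulr0 add0r big1 // => x _; rewrite !mxE /cp.
    by case: eqP => [e|_]; rewrite ?mulr0 //; move: zP; rewrite e jsP.
  have /andP[/eqP z2 zC] := cz.
  rewrite -[RHS](yw0 l (d z).1 lX zC) mulr_sumr.
  pose S := [set x | ((d x).1 == (d z).1) && ((d x).2 \in P)].
  have imS : (fun x => (d x).2) @: S = P.
    apply/setP => j; apply/imsetP/idP => [[x]|jP].
      by rewrite inE => /andP[_ ? ->].
    have := zC; rewrite inE => /forall_inP/(_ _ jP)/codomP[x dx].
    by exists x; rewrite ?inE -?dx /= ?eqxx.
  have injS : {in S &, injective (fun x => (d x).2)}.
    move=> x x'; rewrite !inE => /andP[/eqP e1 _] /andP[/eqP e2 _] e.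
    apply: dI; move: e1 e2 e; case: (d x) => ? ?; case: (d x') => ? ? /=.
    by move=> -> -> ->.
  rewrite -[in RHS]imS big_imset //= [RHS](bigD1 z) /=; last first.
    by rewrite inE eqxx z2.
  rewrite mxE; congr (_ + _).
  rewrite [RHS]big_mkcond; apply: eq_bigr => x _; rewrite !mxE inE cz /=.
  have [e1|] /= := eqVneq (d x).1 (d z).1; last by rewrite mulr0.
  have [_|] /= := boolP (_ \in _); last by rewrite mulr0.
  have -> : ((d x).2 != js) = (x != z).
    congr negb; rewrite -z2; apply/eqP/eqP => [e2|->//].
    by apply: dI; move: e1 e2; case: (d x) => ? ?; case: (d z) => ? ? /= -> ->.
  by rewrite e1; case: eqP; rewrite ?mulr0 ?mulr1.
by rewrite det_mulmx mulf_eq0 (negPf detE) orbF => /eqP.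
Qed.

End FixedSize.

End Pairing.

Lemma pairing_swap (K : fieldType) (I J : finType) n (d : 'I_n -> I * J)
    (w : 'I_n -> J -> K) (y : 'I_n -> I -> K) :
  pairing d w y = pairing (transpose_boxes d) y w.
Proof. by congr (\det _); apply/matrixP => l k; rewrite !mxE mulrC. Qed.

Lemma pairing_expand_row (K : fieldType) (I J : finType) n (d : 'I_n -> I * J)
    (w : 'I_n -> J -> K) (y : 'I_n -> I -> K) :
  pairing d w y = \sum_(rho : {ffun 'I_n -> I})
    (\prod_l y l (rho l)) * pairing d w (word_vec K rho).
Proof.
by rewrite pairing_swap pairing_expand_col; apply: eq_bigr => rho _; rewrite -pairing_swap.
Qed.

(** * Relations between column words *)

Section Words.

Variables (K : fieldType) (I J : finType).

Notation wspace n := {ffun {ffun 'I_n -> J} -> K^o}.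

Section Relations.

Variable n : nat.
Implicit Types (d : 'I_n -> I * J) (phi chi : {ffun 'I_n -> J}).
Implicit Types (X : {set 'I_n}) (P : {set J}) (v : wspace n).

(** The left radical of the pairing is the kernel of this map; row words are
enough as they form a basis of the row tensors. *)
Definition pairing_map d v : {ffun {ffun 'I_n -> I} -> K^o} :=
  [ffun rho : {ffun 'I_n -> I} => \sum_phi v phi * pairing d (word_vec K phi) (word_vec K rho)].

Fact pairing_map_is_linear d : linear (pairing_map d).
Proof.
move=> k a b; apply/ffunP => rho; rewrite !ffunE scaler_sumr -big_split /=.
by apply: eq_bigr => phi _; rewrite !ffunE mulrDl scalerAl.
Qed.
HB.instance Definition _ d :=
  GRing.isLinear.Build K (wspace n) {ffun {ffun 'I_n -> I} -> K^o} *:%R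
    (pairing_map d) (pairing_map_is_linear d).

Lemma pairing_map_tensor d (w : 'I_n -> J -> K) rho :
  pairing_map d (tensor w) rho = pairing d w (word_vec K rho).
Proof.
by rewrite ffunE pairing_expand_col; apply: eq_bigr => phi _; rewrite ffunE.
Qed.

Lemma tensor_word phi phi' :
  tensor (word_vec K phi) phi' = (phi' == phi)%:R.
Proof.
rewrite ffunE; have [->|neq] := eqVneq.
  by rewrite big1 // => l _; rewrite /word_vec eqxx.
have [/forallP eq|] := boolP [forall l, phi' l == phi l].
  by case/eqP: neq; apply/ffunP => l; apply/eqP.
rewrite negb_forall => /existsP[l neql].
by rewrite (bigD1 l) //= /word_vec (negPf neql) mul0r.
Qed.

Lemma words_expand v : v = \sum_phi v phi *: tensor (word_vec K phi).
Proof.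
apply/ffunP => phi; rewrite sum_ffunE (bigD1 phi) //= ffunE tensor_word eqxx.
rewrite big1 ?addr0 => [|phi' neq]; first by rewrite /GRing.scale /= mulr1.
by rewrite ffunE tensor_word eq_sym (negPf neq) scaler0.
Qed.

(** Such a word is the column word of no filling of the boxes, so it is zero in
the Specht module. *)
Definition overfull d phi : bool :=
  [exists j, (count_boxes d [set j] < #|[set l | phi l == j]|)%N].

Definition diff_vec phi chi X : 'I_n -> J -> K :=
  fun l j => (j == phi l)%:R - (l \in X)%:R * (j == chi l)%:R.

(** The Garnir inequality, for differences of columns in [P]; subtraction is
avoided by moving the number of full rows to the right. *)
Definition balanced d phi chi X : bool :=
  [exists P : {set J}, [&& P != set0,
     [forall l in X, (phi l \in P) && (chi l \in P)] &
     (count_boxes d P < #|X| + #|full_rows d P|)%N]].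

(** Differences of basis vectors span the vectors of coordinate sum zero, so
finitely many tensors generate all the relations provided by [pairing_eq0]. *)
Definition word_relations d : {vspace wspace n} :=
  (<<[seq tensor (diff_vec t.1.1 t.1.2 t.2) |
       t in [pred t : {ffun 'I_n -> J} * {ffun 'I_n -> J} * {set 'I_n}
         | balanced d t.1.1 t.1.2 t.2]]>>
   + <<[seq tensor (word_vec K phi) | phi in [pred phi | overfull d phi]]>>)%VS.

Lemma balanced_relation d phi chi X : balanced d phi chi X ->
  tensor (diff_vec phi chi X) \in word_relations d.
Proof.
move=> bal; apply: (subvP (addvSl _ _)); apply: memv_span.
by apply/imageP; exists (phi, chi, X).
Qed.

Lemma overfull_relation d v :
  (forall phi, ~~ overfull d phi -> v phi = 0) -> v \in word_relations d.
Proof.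
move=> v0; rewrite [v]words_expand; apply: rpred_sum => phi _.
have [ov|/v0->] := boolP (overfull d phi); last by rewrite scale0r rpred0.
apply/rpredZ/(subvP (addvSr _ _)); apply: memv_span.
by apply/imageP; exists phi.
Qed.

Lemma diff_vec_out phi chi X P l j : phi l \in P -> chi l \in P -> j \notin P ->
  diff_vec phi chi X l j = 0.
Proof.
move=> pP cP jP; rewrite /diff_vec; have [e|_] := eqVneq j (phi l).
  by rewrite e pP in jP.
have [e|_] := eqVneq j (chi l); first by rewrite e cP in jP.
by rewrite mulr0 subr0.
Qed.

Lemma diff_vec_sum phi chi X P l : phi l \in P -> chi l \in P -> l \in X ->
  \sum_(j in P) diff_vec phi chi X l j = 0.
Proof.
move=> pP cP lX; rewrite /diff_vec lX sumrB.
rewrite (bigD1 (phi l)) //= eqxx big1 => [|j /andP[_ /negPf->] //].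
rewrite (bigD1 (chi l)) //= eqxx big1 => [|j /andP[_ /negPf->] //]; last by rewrite mulr0.
by rewrite mulr1 !addr0 subrr.
Qed.

Lemma word_relations_sub_ker d : injective d -> (word_relations d <= lker (linfun (pairing_map d)))%VS.
Proof.
move=> dI; rewrite /word_relations subv_add; apply/andP; split; apply/span_subvP => v.
  case/imageP => -[[phi chi] X] /= bal ->.
  rewrite memv_ker lfunE /=; apply/eqP/ffunP => rho; rewrite pairing_map_tensor ffunE.
  case/existsP: bal => P /and3P[P0 /forall_inP XP lt].
  apply: (pairing_eq0 dI P0 _ _ lt) => l j lX; have /andP[pP cP] := XP l lX.
    exact: diff_vec_out.
  by rewrite diff_vec_sum // mulr0.
case/imageP => phi /existsP[j lt] ->.
rewrite memv_ker lfunE /=; apply/eqP/ffunP => rho; rewrite pairing_map_tensor ffunE.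
apply: (@det_zero_block _ _ _ [set l | phi l == j] [set k | (d k).2 != j]).
  move=> l k; rewrite !inE => /eqP pl /negPf dk.
  by rewrite mxE /word_vec pl dk mulr0.
have -> : [set k | (d k).2 != j] = ~: [set k | (d k).2 \in [set j]].
  by apply/setP => k; rewrite !inE.
rewrite -[ltnLHS]card_ord -(cardsC [set k | (d k).2 \in [set j]]).
by rewrite -addSn leq_add2r.
Qed.

Lemma sum_card_fibers (f : 'I_n -> J) P :
  (\sum_(j in P) #|[set l | f l == j]| = #|[set l | f l \in P]|)%N.
Proof.
rewrite -[RHS]sum1_card (partition_big f (mem P)) => [|l]; last by rewrite inE.
apply: eq_bigr => j jP; rewrite -sum1_card; apply: eq_bigl => l.
by rewrite !inE; case: eqP => [->|]; rewrite ?jP ?andbF.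
Qed.

(** No column has too many labels, and there are as many labels as boxes, so
every column has its exact number of labels. *)
Lemma not_overfull_content d phi : ~~ overfull d phi ->
  forall P, #|[set l | phi l \in P]| = count_boxes d P.
Proof.
move=> nov P; pose a j := #|[set l | phi l == j]|.
pose b j := #|[set k | (d k).2 == j]|.
have le j : (a j <= b j)%N.
  have := nov; rewrite negb_exists => /forallP/(_ j); rewrite -leqNgt => /leq_trans.
  by apply; apply: subset_leq_card; apply/subsetP => k; rewrite !inE.
have tot (f : 'I_n -> J) : (\sum_(j in [set: J]) #|[set l | f l == j]| = n)%N.
  rewrite sum_card_fibers -[RHS]card_ord -cardsT.
  by apply: eq_card => l; rewrite !inE.
have eq j : a j = b j.
  apply/eqP; rewrite eqn_leq le /=.
  have : (\sum_(i in [set: J]) a i = \sum_(i in [set: J]) b i)%N.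
    by rewrite [LHS](tot phi) [RHS](tot (fun k => (d k).2)).
  rewrite (bigD1 j) ?inE //= [RHS](bigD1 j) ?inE //= => e.
  rewrite -(leq_add2r (\sum_(i in [set: J] | i != j) a i)) e leq_add2l.
  by apply: leq_sum => i _; apply: le.
rewrite -sum_card_fibers (eq_bigr b) => [|j _]; last exact: eq.
exact: (sum_card_fibers (fun k => (d k).2)).
Qed.

End Relations.

End Words.
(** [limg f] adds to [A] at most the dimension of a complement of [B]. *)
Lemma dim_add_quotient (K : fieldType) (U V : vectType K) (f : 'Hom(U, V))
    (A : {vspace V}) (B : {vspace U}) :
  (f @: B <= A)%VS ->
  (\dim (A + limg f) <= \dim A + (\dim {:U} - \dim B))%N.
Proof.
move=> fBA; rewrite -dimv_compl -(addv_complf B) limgD addvA (addv_idPl fBA).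
apply: leq_trans (dimv_add_leqif _ _) _.
by rewrite leq_add2l -(limg_ker_dim f B^C) leq_addl.
Qed.

(** * Inserting the last label *)

Section Extension.

Variables (K : fieldType) (I J : finType) (n : nat).

Notation wspace n := {ffun {ffun 'I_n -> J} -> K^o}.

Definition word_ext (T : finType) (phi : {ffun 'I_n -> T}) (j : T) : {ffun 'I_n.+1 -> T} :=
  [ffun l => oapp phi j (unlift ord_max l)].
Definition word_res (T : finType) (phi : {ffun 'I_n.+1 -> T}) : {ffun 'I_n -> T} :=
  [ffun l => phi (lift ord_max l)].

Lemma word_ext_max (T : finType) (phi : {ffun 'I_n -> T}) j : word_ext phi j ord_max = j.
Proof. by rewrite ffunE unlift_none. Qed.

Lemma word_ext_lift (T : finType) (phi : {ffun 'I_n -> T}) j l :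
  word_ext phi j (lift ord_max l) = phi l.
Proof. by rewrite ffunE liftK. Qed.

Lemma word_resK (T : finType) (phi : {ffun 'I_n.+1 -> T}) :
  word_ext (word_res phi) (phi ord_max) = phi.
Proof.
apply/ffunP => l; have [l' ->|->] := unliftP ord_max l; last by rewrite word_ext_max.
by rewrite word_ext_lift ffunE.
Qed.

Definition insert (j : J) (v : wspace n) : wspace n.+1 :=
  [ffun phi : {ffun 'I_n.+1 -> J} => (phi ord_max == j)%:R * v (word_res phi)].

Fact insert_is_linear j : linear (insert j).
Proof.
move=> k a b; apply/ffunP => phi; rewrite !ffunE mulrDr; congr (_ + _).
by rewrite /GRing.scale /= mulrCA.
Qed.
HB.instance Definition _ j :=
  GRing.isLinear.Build K (wspace n) (wspace n.+1) *:%R (insert j) (insert_is_linear j).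

Lemma mem_insert (j : J) (v : wspace n.+1) :
  (forall phi : {ffun 'I_n.+1 -> J}, phi ord_max != j -> v phi = 0) -> v \in limg (linfun (insert j)).
Proof.
move=> v0.
have -> : v = linfun (insert j) [ffun phi => v (word_ext phi j)].
  rewrite lfunE; apply/ffunP => phi; rewrite !ffunE /=.
  by have [<-|/v0->] := eqVneq; rewrite ?mul0r // word_resK mul1r.
exact: memv_img (memvf _).
Qed.

Lemma big_lift (R : Type) (idx : R) (op : Monoid.com_law idx) (F : 'I_n.+1 -> R) :
  \big[op/idx]_l F l = op (F ord_max) (\big[op/idx]_l F (lift ord_max l)).
Proof.
rewrite big_ord_recr Monoid.mulmC; congr (op _ _).
by apply: eq_bigr => l _; congr F; apply: val_inj; rewrite /= /bump leqNgt ltn_ord.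
Qed.

Lemma insert_tensor j (w : 'I_n.+1 -> J -> K) :
  (forall i, w ord_max i = (i == j)%:R) ->
  insert j (tensor (fun l => w (lift ord_max l))) = tensor w.
Proof.
move=> wj; apply/ffunP => phi; rewrite !ffunE big_lift wj; congr (_ * _).
by apply: eq_bigr => l _; rewrite ffunE.
Qed.

(** Moving the last label from a column [a] of [P] to the column [r].  If [r] is
in [P], replace e_a by (e_a - e_r) + e_r: the first term gives a relation.  If
not, give the vector e_r - e_a to the labels that lie in [r] and e_a - e_r to the
last label.  These labels outnumber the boxes of [r] by one, so in any word with
the right content exactly one of them leaves [r]; when the last label is not
in [r] it is the one, all the others stay, and what remains is the given
tensor. *)
Lemma move_label (d : 'I_n.+1 -> I * J) (phi chi : {ffun 'I_n.+1 -> J})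
    (X : {set 'I_n.+1}) (P : {set J}) (r : J) :
  ord_max \notin X -> phi ord_max \in P ->
  {in X, forall l, (phi l \in P) && (chi l \in P)} ->
  (count_boxes d P < #|X|.+1 + #|full_rows d (r |: P)|)%N ->
  tensor (diff_vec K phi chi X) \in (word_relations K d + limg (linfun (insert r)))%VS.
Proof.
set a := phi ord_max => nX aP XP lt.
suff [u uR vu] : exists2 u, u \in word_relations K d & forall f, ~~ overfull d f ->
    f ord_max != r -> tensor (diff_vec K phi chi X) f = u f.
  move: (tensor _) vu => v vu; pose v1 : wspace n.+1 := [ffun f : {ffun 'I_n.+1 -> J} =>
    (f ord_max == r)%:R * (v f - u f)].
  have -> : v = u + (v - u - v1) + v1 by rewrite -addrA subrK addrC subrK.
  apply: memv_add; last by apply: mem_insert => f /negPf fr; rewrite ffunE fr mul0r.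
  rewrite rpredD //; apply: overfull_relation => f nov; rewrite !ffunE.
  have [e|fr] := eqVneq; first by rewrite mul1r subrr.
  by rewrite mul0r subr0 vu // subrr.
(* The labels sitting in column r, empty when r is in P; X' and chi' encode the
   relation described above. *)
pose Xr := [set l | (l \notin X) && (phi l == r) && (r \notin P)].
pose X' := ord_max |: X :|: Xr.
pose chi' : {ffun 'I_n.+1 -> J} :=
  [ffun l => if l \in Xr then a else if l == ord_max then r else chi l].
have nXr : ord_max \notin Xr.
  by rewrite inE nX /= -/a; case: eqP => [<-|//]; rewrite aP.
have dis : [disjoint ord_max |: X & Xr].
  rewrite disjoint_subset; apply/subsetP => l; rewrite !inE => /orP[/eqP->|->//].
  by have := nXr; rewrite !inE.
have cX' : #|X'| = (#|X|.+1 + #|Xr|)%N.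
  by rewrite cardsU (eqP (_ : _ :&: _ == set0)) ?cards0 ?subn0 ?cardsU1 ?nX // setI_eq0.
have bal : #|Xr| = (if r \in P then 0%N else count_boxes d [set r]) ->
    balanced d phi chi' X'.
  move=> cXr; apply/existsP; exists (r |: P); apply/and3P; split.
  - by apply/set0Pn; exists r; rewrite !inE eqxx.
  - apply/forall_inP => l; rewrite /X' !in_setU !in_set1 ffunE.
    have [lr|lr] := boolP (l \in Xr).
      by move: lr; rewrite inE => /andP[/andP[_ ->] _] _; rewrite aP orbT.
    have [->|ln] := eqVneq l ord_max; first by rewrite -/a aP eqxx !orbT.
    rewrite /= orbF => lX.
    by have /andP[-> ->] := XP l lX; rewrite !orbT.
  - rewrite cX' cXr; case: ifP => rP.
      rewrite addn0; apply: leq_trans lt; rewrite ltnS.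
      by apply: subset_leq_card; apply/subsetP => k; rewrite !inE => /orP[/eqP->|].
    apply: leq_ltn_trans (_ : count_boxes d [set r] + count_boxes d P < _)%N.
      rewrite /count_boxes; have -> : [set k | (d k).2 \in r |: P] =
        [set k | (d k).2 \in [set r]] :|: [set k | (d k).2 \in P].
        by apply/setP => k; rewrite !inE.
      by rewrite cardsU leq_subr.
    by rewrite addnAC addnC ltn_add2r.
(* If Xr does not fill column r, no word with the right content occurs. *)
have [cXr|ne] := eqVneq #|Xr| (if r \in P then 0%N else count_boxes d [set r]); last first.
  exists 0; first exact: rpred0.
  move=> f nov fr; rewrite ffunE [RHS]ffunE.
  have rP : r \notin P.
    apply/negP => rP; case/eqP: ne; rewrite rP; apply/eqP.
    by rewrite cards_eq0; apply/eqP/setP => l; rewrite !inE rP andbF.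
  apply/eqP; rewrite prodf_seq_eq0 /=; apply: contraR ne.
  rewrite -all_predC => /allP nz; rewrite (negPf rP).
  rewrite -(not_overfull_content nov); apply/eqP; apply: eq_card => l; rewrite !inE rP andbT.
  have := nz l (mem_index_enum _); rewrite /=.
  have [lX|lX] /= := boolP (l \in X).
    have /andP[p c] := XP l lX => nz_l; apply/esym/negbTE; apply: contraNneq nz_l => ->.
    by rewrite (diff_vec_out _ X p c) ?eqxx.
  rewrite /diff_vec (negPf lX) mul0r subr0; case: (eqVneq (f l) (phi l)) => [->|] //.
  by rewrite eqxx.
exists (tensor (diff_vec K phi chi' X')); first exact/balanced_relation/bal.
move=> f nov fr; rewrite !ffunE.
have [/forall_inP all_r|] := boolP [forall l in Xr, f l == r].
  apply: eq_bigr => l _; rewrite /diff_vec ffunE.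
  have [lr|lr] := boolP (l \in Xr).
    rewrite (eqP (all_r l lr)) /X' in_setU lr orbT mul1r.
    move: lr; rewrite !inE => /andP[/andP[/negPf-> _] /negPf rP].
    have [e|_] := eqVneq r a; first by rewrite e aP in rP.
    by rewrite mul0r.
  have [->|ln] := eqVneq l ord_max.
    by rewrite (negPf nX) (negPf fr) mulr0 mul0r.
  by rewrite in_setU (negPf lr) orbF in_setU1 (negPf ln).
rewrite negb_forall_in => /exists_inP[l lr flr].
have := lr; rewrite inE => /andP[/andP[lX plr] rP].
rewrite [LHS](bigD1 l) //= {1}/diff_vec (negPf lX) mul0r subr0 (eqP plr) (negPf flr) mul0r.
have [l' fl' l'r] : exists2 l', f l' == r & l' \notin Xr.
  move: cXr; rewrite (negPf rP) -(not_overfull_content nov) => e.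
  apply/exists_inP; apply: contraR flr; rewrite negb_exists_in => /forall_inP sub.
  have : l \in [set l | f l \in [set r]].
    suff -> : [set l | f l \in [set r]] = Xr by [].
    apply/eqP; rewrite eqEcard e leqnn andbT; apply/subsetP => k.
    by rewrite !inE => /sub; rewrite negbK !inE.
  by rewrite !inE.
symmetry; rewrite (bigD1 l') //= /diff_vec ffunE (negPf l'r) (eqP fl').
have [e|ln] := eqVneq l' ord_max; first by move: fr; rewrite -e fl'.
have [l'X|l'X] := boolP (l' \in X).
  have /andP[p c] := XP l' l'X.
  have [e|_] := eqVneq r (phi l'); first by rewrite e p in rP.
  have [e|_] := eqVneq r (chi l'); first by rewrite e c in rP.
  by rewrite mulr0 subrr mul0r.
rewrite in_setU (negPf l'r) orbF in_setU1 (negPf ln) (negPf l'X) mul0r subr0.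
move: l'r; rewrite inE l'X rP andbT /= eq_sym => /negPf->.
by rewrite mul0r.
Qed.

End Extension.

(** * The upper bound *)

Section UpperBound.

Variables (K : fieldType) (I J : finType) (n : nat).

Notation wspace n := {ffun {ffun 'I_n -> J} -> K^o}.

Definition drop_box (d : 'I_n.+1 -> I * J) (k : 'I_n.+1) : 'I_n -> I * J :=
  fun l => d (lift k l).

Variable d : 'I_n.+1 -> I * J.
Hypothesis dI : injective d.

Lemma count_boxes_drop (k : 'I_n.+1) (P : {set J}) :
  (count_boxes d P = ((d k).2 \in P) + count_boxes (drop_box d k) P)%N.
Proof.
rewrite /count_boxes (cardsD1 k) inE; congr (_ + _)%N.
rewrite -(card_imset _ (@lift_inj _ k)); apply: eq_card => l.
rewrite !inE; have [l' ->|->] := unliftP k l.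
  by rewrite eq_sym neq_lift mem_imset ?inE //; apply: lift_inj.
rewrite eqxx /=; apply/esym/imsetP => -[l' _ /eqP]; by rewrite (negPf (neq_lift _ _)).
Qed.

Lemma codom_drop (k : 'I_n.+1) b : b \in codom (drop_box d k) = (b != d k) && (b \in codom d).
Proof.
apply/codomP/andP => [[l ->]|[bk /codomP[l bl]]].
  by rewrite /drop_box codom_f (inj_eq dI) eq_sym neq_lift.
move: bk; rewrite bl; have [l' ->|->] := unliftP k l; last by rewrite eqxx.
by exists l'.
Qed.

Lemma full_rows_drop_sub (k : 'I_n.+1) (P : {set J}) : full_rows (drop_box d k) P \subset full_rows d P.
Proof.
apply/subsetP => i; rewrite !inE => /forall_inP iP; apply/forall_inP => j jP.
by have := iP j jP; rewrite codom_drop => /andP[].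
Qed.

Lemma full_rows_drop_lt (k : 'I_n.+1) (P : {set J}) :
  (d k).2 \in P -> (d k).1 \in full_rows d P ->
  (#|full_rows (drop_box d k) P| < #|full_rows d P|)%N.
Proof.
move=> kP kC; rewrite [ltnRHS](cardsD1 (d k).1) kC ltnS; apply: subset_leq_card.
rewrite subsetD1 full_rows_drop_sub inE; apply/negP => /forall_inP/(_ _ kP).
by rewrite codom_drop -surjective_pairing eqxx.
Qed.

(** The rows of such a [P] and all the columns containing them form a maximal
rectangle, and every maximal rectangle arises in this way. *)
Definition hits (s : seq 'I_n.+1) :=
  forall P, P != set0 -> full_rows d P != set0 ->
    exists2 k, k \in s & (d k).1 \in full_rows d P /\
      forall i, i \in full_rows d P -> (i, (d k).2) \in codom d.

Definition special_order (s : seq 'I_n.+1) :=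
  pairwise (fun k k' => ((d k).1, (d k').2) \notin codom d) s.

Definition insert_span (s : seq 'I_n.+1) : {vspace wspace n.+1} :=
  (word_relations K d + \sum_(k <- s) limg (linfun (@insert K J n (d k).2)))%VS.

Lemma sub_insert_span s k : k \in s ->
  (word_relations K d + limg (linfun (@insert K J n (d k).2)) <= insert_span s)%VS.
Proof.
move=> ks; apply: addvS => //; rewrite (big_rem k) //=; exact: addvSl.
Qed.

Lemma full_rows_setU1 (P : {set J}) r : 
  (forall i, i \in full_rows d P -> (i, r) \in codom d) ->
  full_rows d (r |: P) = full_rows d P.
Proof.
move=> Pr; apply/setP => i; apply/idP/idP => [|iP].
  rewrite !inE => /forall_inP iP; apply/forall_inP => j jP.
  by apply: iP; rewrite !inE jP orbT.
have := iP; rewrite !inE => /forall_inP iPP; apply/forall_inP => j.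
by rewrite !inE => /orP[/eqP->|/iPP//]; apply: Pr.
Qed.

(** A column [a] is contained in the column of some box of [s], and the labels
can be moved there by the relation for a single label of [a]. *)
Lemma insert_span_full s : hits s -> (fullv <= insert_span s)%VS.
Proof.
move=> hs; apply/subvP => v _; rewrite [v]words_expand.
apply: rpred_sum => phi _; apply: rpredZ.
set a := phi ord_max.
have [c0|c0] := eqVneq (full_rows d [set a]) set0.
  apply: (subvP (addvSl _ _)); apply: overfull_relation => f nov; rewrite tensor_word.
  case: eqVneq => // fphi; move: (not_overfull_content nov [set a]).
  have -> : count_boxes d [set a] = 0%N.
    apply: eq_card0 => k; rewrite !inE; apply/negP => /eqP dk.
    have : (d k).1 \in full_rows d [set a].
      rewrite inE; apply/forall_inP => j; rewrite inE => /eqP->.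
      by rewrite -dk -surjective_pairing codom_f.
    by rewrite c0 inE.
  by move/card0_eq/(_ ord_max); rewrite !inE fphi eqxx.
have [|k ks [_ kc]] := hs [set a] _ c0; first by apply/set0Pn; exists a; rewrite inE.
apply: (subvP (sub_insert_span ks)).
have -> : tensor (word_vec K phi) = tensor (diff_vec K phi phi set0).
  apply/ffunP => f; rewrite !ffunE; apply: eq_bigr => l _.
  by rewrite /diff_vec /word_vec inE mul0r subr0.
apply: (@move_label _ _ _ _ _ _ _ _ [set a]); rewrite ?inE //.
  by move=> l; rewrite in_set0.
rewrite (full_rows_setU1 kc) cards0 add1n ltnS.
have inj : {in [set k | (d k).2 \in [set a]] &, injective (fun k => (d k).1)}.
  move=> x x'; rewrite !inE => /eqP e1 /eqP e2 e.
  by apply: dI; move: e1 e2 e; case: (d x) => ? ?; case: (d x') => ? ? /= -> -> ->.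
rewrite /count_boxes -(card_in_imset inj); apply: subset_leq_card; apply/subsetP => i.
case/imsetP => x; rewrite inE => xa ->; rewrite inE; apply/forall_inP => j.
rewrite inE => /eqP->; move: xa; rewrite inE => /eqP<-.
by rewrite -surjective_pairing codom_f.
Qed.

(** A relation of [drop_box d k] on columns [P] is a relation of [d] unless the
column of [d k] is in [P] and its row is not full on [P].  In that case the
inequality lacks exactly one label, which the last label provides by being moved
to the column of the box [k'] that hits the rows full on [P].  This box comes
after [k], because the row of [k'] meets the column of [d k].  If no row is full
on [P], the labels confined to [P] outnumber its boxes. *)
Lemma insert_relations_sub s1 k s2 : hits (s1 ++ k :: s2) -> special_order (s1 ++ k :: s2) ->
  (linfun (@insert K J n (d k).2) @: word_relations K (drop_box d k) <= insert_span s2)%VS.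
Proof.
move=> hs; rewrite /special_order pairwise_cat => /and3P[/allrelP s1s _ /= /andP[_ _]].
rewrite limgD subv_add; apply/andP; split; rewrite limg_span; apply/span_subvP => v;
  case/mapP => x /imageP[t bt ->] ->; rewrite lfunE /=; move: t bt {x}; last first.
  move=> phi /existsP[j lt].
  apply: (subvP (addvSl _ _)); apply: overfull_relation => f nov; rewrite ffunE.
  have [fm|_] := eqVneq; last by rewrite mul0r.
  rewrite mul1r tensor_word; case: eqVneq => // wf.
  move: (not_overfull_content nov [set j]) lt; rewrite (count_boxes_drop k) => cf.
  suff -> : #|[set l | phi l == j]| = count_boxes (drop_box d k) [set j] by rewrite ltnn.
  apply: (@addnI ((d k).2 \in [set j])).
  rewrite -cf [RHS](cardsD1 ord_max) [in RHS]inE fm; congr (_ + _)%N.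
  rewrite -(card_imset _ (@lift_inj _ ord_max)); apply: eq_card => l.
  rewrite !inE; have [l' ->|->] := unliftP ord_max l; last first.
    rewrite eqxx /=; apply/imsetP => -[l' _ /eqP]; by rewrite (negPf (neq_lift _ _)).
  rewrite eq_sym neq_lift mem_imset ?inE; last exact: lift_inj.
  by rewrite -wf ffunE.
move=> -[[phi0 chi0] X0] /= bal.
set a := (d k).2; pose X := lift ord_max @: X0.
pose phi := word_ext phi0 a; pose chi := word_ext chi0 a.
have nX : ord_max \notin X.
  by apply/imsetP => -[l _ /eqP]; rewrite (negPf (neq_lift _ _)).
have mX l : (lift ord_max l \in X) = (l \in X0) by rewrite mem_imset //; apply: lift_inj.
have cX : #|X| = #|X0| by rewrite card_imset //; apply: lift_inj.
have -> : tensor (diff_vec K phi0 chi0 X0) =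
    tensor (fun l => diff_vec K phi chi X (lift ord_max l)).
  apply/ffunP => f; rewrite !ffunE; apply: eq_bigr => l _.
  by rewrite /diff_vec mX !word_ext_lift.
rewrite insert_tensor => [|i]; last first.
  by rewrite /diff_vec (negPf nX) mul0r subr0 word_ext_max.
case/existsP: bal => P /and3P[P0 /forall_inP X0P lt].
have XP : {in X, forall l, (phi l \in P) && (chi l \in P)}.
  by move=> _ /imsetP[l lX ->]; rewrite !word_ext_lift X0P.
have [ok|] := boolP ((a \in P) ==> ((d k).1 \in full_rows d P)).
  apply/(subvP (addvSl _ _))/balanced_relation/existsP; exists P; rewrite P0 /= cX.
  apply/andP; split; first by apply/forall_inP.
  rewrite (count_boxes_drop k) -/a.
  have [aP|aP] := boolP (a \in P); last first.
    by apply: leq_trans lt _; rewrite leq_add2l subset_leq_card ?full_rows_drop_sub.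
  move: ok; rewrite aP /= => kC; rewrite add1n.
  by apply: leq_ltn_trans lt _; rewrite ltn_add2l full_rows_drop_lt.
rewrite negb_imply => /andP[aP kC].
have ltX : (count_boxes d P < #|X|.+1 + #|full_rows d P|)%N.
  rewrite (count_boxes_drop k) -/a aP cX addSn ltnS; apply: leq_trans lt _.
  by rewrite leq_add2l subset_leq_card ?full_rows_drop_sub.
have [C0|C0] := eqVneq (full_rows d P) set0.
  apply: (subvP (addvSl _ _)); apply: overfull_relation => f nov; rewrite ffunE.
  apply/eqP; rewrite prodf_seq_eq0 /=; apply: contraTT ltX.
  rewrite -all_predC => /allP nz; rewrite C0 cards0 addn0 -(not_overfull_content nov) -leqNgt.
  have -> : (#|X|.+1 = #|ord_max |: X|)%N by rewrite cardsU1 nX.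
  apply: subset_leq_card; apply/subsetP => l; rewrite !inE => lX.
  have := nz l (mem_index_enum _); rewrite /=; apply: contraNT => flP.
  case/orP: lX => [/eqP lm|lX]; last first.
    by have /andP[p c] := XP l lX; rewrite (diff_vec_out _ _ p c).
  rewrite /diff_vec lm (negPf nX) mul0r subr0 word_ext_max.
  have [e|_] := eqVneq (f ord_max) a; last by rewrite eqxx.
  by move: flP; rewrite lm e aP.
have [k' k's [k'C k'r]] := hs P P0 C0.
have aC : ((d k').1, a) \in codom d.
  by move: k'C; rewrite inE => /forall_inP; apply.
have ks2 : k' \in s2.
  move: k's; rewrite mem_cat inE => /or3P[k's1|/eqP e|//].
    by have := s1s k' k k's1 (mem_head _ _); rewrite aC.
  by move: kC; rewrite -e k'C.
apply: (subvP (sub_insert_span ks2)); apply: (@move_label _ _ _ _ _ _ _ _ P) => //.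
  by rewrite word_ext_max.
by rewrite full_rows_setU1.
Qed.

(** The spans over the tails of [s] filter the space of words, and the
contribution of [k] is a quotient of the words modulo the relations of
[drop_box d k]. *)
Lemma codim_word_relations s : hits s -> special_order s ->
  (\dim {:wspace n.+1} <= \dim (word_relations K d) +
     \sum_(k <- s) (\dim {:wspace n} - \dim (word_relations K (drop_box d k))))%N.
Proof.
move=> hs sp; apply: leq_trans (dimvS (insert_span_full hs)) _.
have: exists s1, s1 ++ s = s by exists [::].
move: {1 3 4}s => s2 [s1 es]; elim: s2 s1 es => [|k s2 IH] s1 es.
  by rewrite /insert_span !big_nil addv0 addn0.
have {}IH := IH (rcons s1 k); rewrite cat_rcons in IH; have {}IH := IH es.
have -> : insert_span (k :: s2) = (insert_span s2 + limg (linfun (@insert K J n (d k).2)))%VS.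
  by rewrite /insert_span big_cons -addvA; congr (_ + _)%VS; rewrite addvC.
have sub : (linfun (@insert K J n (d k).2) @: word_relations K (drop_box d k) <= insert_span s2)%VS.
  by apply: (@insert_relations_sub s1); rewrite es.
apply: leq_trans (dim_add_quotient sub) _.
by rewrite big_cons addnCA addnC leq_add2l.
Qed.

End UpperBound.

(** * Tableaux and words *)

Section Transport.

Variables (A B : finType) (f : A -> B) (g : B -> A).
Hypotheses (fK : cancel f g) (gK : cancel g f).

Fact transport_perm_subproof (s : {perm A}) : injective (fun x => f (s (g x))).
Proof. by move=> x y /(can_inj fK)/perm_inj/(can_inj gK). Qed.

Definition transport_perm (s : {perm A}) : {perm B} := perm (@transport_perm_subproof s).

Lemma transport_permE s x : transport_perm s x = f (s (g x)).
Proof. by rewrite permE. Qed.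

Lemma transport_tperm x y : transport_perm (tperm x y) = tperm (f x) (f y).
Proof.
apply/permP => z; rewrite transport_permE; apply: (can_inj gK); rewrite fK.
case: tpermP => [<-|<-|zx zy]; rewrite ?gK ?tpermL ?tpermR ?fK //.
by rewrite tpermD // -[z in _ != z]gK (can_eq fK) eq_sym; apply/eqP.
Qed.

Lemma transport_permM s t : transport_perm (s * t)%g = (transport_perm s * transport_perm t)%g.
Proof. by apply/permP => z; rewrite permM !transport_permE permM fK. Qed.

Lemma transport_perm1 : transport_perm 1%g = 1%g.
Proof. by apply/permP => z; rewrite transport_permE !perm1 gK. Qed.

(** Both signs count the factors of a product of transpositions. *)
Lemma odd_transport_perm (s : {perm A}) : odd_perm (transport_perm s) = odd_perm s.
Proof.
have [ts -> /allP tsP] := prod_tpermP s; elim: ts tsP => [|t ts IH] tsP.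
  by rewrite big_nil transport_perm1 !odd_perm1.
rewrite big_cons transport_permM !odd_permM IH => [|u uts]; last first.
  by apply: tsP; rewrite inE uts orbT.
by rewrite transport_tperm !odd_tperm (can_eq fK).
Qed.

End Transport.

Section Bridge.

Variables (K : fieldType) (I J : finType) (r : posnat -> I) (c : posnat -> J).
Variables (D : diagram) (n : nat).

(** Rows and columns are numbered in finite types by [r] and [c], which need to
separate only the rows and columns of the diagram. *)
Definition row_inj (D : diagram) := forall x y : box, x \in D -> y \in D -> r x.1 = r y.1 -> x.1 = y.1.
Definition col_inj (D : diagram) := forall x y : box, x \in D -> y \in D -> c x.2 = c y.2 -> x.2 = y.2.

Variables (e : 'I_n -> D) (e' : D -> 'I_n).
Hypotheses (eK : cancel e e') (e'K : cancel e' e).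
Hypotheses (rI : row_inj D) (cI : col_inj D).

Definition boxes (l : 'I_n) : I * J := (r (row_of (e l)), c (col_of (e l))).

Lemma boxes_inj : injective boxes.
Proof.
move=> k l [/(rI (fsvalP _) (fsvalP _)) e1 /(cI (fsvalP _) (fsvalP _)) e2].
apply: (can_inj eK); apply: val_inj; move: e1 e2.
by rewrite /=; case: (fsval (e k)) => ? ?; case: (fsval (e l)) => ? ? /= -> ->.
Qed.

Lemma codom_boxes (b b' : box) : b \in D -> b' \in D ->
  ((r b.1, c b'.2) \in codom boxes) = ((b.1, b'.2) \in D).
Proof.
move=> bD b'D; apply/codomP/idP => [[k [rk ck]]|bb'].
  have := rI bD (fsvalP (e k)) rk; have := cI b'D (fsvalP (e k)) ck.
  by move=> -> ->; rewrite -surjective_pairing fsvalP.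
by exists (e' [` bb']%fset); rewrite /boxes e'K.
Qed.

Fact label_perm_subproof (T : itab D n) : injective (fun l => val T (e l)).
Proof. by move=> k l /(injectiveP _ (valP T))/(can_inj eK). Qed.

(** Read through the enumeration [e] of the boxes, a tableau is a permutation of
the labels; its sign depends on [e] only by a global factor. *)
Definition label_perm (T : itab D n) : 'S_n := perm (@label_perm_subproof T).

Lemma label_permE T l : label_perm T l = val T (e l).
Proof. by rewrite permE. Qed.

Fact tab_of_subproof (p : 'S_n) : injectiveb [ffun x : D => p (e' x)].
Proof. by apply/injectiveP => x y; rewrite !ffunE => /perm_inj/(can_inj e'K). Qed.

Definition tab_of (p : 'S_n) : itab D n := Sub [ffun x : D => p (e' x)] (tab_of_subproof p).

Lemma tab_ofK : cancel tab_of label_perm.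
Proof. by move=> p; apply/permP => l; rewrite label_permE /= ffunE eK. Qed.

Lemma label_permK : cancel label_perm tab_of.
Proof. by move=> T; apply/val_inj/ffunP => x; rewrite /= ffunE label_permE e'K. Qed.

(** The label [l] is in the box numbered by the preimage of [l]. *)
Definition col_word (T : itab D n) : {ffun 'I_n -> J} := [ffun l => (boxes ((label_perm T)^-1%g l)).2].
Definition row_word (T : itab D n) : {ffun 'I_n -> I} := [ffun l => (boxes ((label_perm T)^-1%g l)).1].

Definition box_perm : {perm D} -> 'S_n := transport_perm e'K eK.

Lemma box_permE s l : box_perm s l = e' (s (e l)).
Proof. exact: transport_permE. Qed.

Lemma label_perm_tab_perm T s : label_perm (tab_perm T s) = (box_perm s * label_perm T)%g.
Proof. by apply/permP => l; rewrite permM !label_permE box_permE /= ffunE e'K. Qed.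

Lemma odd_label_perm T s : odd_perm (label_perm (tab_perm T s)) = odd_perm s (+) odd_perm (label_perm T).
Proof. by rewrite label_perm_tab_perm odd_permM odd_transport_perm. Qed.

Lemma col_word_tab_perm T s : (col_word (tab_perm T s) == col_word T) = (s \in col_group D).
Proof.
rewrite inE; apply/eqP/forallP => [/ffunP cw x|sC].
  apply/eqP; have := cw (val T (s x)); rewrite !ffunE label_perm_tab_perm invMg permM.
  have -> : ((label_perm T)^-1)%g (val T (s x)) = e' (s x).
    by apply/eqP; rewrite (canF_eq (permKV _)) label_permE e'K.
  have -> : ((box_perm s)^-1)%g (e' (s x)) = e' x.
    by apply/eqP; rewrite (canF_eq (permKV _)) box_permE e'K.
  by rewrite /boxes !e'K /= => /(cI (fsvalP _) (fsvalP _)).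
apply/ffunP => l; rewrite !ffunE label_perm_tab_perm invMg permM.
set k := ((label_perm T)^-1)%g l; rewrite /boxes /=; congr c.
rewrite -[in RHS](permKV (box_perm s) k) box_permE e'K.
by rewrite (eqP (sC _)).
Qed.

Lemma row_word_tab_perm T s : (row_word (tab_perm T s) == row_word T) = (s \in row_group D).
Proof.
rewrite inE; apply/eqP/forallP => [/ffunP cw x|sC].
  apply/eqP; have := cw (val T (s x)); rewrite !ffunE label_perm_tab_perm invMg permM.
  have -> : ((label_perm T)^-1)%g (val T (s x)) = e' (s x).
    by apply/eqP; rewrite (canF_eq (permKV _)) label_permE e'K.
  have -> : ((box_perm s)^-1)%g (e' (s x)) = e' x.
    by apply/eqP; rewrite (canF_eq (permKV _)) box_permE e'K.
  by rewrite /boxes !e'K /= => /(rI (fsvalP _) (fsvalP _)).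
apply/ffunP => l; rewrite !ffunE label_perm_tab_perm invMg permM.
set k := ((label_perm T)^-1)%g l; rewrite /boxes /=; congr r.
rewrite -[in RHS](permKV (box_perm s) k) box_permE e'K.
by rewrite (eqP (sC _)).
Qed.

Lemma tab_perm_bij (T : itab D n) : bijective (tab_perm T).
Proof.
exists (fun U => transport_perm eK e'K (label_perm U * (label_perm T)^-1)%g) => [s|U].
  rewrite label_perm_tab_perm mulgK; apply/permP => x.
  by rewrite transport_permE box_permE !e'K.
apply: (can_inj label_permK); rewrite label_perm_tab_perm.
suff -> : box_perm (transport_perm eK e'K (label_perm U * (label_perm T)^-1)%g) = (label_perm U * (label_perm T)^-1)%g by rewrite mulgKV.
by apply/permP => l; rewrite box_permE transport_permE !eK.
Qed.

Lemma tab_perm_inj (T : itab D n) : injective (tab_perm T).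
Proof. exact: bij_inj (tab_perm_bij T). Qed.

Lemma card_col_word_fiber T : #|[set U | col_word U == col_word T]| = #|col_group D|.
Proof.
rewrite -(card_imset _ (@tab_perm_inj T)); apply: eq_card => U.
have [s sK Ks] := tab_perm_bij T; rewrite -[U]Ks inE col_word_tab_perm.
by rewrite mem_imset //; apply: tab_perm_inj.
Qed.

(** The permutations with a nonzero term in the determinant are the fillings [V]
with the columns of [T] and the rows of [U]. *)
Lemma pairing_words T U :
  pairing boxes (word_vec K (col_word T)) (word_vec K (row_word U)) =
  \sum_(V | (col_word V == col_word T) && (row_word V == row_word U)) (-1) ^+ odd_perm (label_perm V).
Proof.
rewrite /pairing /determinant [RHS]big_mkcond /=.
have bij : bijective (fun V => (label_perm V)^-1%g).
  by exists (fun p => tab_of p^-1%g) => V; rewrite ?invgK ?label_permK // tab_ofK invgK.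
rewrite (reindex _ (onW_bij _ bij)) /=; apply: eq_bigr => V _.
rewrite odd_permV; case: ifP => [/andP[/eqP/ffunP cV /eqP/ffunP rV]|].
  rewrite big1 ?mulr1 // => l _; rewrite mxE /word_vec -cV -rV !ffunE !eqxx.
  by rewrite mulr1.
move/negbT; rewrite negb_and => ne.
suff [l ll] : exists l, (pairing_mx boxes (word_vec K (col_word T)) (word_vec K (row_word U)))
   l (((label_perm V)^-1)%g l) = 0 by rewrite (bigD1 l) //= ll mul0r mulr0.
case/orP: ne => ne.
  have /existsP[l nel] : [exists l, col_word V l != col_word T l].
    by rewrite -negb_forall; apply: contra ne => /forallP eqs; apply/eqP/ffunP => l; apply/eqP.
  exists l; rewrite mxE; move: nel; rewrite [col_word V l]ffunE /word_vec => /negPf->.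
  by rewrite mulr0.
have /existsP[l nel] : [exists l, row_word V l != row_word U l].
  by rewrite -negb_forall; apply: contra ne => /forallP eqs; apply/eqP/ffunP => l; apply/eqP.
exists l; rewrite mxE; move: nel; rewrite [row_word V l]ffunE /word_vec => /negPf->.
by rewrite mul0r.
Qed.

Lemma ract_tabvec (T : itab D n) s : Defs.ract (tabvec K T) s = tabvec K (tab_perm T s).
Proof.
rewrite /Defs.ract (bigD1 T) //= ffunE eqxx scale1r big1 ?addr0 // => U /negPf UT.
by rewrite ffunE UT scale0r.
Qed.

Lemma mulCR_tabvec (T : itab D n) : mulCR (tabvec K T) =
  \sum_(s in col_group D) \sum_(t in row_group D)
    (-1) ^+ s *: tabvec K (tab_perm (tab_perm T s) t).
Proof. by apply: eq_bigr => s _; apply: eq_bigr => t _; rewrite !ract_tabvec. Qed.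

(** Applying the column group to [T] produces the fillings [V] with the columns
of [T], with sign, and [U] arises from [V] by a row permutation, in one way, if
and only if the rows agree. *)
Lemma mulCR_tabvec_pairing T U : mulCR (tabvec K T) U =
  (-1) ^+ odd_perm (label_perm T) *
    pairing boxes (word_vec K (col_word T)) (word_vec K (row_word U)).
Proof.
rewrite pairing_words mulCR_tabvec sum_ffunE mulr_sumr big_mkcondr /=.
have bij := tab_perm_bij T.
rewrite (reindex _ (onW_bij _ bij)) /=; apply: eq_big => s; first by rewrite col_word_tab_perm.
move=> sC; rewrite sum_ffunE odd_label_perm signr_addb mulrCA -signr_addb addbb mulr1.
have [t _ Kt] := tab_perm_bij (tab_perm T s).
rewrite -[U]Kt; set u := t U.
case: ifP => [uR|/negbT uR]; last first.
  rewrite big1 // => t' t'R; rewrite ffunE [tabvec _ _ _]ffunE.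
  rewrite (inj_eq (tab_perm_inj (T := _))).
  have [ut|] := eqVneq; last by rewrite scaler0.
  by move: uR; rewrite eq_sym row_word_tab_perm ut t'R.
rewrite eq_sym row_word_tab_perm in uR.
rewrite (bigD1 u) //= big1 ?addr0 => [|t' /andP[_ ne]].
  by rewrite ffunE [tabvec _ _ _]ffunE eqxx /GRing.scale /= mulr1.
by rewrite ffunE [tabvec _ _ _]ffunE (inj_eq (tab_perm_inj (T := _))) eq_sym (negPf ne) scaler0.
Qed.

Notation tabs := (tabspace K D n).
Notation words := {ffun {ffun 'I_n -> J} -> K^o}.
Notation rwords := {ffun {ffun 'I_n -> I} -> K^o}.

Lemma tabs_expand (v : tabs) : v = \sum_T v T *: tabvec K T.
Proof.
apply/ffunP => U; rewrite sum_ffunE (bigD1 U) //= ffunE [tabvec _ _ _]ffunE eqxx.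
rewrite big1 ?addr0 => [|T neq]; first by rewrite /GRing.scale /= mulr1.
by rewrite ffunE [tabvec _ _ _]ffunE eq_sym (negPf neq) scaler0.
Qed.

Definition tab_sign (T : itab D n) : K := (-1) ^+ odd_perm (label_perm T).

Lemma tab_sign_sq T : tab_sign T * tab_sign T = 1.
Proof. by rewrite /tab_sign -signr_addb addbb. Qed.

(** The sign makes the one-column relations vanish. *)
Definition to_words (v : tabs) : words := \sum_T (v T * tab_sign T) *: tensor (word_vec K (col_word T)).

Fact to_words_is_linear : linear to_words.
Proof.
move=> k a b; rewrite /to_words scaler_sumr -big_split; apply: eq_bigr => T _ /=.
by rewrite !ffunE mulrDl scalerDl scalerA -mulrA.
Qed.
HB.instance Definition _ := GRing.isLinear.Build K tabs words *:%R to_words to_words_is_linear.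

Lemma to_words_tabvec T : to_words (tabvec K T) = tab_sign T *: tensor (word_vec K (col_word T)).
Proof.
rewrite /to_words (bigD1 T) //= ffunE eqxx mul1r big1 ?addr0 // => U /negPf UT.
by rewrite ffunE UT mul0r scale0r.
Qed.

Lemma mulCR_pairing_map v U : mulCR v U = pairing_map boxes (to_words v) (row_word U).
Proof.
rewrite {1}[v]tabs_expand linear_sum /= sum_ffunE /to_words linear_sum /= sum_ffunE.
apply: eq_bigr => T _; rewrite !linearZ ffunE [RHS]ffunE pairing_map_tensor mulCR_tabvec_pairing.
by rewrite /GRing.scale /= mulrA.
Qed.

Lemma col_word_ex (phi : {ffun 'I_n -> J}) (y : 'I_n -> I -> K) :
  pairing boxes (word_vec K phi) y != 0 -> exists T, col_word T = phi.
Proof.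
move=> nz; suff [p pP] : exists p : 'S_n, forall l, phi l = (boxes (p l)).2.
  by exists (tab_of p^-1%g); apply/ffunP => l; rewrite ffunE tab_ofK invgK pP.
case: (pickP (fun p : 'S_n => [forall l, phi l == (boxes (p l)).2])) => [p /forallP pP|no].
  by exists p => l; apply/eqP.
case/eqP: nz; rewrite /pairing /determinant big1 // => p _.
have /negbT := no p; rewrite negb_forall => /existsP[l /negPf ne].
by rewrite (bigD1 l) //= mxE /word_vec eq_sym ne mulr0 mul0r mulr0.
Qed.

Lemma row_word_ex (rho : {ffun 'I_n -> I}) (w : 'I_n -> J -> K) :
  pairing boxes w (word_vec K rho) != 0 -> exists T, row_word T = rho.
Proof.
move=> nz; suff [p pP] : exists p : 'S_n, forall l, rho l = (boxes (p l)).1.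
  by exists (tab_of p^-1%g); apply/ffunP => l; rewrite ffunE tab_ofK invgK pP.
case: (pickP (fun p : 'S_n => [forall l, rho l == (boxes (p l)).1])) => [p /forallP pP|no].
  by exists p => l; apply/eqP.
case/eqP: nz; rewrite /pairing /determinant big1 // => p _.
have /negbT := no p; rewrite negb_forall => /existsP[l /negPf ne].
by rewrite (bigD1 l) //= mxE /word_vec eq_sym ne !mul0r mulr0.
Qed.

(** Reads off the coefficient of one tableau for each row word; on the image of
[mulCR] no information is lost, because the coefficient of [U] depends only on
the row word of [U]. *)
Definition row_section (g : tabs) : rwords :=
  [ffun rho => if [pick U | row_word U == rho] is Some U then g U else 0].

Fact row_section_is_linear : linear row_section.
Proof.
move=> k a b; apply/ffunP => rho; rewrite !ffunE; case: pickP => [U _|_].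
  by rewrite !ffunE.
by rewrite scaler0 addr0.
Qed.
HB.instance Definition _ := GRing.isLinear.Build K tabs rwords *:%R row_section row_section_is_linear.

Lemma row_section_mulCR v : row_section (mulCR v) = pairing_map boxes (to_words v).
Proof.
apply/ffunP => rho; rewrite ffunE; case: pickP => [U /eqP <-|no].
  by rewrite mulCR_pairing_map.
rewrite ffunE big1 // => phi _.
have [->|nz] := eqVneq (pairing boxes (word_vec K phi) (word_vec K rho)) 0.
  by rewrite mulr0.
by have [U Urho] := row_word_ex nz; have := no U; rewrite Urho eqxx.
Qed.

Lemma lker_mulCR v :
  (v \in lker (linfun (@mulCR K D n))) = (to_words v \in lker (linfun (pairing_map boxes))).
Proof.
rewrite !memv_ker !lfunE /=; apply/eqP/eqP => [e0|e0].
  by rewrite -row_section_mulCR e0 linear0.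
by apply/ffunP => U; rewrite mulCR_pairing_map e0 !ffunE.
Qed.

(** A word that is not the column word of a tableau is in the radical. *)
Lemma pairing_map_lift phi : exists v,
  pairing_map boxes (to_words v) = pairing_map boxes (tensor (word_vec K phi)).
Proof.
case: (pickP (fun T => col_word T == phi)) => [T /eqP <-|no].
  exists (tab_sign T *: tabvec K T); rewrite linearZ /= to_words_tabvec scalerA tab_sign_sq.
  by rewrite scale1r.
exists 0; rewrite linear0 linear0; apply/esym/ffunP => rho.
rewrite pairing_map_tensor ffunE.
have [->//|nz] := eqVneq (pairing boxes (word_vec K phi) (word_vec K rho)) 0.
by have [T Tphi] := col_word_ex nz; have := no T; rewrite Tphi eqxx.
Qed.

(** [row_section] maps S^D isomorphically onto the image of the pairing. *)
Lemma dim_specht_pairing : \dim (specht K D n) = \dim (limg (linfun (pairing_map (K := K) boxes))).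
Proof.
have imW : limg (linfun (pairing_map (K := K) boxes)) = (linfun row_section @: specht K D n)%VS.
  rewrite /specht -limg_comp; apply/eqP; rewrite eqEsubv; apply/andP; split.
    apply/subvP => _ /memv_imgP[v _ ->]; rewrite lfunE /=.
    have -> : pairing_map boxes v =
        \sum_phi v phi *: pairing_map boxes (tensor (word_vec K phi)).
      rewrite {1}[v]words_expand linear_sum; apply: eq_bigr => phi _.
      by rewrite linearZ.
    apply: rpred_sum => phi _; apply: rpredZ.
    have [u uE] := pairing_map_lift phi; rewrite -uE -row_section_mulCR.
    apply/memv_imgP; exists u; first exact: memvf.
    by rewrite comp_lfunE !lfunE.
  apply/subvP => _ /memv_imgP[v _ ->]; rewrite comp_lfunE !lfunE /= row_section_mulCR.
  by apply/memv_imgP; exists (to_words v); rewrite ?memvf ?lfunE.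
apply/eqP; rewrite eqn_leq; apply/andP; split; last first.
  by rewrite imW -(limg_ker_dim (linfun row_section) (specht K D n)) leq_addl.
rewrite imW limg_dim_eq //; apply/eqP; rewrite -subv0; apply/subvP => u.
rewrite memv_cap memv_ker lfunE /= memv0 => /andP[/memv_imgP[v _ ->]].
rewrite lfunE /= row_section_mulCR => /eqP e0; apply/eqP/ffunP => U.
by rewrite mulCR_pairing_map e0 !ffunE.
Qed.

Lemma dim_specht_ker :
  (\dim (specht K D n) + \dim (lker (linfun (pairing_map (K := K) boxes))) = \dim {:words})%N.
Proof. by rewrite dim_specht_pairing addnC -(limg_ker_dim (linfun (pairing_map boxes)) fullv) capfv. Qed.

(** On column words of tableaux [to_words] undoes it, up to the order of the
column group. *)
Definition of_words (g : words) : tabs := [ffun T => tab_sign T * g (col_word T)].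

Fact of_words_is_linear : linear of_words.
Proof.
move=> k a b; apply/ffunP => T; rewrite !ffunE mulrDr; congr (_ + _).
by rewrite /GRing.scale /= mulrCA.
Qed.
HB.instance Definition _ := GRing.isLinear.Build K words tabs *:%R of_words of_words_is_linear.

Lemma pairing_map_to_words_of_words g :
  pairing_map boxes (to_words (of_words g)) = #|col_group D|%:R *: pairing_map boxes g.
Proof.
apply/ffunP => rho; rewrite ffunE [RHS]ffunE [in RHS]ffunE scaler_sumr.
apply: eq_bigr => phi _; rewrite /to_words sum_ffunE.
have [->|nz] := eqVneq (pairing boxes (word_vec K phi) (word_vec K rho)) 0.
  by rewrite !mulr0 scaler0.
rewrite scalerAl; congr (_ * _).
have [T <-] := col_word_ex nz.
transitivity (\sum_(U in [set U | col_word U == col_word T]) g (col_word T)).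
  rewrite [RHS]big_mkcond; apply: eq_bigr => U _.
  rewrite ffunE tensor_word [of_words g U]ffunE inE eq_sym mulrAC tab_sign_sq mul1r.
  by case: eqP => [->|_]; rewrite /GRing.scale /= ?mulr1 ?mulr0.
by rewrite sumr_const card_col_word_fiber scaler_nat.
Qed.

End Bridge.

(** * Removing the box of the last label *)

Lemma pairing_laplace (K : fieldType) (I J : finType) n (d : 'I_n.+1 -> I * J)
    (w : 'I_n.+1 -> J -> K) (y : 'I_n.+1 -> I -> K) :
  pairing d w y = \sum_k (y ord_max (d k).1 * w ord_max (d k).2) *
    ((-1) ^+ (n + k) * pairing (drop_box d k) (fun l => w (lift ord_max l))
                                     (fun l => y (lift ord_max l))).
Proof.
rewrite /pairing (expand_det_row _ ord_max); apply: eq_bigr => k _.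
rewrite mxE /cofactor; congr (_ * (_ * \det _)).
by apply/matrixP => i j; rewrite !mxE.
Qed.

Lemma row_injD (I : finType) (r : posnat -> I) (D : diagram) (b : box) :
  row_inj r D -> row_inj r (D `\ b)%fset.
Proof. by move=> rI x y /fsetD1P[_ xD] /fsetD1P[_ yD]; apply: rI. Qed.

Lemma col_injD (J : finType) (c : posnat -> J) (D : diagram) (b : box) :
  col_inj c D -> col_inj c (D `\ b)%fset.
Proof. by move=> cI x y /fsetD1P[_ xD] /fsetD1P[_ yD]; apply: cI. Qed.

Section Removal.

Variables (K : fieldType) (D : diagram) (n : nat).
Local Open Scope fset_scope.

Section Box.

Variable b : box.

Definition extend_fun (T : itab (D `\ b) n) : {ffun D -> 'I_n.+1} :=
  [ffun x : D => oapp (fun x' : (D `\ b)%fset => lift ord_max (val T x')) ord_max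
                      (insub (fsval x))].

Fact extend_subproof T : injectiveb (extend_fun T).
Proof.
apply/injectiveP => x y; rewrite !ffunE.
case: insubP => [x' _ xE|]; case: insubP => [y' _ yE|] //=.
- move=> /lift_inj/(injectiveP _ (valP T)) xy; apply: val_inj.
  by rewrite /= -xE -yE xy.
- by move=> _ /eqP; rewrite eq_sym (negPf (neq_lift _ _)).
- by move=> _ /eqP; rewrite (negPf (neq_lift _ _)).
- rewrite !in_fsetD1 !fsvalP !andbT !negbK => /eqP yb /eqP xb _.
  by apply: val_inj; rewrite /= xb yb.
Qed.

(** [insub] fails exactly at the box [b], which receives the last label. *)
Definition extend (T : itab (D `\ b) n) : itab D n.+1 := Sub (extend_fun T) (extend_subproof T).

Definition restrict (g : tabspace K D n.+1) : tabspace K (D `\ b) n :=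
  [ffun U => g (extend U)].

Fact restrict_is_linear : linear restrict.
Proof. by move=> k u v; apply/ffunP => U; rewrite !ffunE. Qed.
HB.instance Definition _ := GRing.isLinear.Build K (tabspace K D n.+1)
  (tabspace K (D `\ b) n) *:%R restrict restrict_is_linear.

(** The span of the [e_T] with the last label of [T] in [b]. *)
Definition last_at : {vspace tabspace K D n.+1} :=
  (linfun (@mulCR K D n.+1) @: <<[seq tabvec K (extend T) | T : itab (D `\ b) n]>>)%VS.

Lemma last_at_sub : (last_at <= specht K D n.+1)%VS.
Proof. exact: limgS (subvf _). Qed.

End Box.

Lemma sum_last_at_sub (T : Type) (s : seq T) (b : T -> box) :
  (\sum_(x <- s) last_at (b x) <= specht K D n.+1)%VS.
Proof.
elim/big_ind: _ => [|V1 V2|x _]; rewrite ?sub0v //; last exact: last_at_sub.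
by rewrite subv_add => -> ->.
Qed.

Variables (I J : finType) (r : posnat -> I) (c : posnat -> J).
Hypotheses (rI : row_inj r D) (cI : col_inj c D).
Variables (e : 'I_n.+1 -> D) (e' : D -> 'I_n.+1).
Hypotheses (eK : cancel e e') (e'K : cancel e' e).

Lemma drop_enum (k : 'I_n.+1) : exists (e1 : 'I_n -> D `\ fsval (e k)) e1',
  [/\ cancel e1 e1', cancel e1' e1 & forall l, fsval (e1 l) = fsval (e (lift k l))].
Proof.
have sub l : fsval (e (lift k l)) \in D `\ fsval (e k).
  rewrite in_fsetD1 fsvalP andbT (inj_eq val_inj) (can_eq eK) eq_sym.
  exact: neq_lift.
pose e1 l : D `\ fsval (e k) := [` sub l].
have e1I : injective e1.
  by move=> l l' /(congr1 val)/= /val_inj/(can_inj eK)/lift_inj.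
have [|e1' e1K e1'K] := inj_card_bij e1I; last by exists e1, e1'; split.
rewrite -cardfE card_ord -ltnS.
have := cardfsD1 (fsval (e k)) D; rewrite fsvalP add1n => <-.
by rewrite cardfE -[leqRHS]card_ord -(card_codom (can_inj e'K)) max_card.
Qed.

Section RemovedBox.

Variable k : 'I_n.+1.
Notation b := (fsval (e k)).
Variables (e1 : 'I_n -> D `\ b) (e1' : D `\ b -> 'I_n).
Hypotheses (e1K : cancel e1 e1') (e1'K : cancel e1' e1).
Hypothesis e1E : forall l, fsval (e1 l) = fsval (e (lift k l)).

Lemma boxes_drop l : boxes r c e1 l = drop_box (boxes r c e) k l.
Proof. by rewrite /drop_box /boxes /row_of /col_of e1E. Qed.

Lemma label_perm_extend (T : itab (D `\ b) n) : label_perm eK (extend T) = lift_perm k ord_max (label_perm e1K T).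
Proof.
apply/permP => l; rewrite label_permE /= ffunE; have [l' ->|->] := unliftP k l.
  rewrite -e1E valK /=; first by rewrite lift_perm_lift label_permE.
by rewrite insubF /= ?lift_perm_id // in_fsetD1 eqxx.
Qed.

Lemma col_word_extend (T : itab (D `\ b) n) : col_word r c eK (extend T) = word_ext (col_word r c e1K T) (c b.2).
Proof.
apply/ffunP => l; rewrite !ffunE label_perm_extend lift_permV.
have [l' ->|->] := unliftP ord_max l; last by rewrite lift_perm_id.
by rewrite lift_perm_lift /= ffunE boxes_drop.
Qed.

Lemma row_word_extend (T : itab (D `\ b) n) : row_word r c eK (extend T) = word_ext (row_word r c e1K T) (r b.1).
Proof.
apply/ffunP => l; rewrite !ffunE label_perm_extend lift_permV.
have [l' ->|->] := unliftP ord_max l; last by rewrite lift_perm_id.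
by rewrite lift_perm_lift /= ffunE boxes_drop.
Qed.

(** Only the term of the Laplace expansion at [b] survives.  Its cofactor sign
is cancelled by the change of sign of the label permutation. *)
Lemma restrict_mulCR_extend (T : itab (D `\ b) n) :
  restrict b (mulCR (tabvec K (extend T))) = mulCR (tabvec K T).
Proof.
apply/ffunP => U; rewrite ffunE (mulCR_tabvec_pairing _ eK e'K rI cI).
rewrite (mulCR_tabvec_pairing _ e1K e1'K (row_injD rI) (col_injD cI)).
rewrite label_perm_extend odd_lift_perm col_word_extend row_word_extend pairing_laplace (bigD1 k) //=.
rewrite big1 ?addr0 => [|k' k'k]; last first.
  rewrite /word_vec !word_ext_max -natrM mulnb.
  case: andP => [[/eqP e1eq /eqP e2eq]|_]; last by rewrite mul0r.
  case/eqP: k'k; apply: (boxes_inj eK rI cI (r := r) (c := c)).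
  by rewrite /boxes; rewrite /= in e1eq e2eq; rewrite e1eq e2eq.
rewrite /word_vec !word_ext_max !eqxx mulr1 mul1r mulrA; congr (_ * _).
  rewrite -[(-1) ^+ (n + k)]signr_odd oddD -signr_addb /=; congr (_ ^+ nat_of_bool _).
  by case: (odd n); case: (odd k); case: (odd_perm _).
congr (\det _); apply/matrixP => i j; rewrite !mxE !word_ext_lift.
by rewrite -boxes_drop.
Qed.

Lemma restrict_last_at_enum : (linfun (restrict b) @: last_at b)%VS = specht K (D `\ b) n.
Proof.
rewrite /last_at !limg_span -map_comp; apply/eqP; rewrite eqEsubv; apply/andP; split.
  apply/span_subvP => _ /mapP[_ /imageP[T _ ->] ->] /=; rewrite !lfunE /=.
  rewrite ?lfunE /= restrict_mulCR_extend -[mulCR _](lfunE (@mulCR K _ n)).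
  exact: memv_img (memvf _).
apply/subvP => _ /memv_imgP[v _ ->]; rewrite lfunE /= [v]tabs_expand linear_sum.
apply: rpred_sum => T _; rewrite linearZ; apply: rpredZ; apply: memv_span.
apply/mapP; exists (tabvec K (extend T)); first by apply: image_f.
by rewrite /= !lfunE /= ?lfunE /= restrict_mulCR_extend.
Qed.

End RemovedBox.

Lemma enum_onto (b : box) : b \in D -> exists k, fsval (e k) = b.
Proof. by move=> bD; exists (e' [` bD]); rewrite e'K. Qed.

Lemma restrict_last_at (b : box) : b \in D ->
  (linfun (restrict b) @: last_at b)%VS = specht K (D `\ b) n.
Proof.
move=> /enum_onto[k <-]; have [e1 [e1' [e1K e1'K e1E]]] := drop_enum k.
exact: restrict_last_at_enum e1K e1'K e1E.
Qed.

Lemma row_word_extend_max (b : box) (U : itab (D `\ b) n) : b \in D ->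
  row_word r c eK (extend U) ord_max = r b.1.
Proof.
move=> bD; have [k kb] := enum_onto bD; move: U; rewrite -kb => U.
have [e1 [e1' [e1K e1'K e1E]]] := drop_enum k.
by rewrite (row_word_extend e1K e1E) word_ext_max.
Qed.

Lemma col_word_extend_max (b : box) (U : itab (D `\ b) n) : b \in D ->
  col_word r c eK (extend U) ord_max = c b.2.
Proof.
move=> bD; have [k kb] := enum_onto bD; move: U; rewrite -kb => U.
have [e1 [e1' [e1K e1'K e1E]]] := drop_enum k.
by rewrite (col_word_extend e1K e1E) word_ext_max.
Qed.

(** A column and a row permutation move the last label from [b] to [b'] only
through the box in the row of [b'] and the column of [b]. *)
Lemma restrict_last_at0 (b b' : box) : b \in D -> b' \in D -> (b'.1, b.2) \notin D ->
  (linfun (restrict b') @: last_at b)%VS = 0%VS.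
Proof.
move=> bD b'D bb'; apply/eqP; rewrite -subv0 /last_at !limg_span -map_comp.
apply/span_subvP => _ /mapP[_ /imageP[T _ ->] ->] /=; rewrite !lfunE /= ?lfunE /= memv0.
apply/eqP/ffunP => U; rewrite ffunE [RHS]ffunE (mulCR_tabvec_pairing _ eK e'K rI cI).
rewrite pairing_laplace big1 ?mulr0 // => k _.
rewrite /word_vec row_word_extend_max // col_word_extend_max // -natrM mulnb.
case: andP => [[/eqP rk /eqP ck]|_]; last by rewrite mul0r.
case/negP: bb'; have := fsvalP (e k).
have := rI (fsvalP (e k)) b'D rk; have := cI (fsvalP (e k)) bD ck.
by case: (fsval (e k)) => ? ? /= -> ->.
Qed.

End Removal.

(** [A] is in the kernel of [f] on the sum. *)
Lemma dim_add_kernel (K : fieldType) (U V : vectType K) (f : 'Hom(U, V))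
    (A B : {vspace U}) :
  (f @: A = 0)%VS -> (\dim A + \dim (f @: B) <= \dim (A + B))%N.
Proof.
move=> fA; rewrite -(limg_ker_dim f (A + B)) leq_add //; apply: dimvS.
  rewrite subv_cap addvSl /= ; apply/subvP => v vA.
  by rewrite memv_ker -memv0 -fA memv_img.
by rewrite limgS // addvSr.
Qed.

(** * The lower bound *)

Section LowerBound.

Variables (K : fieldType) (D : diagram) (n : nat).
Variables (I J : finType) (r : posnat -> I) (c : posnat -> J).
Hypotheses (rI : row_inj r D) (cI : col_inj c D).
Variables (e : 'I_n.+1 -> D) (e' : D -> 'I_n.+1).
Hypotheses (eK : cancel e e') (e'K : cancel e' e).
Local Open Scope fset_scope.

Definition cross_free (b b' : box) := (b.1, b'.2) \notin D.

(** Adding the spans of [e_T] from the last box of [s] to the first, restriction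
at the current box kills what has been added before and maps the new span onto
S^(D minus b).  The space [A] leaves room for a further vector at any place in
this triangular system. *)
Lemma lower_bound (s : seq box) (A : {vspace tabspace K D n.+1}) :
  {subset s <= D} -> pairwise cross_free s ->
  (forall b, b \in s -> (linfun (@restrict K D n b) @: A)%VS = 0%VS) ->
  (\dim A + \sum_(b <- s) \dim (specht K (D `\ b) n) <=
   \dim (A + \sum_(b <- s) last_at K D n b)%VS)%N.
Proof.
elim: s => [|b s IH] sD sp A0; first by rewrite !big_nil addn0 addv0.
have bD : b \in D by apply: sD; rewrite mem_head.
move: sp => /= /andP[/allP bs sp].
have {}IH : (\dim A + \sum_(b <- s) \dim (specht K (D `\ b) n) <=
   \dim (A + \sum_(b <- s) last_at K D n b)%VS)%N.
  apply: IH => // [x xs|x xs]; first by rewrite sD // inE xs orbT.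
  by rewrite A0 // inE xs orbT.
rewrite !big_cons addnCA addnC [(last_at K D n b + _)%VS]addvC addvA.
have r0 : (linfun (@restrict K D n b) @: (A + \sum_(b <- s) last_at K D n b))%VS = 0%VS.
  rewrite limgD A0 ?mem_head // add0v limg_sum big_seq big1 // => b' b's.
  apply: (restrict_last_at0 _ rI cI eK e'K) => //; last exact: bs.
  by apply: sD; rewrite inE b's orbT.
apply: leq_trans (dim_add_kernel _ r0).
by rewrite (restrict_last_at K rI cI eK e'K bD) leq_add2r.
Qed.

Lemma lower_bound0 (s : seq box) : {subset s <= D} -> pairwise cross_free s ->
  (\sum_(b <- s) \dim (specht K (D `\ b) n) <= \dim (\sum_(b <- s) last_at K D n b)%VS)%N.
Proof.
move=> sD sp; have := lower_bound (A := 0%VS) sD sp.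
by rewrite dimv0 add0n add0v; apply=> b _; rewrite limg0.
Qed.

End LowerBound.

(** * Maximal rectangles that are not hit *)

Section RectangleVectors.

Variables (K : fieldType).

(** For a rectangle Q1 x Q2 with a chosen column [j0], labels being identified
with boxes: the boxes in the columns Q2, except those of the rectangle in
[j0]. *)
Definition rect_labels (I J : finType) n (d : 'I_n -> I * J) (Q1 : {set I}) (Q2 : {set J})
    (j0 : J) : {set 'I_n} :=
  [set k | ((d k).2 \in Q2) && ~~ (((d k).1 \in Q1) && ((d k).2 == j0))].

(** The box of a label in [rect_labels] lies in some column [j] of Q2, and the
label gets the vector e_j - e_j' in H(Q2).  For a box of the rectangle [j'] is
[j0]; otherwise it is a column of Q2 that the row of the box does not meet, so
that only e_j is visible in this row. *)
Definition rect_vec (I J : finType) n (d : 'I_n -> I * J) (Q1 : {set I}) (Q2 : {set J})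
    (j0 : J) (js : 'I_n -> J) (k : 'I_n) (j : J) : K :=
  (j == (d k).2)%:R - (k \in rect_labels d Q1 Q2 j0)%:R *
    (j == if (d k).1 \in Q1 then j0 else js k)%:R.

(** Maximality of the rectangle Q1 x Q2 with respect to rows. *)
Definition escapes (I J : finType) n (d : 'I_n -> I * J) (Q1 : {set I}) (Q2 : {set J})
    (js : 'I_n -> J) :=
  forall k, (d k).2 \in Q2 -> (d k).1 \notin Q1 ->
    js k \in Q2 /\ ((d k).1, js k) \notin codom d.

(** The labels with a vector in H(Q2) are one too few for [pairing_eq0].  The last
label, whose vector is e_(j0), is added to them: its row of the matrix sums to
zero on the rows Q1 because [y] vanishes there. *)
Lemma rect_vec0 (I J : finType) n (d : 'I_n.+1 -> I * J) (Q1 : {set I}) (Q2 : {set J})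
    (js : 'I_n.+1 -> J) (k0 : 'I_n.+1) (s : 'S_n.+1) (y : 'I_n.+1 -> I -> K) :
  injective d -> (d k0).1 \in Q1 -> (d k0).2 \in Q2 -> s ord_max = k0 ->
  (forall i j, i \in Q1 -> j \in Q2 -> (i, j) \in codom d) ->
  escapes d Q1 Q2 js ->
  (forall i, i \in Q1 -> y ord_max i = 0) ->
  pairing d (fun l => rect_vec d Q1 Q2 (d k0).2 js (s l)) y = 0.
Proof.
move=> dI k1 k2 sk Q12 esc y0; set j0 := (d k0).2; set A := rect_labels d Q1 Q2 j0.
have comQ : full_rows d Q2 = Q1.
  apply/setP => i; rewrite inE; apply/forall_inP/idP => [iQ|iQ1 j jQ2]; last exact: Q12.
  have /codomP[k dk] := iQ _ k2; apply: contraT => niQ.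
  have [] := esc k; rewrite -dk //= => jsQ.
  by rewrite iQ.
have k0A : k0 \notin A by rewrite inE k1 eqxx /= andbF.
apply: (@pairing_eq0 _ _ _ _ _ _ _ (ord_max |: s @^-1: A) Q2 dI).
- by apply/set0Pn; exists j0.
- move=> l j lX jQ2; rewrite /rect_vec -/A.
  have slQ : (d (s l)).2 \in Q2.
    by move: lX; rewrite !inE => /orP[/eqP->|/andP[]//]; rewrite sk.
  have -> : (j == (d (s l)).2) = false by apply: contraNF jQ2 => /eqP->.
  have [slA|] := boolP (s l \in A); last by rewrite mul0r subr0.
  suff /negPf-> : j != (if (d (s l)).1 \in Q1 then j0 else js (s l)) by rewrite mulr0 subr0.
  apply: contraNneq jQ2 => ->; case: ifP => // /negbT/(esc _ slQ)[] //.
- move=> l i; rewrite comQ in_setU1 => /orP[/eqP->|].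
    by move=> iQ; rewrite y0 // mul0r.
  rewrite inE => slA iQ; rewrite /rect_vec -/A slA sumrB.
  have slQ : (d (s l)).2 \in Q2 by move: slA; rewrite !inE => /andP[].
  set j1 := if _ then _ else _.
  have j1Q : j1 \in Q2 by rewrite /j1; case: ifP => // /negbT/(esc _ slQ)[].
  rewrite (bigD1 (d (s l)).2) //= eqxx big1 => [|j /andP[_ /negPf->] //].
  rewrite (bigD1 j1) //= eqxx big1 => [|j /andP[_ /negPf->] //]; last by rewrite mulr0.
  by rewrite mulr1 !addr0 subrr mulr0.
rewrite comQ cardsU1 inE sk k0A add1n addSn ltnS.
have -> : #|s @^-1: A| = #|A|.
  rewrite -(card_imset _ (@perm_inj _ s)); apply: eq_card => k.
  by rewrite -[k](permKV s) mem_imset ?inE //; apply: perm_inj.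
rewrite /count_boxes -(cardsID A [set k | (d k).2 \in Q2]); apply: leq_add.
  by apply: subset_leq_card; apply: subsetIr.
have inj : {in [set k | (d k).2 \in Q2] :\: A &, injective (fun k => (d k).1)}.
  move=> x x'; rewrite !inE => /andP[n1 q1] /andP[n2 q2] e.
  move: n1 n2; rewrite q1 q2 /= !negbK => /andP[_ /eqP e1] /andP[_ /eqP e2].
  by apply: dI; move: e e1 e2; case: (d x) => ? ?; case: (d x') => ? ? /= -> -> ->.
rewrite -(card_in_imset inj); apply: subset_leq_card; apply/subsetP => i.
case/imsetP => k; rewrite !inE => /andP[n1 q1] ->.
by move: n1; rewrite q1 /= negbK => /andP[].
Qed.

(** With labels identified with boxes, the row of a label is 1 at its own box,
and its other nonzero entries are at boxes of the rectangle that lie in the row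
i0 or the column j0 more often than the box of the label. *)
Lemma rect_vec_det (I J : finType) n (d : 'I_n.+1 -> I * J) (Q1 : {set I}) (Q2 : {set J})
    (js : 'I_n.+1 -> J) (ir : 'I_n.+1 -> I) (k0 : 'I_n.+1) (s : 'S_n.+1) :
  injective d -> (d k0).1 \in Q1 -> (d k0).2 \in Q2 ->
  escapes d Q1 Q2 js -> escapes (transpose_boxes d) Q2 Q1 ir ->
  pairing d (fun l => rect_vec d Q1 Q2 (d k0).2 js (s l))
         (fun l => rect_vec (transpose_boxes d) Q2 Q1 (d k0).1 ir (s l)) != 0.
Proof.
move=> dI k1 k2 escj esci; set i0 := (d k0).1; set j0 := (d k0).2.
pose W := rect_vec d Q1 Q2 j0 js; pose Y := rect_vec (transpose_boxes d) Q2 Q1 i0 ir.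
have -> : pairing d (fun l => W (s l)) (fun l => Y (s l)) = \det (row_perm s (pairing_mx d W Y)).
  by congr (\det _); apply/matrixP => l k; rewrite !mxE.
rewrite row_permE det_mulmx det_perm mulf_eq0 signr_eq0 /=.
suff -> : \det (pairing_mx d W Y) = 1 by apply: oner_neq0.
apply: (@det_unitriangular _ _ _ (fun x => ((d x).1 == i0) + ((d x).2 == j0))%N).
- move=> k; rewrite mxE /W /Y /rect_vec /= !eqxx.
  have -> : (k \in rect_labels d Q1 Q2 j0)%:R *
      ((d k).2 == (if (d k).1 \in Q1 then j0 else js k))%:R = 0 :> K.
    rewrite -natrM mulnb inE; case: ifP => [_|/negbT q1] /=.
      by case: eqP; rewrite ?andbF.
    have [q2|] //= := boolP ((d k).2 \in Q2).
    have [_] := escj k q2 q1; case: eqP; rewrite ?andbF // => <-.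
    by rewrite -surjective_pairing codom_f.
  have -> : (k \in rect_labels (transpose_boxes d) Q2 Q1 i0)%:R *
      ((d k).1 == (if (d k).2 \in Q2 then i0 else ir k))%:R = 0 :> K.
    rewrite -natrM mulnb inE /=; case: ifP => [_|/negbT q2] /=.
      by case: eqP; rewrite ?andbF.
    have [q1|] //= := boolP ((d k).1 \in Q1).
    have [_] := esci k q1 q2; case: eqP; rewrite ?andbF //= => <-.
    by rewrite (_ : (_, _) = transpose_boxes d k) ?codom_f.
  by rewrite !subr0 mulr1.
have nb (a : bool) : (a%:R != 0 :> K) = a by case: a; rewrite ?oner_eq0 ?eqxx.
move=> k x; rewrite mxE mulf_eq0 negb_or => /andP[Ynz Wnz] kx.
have Wc : (d x).2 = (d k).2 \/ [/\ (d x).2 != (d k).2, k \in rect_labels d Q1 Q2 j0 &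
    (d x).2 = if (d k).1 \in Q1 then j0 else js k].
  have [->|ne] := eqVneq (d x).2 (d k).2; [by left|right].
  move: Wnz; rewrite /W /rect_vec (negPf ne) sub0r oppr_eq0 mulf_eq0 negb_or.
  by rewrite !nb => /andP[-> /eqP].
have Yc : (d x).1 = (d k).1 \/ [/\ (d x).1 != (d k).1, k \in rect_labels (transpose_boxes d) Q2 Q1 i0 &
    (d x).1 = if (d k).2 \in Q2 then i0 else ir k].
  have [->|ne] := eqVneq (d x).1 (d k).1; [by left|right].
  move: Ynz; rewrite /Y /rect_vec /= (negPf ne) sub0r oppr_eq0 mulf_eq0 negb_or.
  by rewrite !nb => /andP[-> /eqP].
case: Wc => [x2|[x2 kA jj]].
  case: Yc => [x1|[x1 kA ii]].
    by case/eqP: kx; apply: dI; move: x1 x2; case: (d x) => ? ?; case: (d k) => ? ? /= -> ->.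
  move: kA ii; rewrite inE /= => /andP[q1 _]; case: ifP => [q2 ii|/negbT q2 ii].
    by rewrite x2 ltn_add2r ii eqxx; move: x1; rewrite ii eq_sym => /negPf->.
  have [_ /negP[]] := esci k q1 q2.
  by rewrite /= -ii -x2 (_ : (_, _) = transpose_boxes d x) ?codom_f.
move: kA jj; rewrite inE => /andP[q2 _]; case: ifP => [q1 jj|/negbT q1 jj].
  rewrite jj eqxx; move: x2; rewrite jj eq_sym => /negPf->; rewrite addn0 addn1 ltnS.
  by case: Yc => [->//|[_ _]]; rewrite q2 => ->; rewrite eqxx; case: eqP.
case: Yc => [x1|[_]]; last by rewrite inE /= (negPf q1).
have [_ /negP[]] := escj k q2 q1.
by rewrite -jj -x1 -surjective_pairing codom_f.
Qed.

End RectangleVectors.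

Section Necessity.

Variables (K : numFieldType) (D : diagram) (n : nat).
Variables (I J : finType) (r : posnat -> I) (c : posnat -> J).
Hypotheses (rI : row_inj r D) (cI : col_inj c D).
Variables (e : 'I_n.+1 -> D) (e' : D -> 'I_n.+1).
Hypotheses (eK : cancel e e') (e'K : cancel e' e).
Local Open Scope fset_scope.

Notation d := (boxes r c e).

(** If a box [b] of [s] has its row in P1, then no later box has its column in
P2, since that box would have to come before [b]. *)
Lemma unhit_split (s : seq box) (P1 P2 : pred posnat) :
  (forall i j, P1 i -> P2 j -> (i, j) \in D) ->
  pairwise (cross_free D) s -> {in s, forall b, ~~ (P1 b.1 && P2 b.2)} ->
  exists s1 s2, [/\ s = s1 ++ s2, {in s1, forall b, ~~ P1 b.1} & {in s2, forall b, ~~ P2 b.2}].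
Proof.
move=> P12; elim: s => [|b s IH] sp un; first by exists [::], [::].
have [b1|b1] := boolP (P1 b.1); last first.
  move: sp => /= /andP[_ /IH[x xs|s1 [s2 [-> h1 h2]]]].
    by apply: un; rewrite inE xs orbT.
  by exists (b :: s1), s2; split=> // x; rewrite inE => /orP[/eqP->//|]; apply: h1.
exists [::], (b :: s); split=> // x; rewrite inE => /orP[/eqP->|xs].
  by have := un b (mem_head _ _); rewrite b1.
move: sp => /= /andP[/allP/(_ _ xs) bx _]; apply: contra bx => x2.
exact: P12.
Qed.

Definition row_functional (y : 'I_n.+1 -> I -> K) (g : tabspace K D n.+1) : K^o :=
  \sum_(rho : {ffun 'I_n.+1 -> I}) (\prod_l y l (rho l)) * row_section r c eK g rho.

Fact row_functional_is_linear y : linear (row_functional y).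
Proof.
move=> k u v; rewrite /row_functional scaler_sumr -big_split; apply: eq_bigr => rho _ /=.
have -> : (row_section r c eK (k *: u + v) = k *: row_section r c eK u + row_section r c eK v)%R.
  exact: row_section_is_linear.
move: (row_section r c eK u) (row_section r c eK v) => a b.
by rewrite !ffunE mulrDr; congr (_ + _)%R; rewrite /GRing.scale /= mulrCA.
Qed.
HB.instance Definition _ y := GRing.isLinear.Build K (tabspace K D n.+1) K^o *:%R
  (row_functional y) (row_functional_is_linear y).

Lemma row_functionalE y (v : tabspace K D n.+1) (w : 'I_n.+1 -> J -> K) (a : K) :
  pairing_map d (to_words r c eK v) = a *: pairing_map d (tensor w) ->
  row_functional y (mulCR v) = a * pairing d w y.
Proof.
move=> vw; rewrite pairing_expand_row mulr_sumr; apply: eq_bigr => rho _.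
rewrite (row_section_mulCR eK e'K rI cI) vw ffunE pairing_map_tensor.
by rewrite /GRing.scale /= mulrCA.
Qed.

(** The additional vector [v] is annihilated by the restrictions at the boxes of
[s1], and the functional [zf] annihilates the spans of the boxes of [s2]; so [v]
can be inserted between [s1] and [s2]. *)
Lemma unhit_dim (s : seq box) (P1 P2 : pred posnat) (b0 : box) :
  b0 \in D -> P1 b0.1 -> P2 b0.2 ->
  (forall i j, P1 i -> P2 j -> (i, j) \in D) ->
  (forall b, b \in D -> P2 b.2 -> ~~ P1 b.1 -> exists2 j, P2 j & (b.1, j) \notin D) ->
  (forall b, b \in D -> P1 b.1 -> ~~ P2 b.2 -> exists2 i, P1 i & (i, b.2) \notin D) ->
  {subset s <= D} -> pairwise (cross_free D) s ->
  {in s, forall b, ~~ (P1 b.1 && P2 b.2)} ->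
  (\sum_(b <- s) \dim (specht K (D `\ b) n) < \dim (specht K D n.+1))%N.
Proof.
move=> b0D b01 b02 P12 mx1 mx2 sD sp un.
have [s1 [s2 [sE h1 h2]]] := unhit_split P12 sp un.
pose Q1 := [set i | [exists k, ((d k).1 == i) && P1 (row_of (e k))]].
pose Q2 := [set j | [exists k, ((d k).2 == j) && P2 (col_of (e k))]].
have Q1E (b : box) : b \in D -> (r b.1 \in Q1) = P1 b.1.
  move=> bD; rewrite inE; apply/existsP/idP => [[k /andP[/eqP rk]]|Pb].
    by rewrite /row_of (rI (fsvalP (e k)) bD rk).
  by exists (e' [` bD]); rewrite /boxes e'K /row_of /= eqxx.
have Q2E (b : box) : b \in D -> (c b.2 \in Q2) = P2 b.2.
  move=> bD; rewrite inE; apply/existsP/idP => [[k /andP[/eqP rk]]|Pb].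
    by rewrite /col_of (cI (fsvalP (e k)) bD rk).
  by exists (e' [` bD]); rewrite /boxes e'K /col_of /= eqxx.
have dE (b : box) (bD : b \in D) : (r b.1, c b.2) = d (e' [` bD]).
  by rewrite /boxes e'K.
have codE := codom_boxes e'K rI cI.
pose k0 := e' [` b0D].
have dk0 : d k0 = (r b0.1, c b0.2) by rewrite dE.
have dI : injective d := boxes_inj eK rI cI.
have Q12 i j : i \in Q1 -> j \in Q2 -> (i, j) \in codom d.
  rewrite !inE => /existsP[k /andP[/eqP<- k1]] /existsP[k' /andP[/eqP<- k2]].
  by rewrite /boxes /= codE ?fsvalP // P12.
have [js escj] : exists js, escapes d Q1 Q2 js.
  suff /fin_all_exists[js jsP] : forall k, exists j, (d k).2 \in Q2 -> (d k).1 \notin Q1 ->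
      j \in Q2 /\ ((d k).1, j) \notin codom d by exists js.
  move=> k; have [/andP[q2 q1]|] := boolP (((d k).2 \in Q2) && ((d k).1 \notin Q1)); last first.
    by rewrite negb_and => ne; exists (c b0.2) => q2 q1; rewrite q2 q1 in ne.
  move: q1 q2; rewrite /boxes /= Q1E ?fsvalP // Q2E ?fsvalP // => q1 q2.
  have [j jP jD] := mx1 _ (fsvalP (e k)) q2 q1.
  have bj : (b0.1, j) \in D by apply: P12.
  exists (c j) => _ _; rewrite (Q2E (b0.1, j)) //; split=> //.
  by rewrite (codE _ (b0.1, j)) ?fsvalP.
have [ir esci] : exists ir, escapes (transpose_boxes d) Q2 Q1 ir.
  suff /fin_all_exists[ir isP] : forall k, exists i, (d k).1 \in Q1 -> (d k).2 \notin Q2 ->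
      i \in Q1 /\ ((d k).2, i) \notin codom (transpose_boxes d) by exists ir.
  move=> k; have [/andP[q1 q2]|] := boolP (((d k).1 \in Q1) && ((d k).2 \notin Q2)); last first.
    by rewrite negb_and => ne; exists (r b0.1) => q1 q2; rewrite q1 q2 in ne.
  move: q1 q2; rewrite /boxes /= Q1E ?fsvalP // Q2E ?fsvalP // => q1 q2.
  have [i iP iD] := mx2 _ (fsvalP (e k)) q1 q2.
  have bi : (i, b0.2) \in D by apply: P12.
  exists (r i) => _ _; rewrite (Q1E (i, b0.2)) //; split=> //.
  apply: contra iD => /codomP[x [ck ri]].
  by rewrite -(codE (i, b0.2)) ?fsvalP //; apply/codomP; exists x; rewrite /boxes /= ri ck.
(* The last label goes to the corner k0 of the rectangle. *)
pose sg := tperm ord_max k0.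
have sgk : sg ord_max = k0 by rewrite tpermL.
pose w l := rect_vec K d Q1 Q2 (d k0).2 js (sg l).
pose y l := rect_vec K (transpose_boxes d) Q2 Q1 (d k0).1 ir (sg l).
have k0Q1 : (d k0).1 \in Q1 by rewrite dk0 Q1E.
have k0Q2 : (d k0).2 \in Q2 by rewrite dk0 Q2E.
have nz : pairing d w y != 0 by apply: rect_vec_det.
have C0 : #|col_group D|%:R != 0 :> K.
  rewrite pnatr_eq0 -lt0n; apply/card_gt0P; exists 1%g.
  by rewrite inE; apply/forallP => x; rewrite perm1.
pose u := of_words r c eK (tensor w); pose v := mulCR u.
have vE : pairing_map d (to_words r c eK u) = #|col_group D|%:R *: pairing_map d (tensor w).
  exact: pairing_map_to_words_of_words.
pose zf := linfun (row_functional y).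
have zv : zf v != 0 by rewrite lfunE /= (row_functionalE _ vE) mulf_neq0.
have zl b : b \in s2 -> (zf @: last_at K D n b)%VS = 0%VS.
  move=> bs2; have bD : b \in D by apply: sD; rewrite sE mem_cat bs2 orbT.
  apply/eqP; rewrite -subv0 /last_at !limg_span -map_comp.
  apply/span_subvP => _ /mapP[_ /imageP[T _ ->] ->] /=; rewrite !lfunE /= ?lfunE /= memv0.
  rewrite (@row_functionalE _ _ (word_vec K (col_word r c eK (extend T))) (tab_sign K eK (extend T))).
    rewrite pairing_swap (@rect_vec0 K J I _ (transpose_boxes d) Q2 Q1 ir k0 sg) ?mulr0 //.
    - by move=> k l [e1 e2]; apply: dI; rewrite /boxes e1 e2.
    - move=> j i jQ iQ; have /codomP[x xE] := Q12 _ _ iQ jQ.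
      by apply/codomP; exists x; rewrite /transpose_boxes -xE.
    - move=> j jQ; rewrite /word_vec (col_word_extend_max _ _ eK e'K) //.
      case: eqP => // jb; move: jQ; rewrite jb Q2E //.
      by rewrite (negPf (h2 _ bs2)).
  by rewrite to_words_tabvec linearZ.
have rv b : b \in s1 -> (linfun (@restrict K D n b) @: <[v]>)%VS = 0%VS.
  move=> bs1; have bD : b \in D by apply: sD; rewrite sE mem_cat bs1.
  apply/eqP; rewrite limg_line -subv0 -memvE memv0 lfunE /=.
  apply/eqP/ffunP => U; rewrite ffunE [RHS]ffunE (mulCR_pairing_map eK e'K rI cI) vE.
  rewrite ffunE pairing_map_tensor rect_vec0 ?scaler0 // => i iQ.
  rewrite /word_vec (row_word_extend_max _ _ eK e'K) //.
  case: eqP => // ib; move: iQ; rewrite ib Q1E //.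
  by rewrite (negPf (h1 _ bs1)).
have spP : pairwise (cross_free D) s1 /\ pairwise (cross_free D) s2 /\ allrel (cross_free D) s1 s2.
  by move: sp; rewrite sE pairwise_cat => /and3P[].
have [sp1 [sp2 /allrelP sp12]] := spP.
pose A2 := (\sum_(b <- s2) last_at K D n b)%VS.
have A2dim : (\sum_(b <- s2) \dim (specht K (D `\ b) n) <= \dim A2)%N.
  apply: (lower_bound0 K rI cI eK e'K) => // x xs.
  by apply: sD; rewrite sE mem_cat xs orbT.
have A1dim : (\dim A2 + 1 <= \dim (A2 + <[v]>))%N.
  have zA2 : (zf @: A2 = 0)%VS.
    by rewrite limg_sum big_seq big1 // => b /zl.
  apply: leq_trans (dim_add_kernel _ zA2).
  by rewrite leq_add2l limg_line dim_vline zv.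
have r1 b : b \in s1 -> (linfun (@restrict K D n b) @: (A2 + <[v]>))%VS = 0%VS.
  move=> bs1; rewrite limgD rv // addv0 limg_sum big_seq big1 // => b' b's2.
  have bD : b \in D by apply: sD; rewrite sE mem_cat bs1.
  have b'D : b' \in D by apply: sD; rewrite sE mem_cat b's2 orbT.
  by apply: (restrict_last_at0 _ rI cI eK e'K) => //; apply: sp12.
have := lower_bound rI cI eK e'K _ sp1 r1.
have s1D : {subset s1 <= D} by move=> x xs; apply: sD; rewrite sE mem_cat xs.
move=> /(_ s1D) fin; rewrite sE big_cat /= addnC.
have sub : (A2 + <[v]> + \sum_(b <- s1) last_at K D n b <= specht K D n.+1)%VS.
  rewrite !subv_add !sum_last_at_sub ?andbT /=.
  by rewrite -memvE; apply/memv_imgP; exists u; rewrite ?memvf ?lfunE.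
apply: leq_trans (dimvS sub); apply: leq_trans fin.
by rewrite -addSn leq_add2r -addn1; apply: leq_trans A1dim; rewrite leq_add2r.
Qed.

End Necessity.

(** * From the branching isomorphism to dimensions, and back *)

(** Stated for an abstract family: with a concrete dependent codomain,
unification would have to compare the spaces at different indices. *)
Lemma family_update (I : eqType) (T : I -> Type) (Q : forall i, T i -> Prop)
    (z : forall i, T i) (i : I) (t : T i) :
  (forall j, Q j (z j)) -> Q i t ->
  exists u : forall j, T j, [/\ forall j, Q j (u j), u i = t & forall j, i != j -> u j = z j].
Proof.
move=> Qz Qt; exists (dfwith z t); split=> [j||j]; first by case: dfwithP.
  exact: dfwith_in.
exact: dfwith_out.
Qed.

Section IsoDim.

Variables (K : fieldType) (D : diagram) (B : {fset box}) (n : nat).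
Local Open Scope fset_scope.

(** Intersecting successively with the kernels of the components of the
isomorphism lowers the dimension by that of one summand at each step. *)
Lemma branching_iso_dim : branching_iso K D B n ->
  (\dim (specht K D n.+1) = \sum_(x : B) \dim (specht K (D `\ fsval x) n))%N.
Proof.
case=> f [fS _ fU]; set S := specht K D n.+1.
pose ker (l : seq B) := foldr (fun x W => (W :&: lker (f x))%VS) S l.
have kerP l v : v \in ker l -> v \in S /\ {in l, forall x, f x v = 0}.
  elim: l => [vS|x l IH] /=; first by split.
  case/memv_capP => /IH[vS v0l] vx; split=> // y.
  rewrite inE => /orP[/eqP->|/v0l//]; apply/eqP; move: vx; by rewrite memv_ker.
have Pker l v : v \in S -> {in l, forall x, f x v = 0} -> v \in ker l.
  move=> vS; elim: l => [|x l IH] v0 //=; apply/memv_capP; split.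
    by apply: IH => y yl; apply: v0; rewrite inE yl orbT.
  rewrite memv_ker; apply/eqP/v0; exact: mem_head.
have step l : uniq l -> (\dim S =
    \dim (ker l) + \sum_(x <- l) \dim (specht K (D `\ fsval x) n))%N.
  elim: l => [|x l IH] /=; first by rewrite big_nil addn0.
  case/andP=> xl /IH ->; rewrite big_cons addnA; congr (_ + _)%N.
  rewrite -(limg_ker_dim (f x) (ker l)); congr (_ + _)%N.
  suff -> : (f x @: ker l)%VS = specht K (D `\ fsval x) n by [].
  apply/eqP; rewrite eqEsubv; apply/andP; split; apply/subvP => u.
    by case/memv_imgP => v /kerP[vS _] ->; apply: fS.
  move=> uS.
  have [u' [u'S u'x u'y]] : exists u' : forall y : B, tabspace K (D `\ fsval y) n,
      [/\ forall y, u' y \in specht K (D `\ fsval y) n, u' x = u &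
          forall y, x != y -> u' y = 0].
    apply: (@family_update B (fun y => tabspace K (D `\ fsval y) n)
      (fun y z => z \in specht K (D `\ fsval y) n) (fun=> 0) x u _ uS).
    by move=> y; apply: rpred0.
  have [v [[vS vu] _]] := fU u' u'S.
  apply/memv_imgP; exists v; last by rewrite -u'x; symmetry; apply: vu.
  apply: Pker => // y yl; apply: etrans (vu y) _; apply: u'y.
  by apply: contraNneq xl => ->.
rewrite (step _ (index_enum_uniq _)).
suff -> : ker (index_enum B) = 0%VS by rewrite dimv0 add0n.
apply/eqP; rewrite -subv0; apply/subvP => v /kerP[vS v0].
have [|z [_ zU]] := fU (fun=> 0); first by move=> x; rewrite rpred0.
rewrite memv0; apply/eqP; transitivity z.
  by apply/esym/zU; split=> // x; apply: v0; rewrite mem_index_enum.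
by apply: zU; split=> [|x]; rewrite ?rpred0 ?linear0.
Qed.

End IsoDim.

Section LeftAction.

Variables (K : fieldType).

Section Fixed.

Variables (D : diagram) (n : nat).
Implicit Types (T : itab D n) (w : 'S_n) (a : tabspace K D n).

Lemma lactE w a U : lact w a U = a (perm_tab w^-1 U).
Proof.
have inv (w' : 'S_n) T : perm_tab w' (perm_tab w'^-1 T) = T.
  by apply/val_inj/ffunP => x; do 3!rewrite /= ?ffunE; rewrite permKV.
rewrite /lact sum_ffunE; transitivity (\sum_T a T * (U == perm_tab w T)%:R).
  by apply: eq_bigr => T _; rewrite ffunE; congr (_ * _); rewrite ffunE.
rewrite (bigD1 (perm_tab w^-1 U)) //= inv eqxx mulr1 big1 ?addr0 // => T neq.
have [e|_] := eqVneq; last by rewrite mulr0.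
by case/eqP: neq; have := inv w^-1%g T; rewrite invgK e => ->.
Qed.

Fact lact_is_linear w : linear (@lact K D n w).
Proof. by move=> k a b; apply/ffunP => U; rewrite !(lactE, ffunE). Qed.
HB.instance Definition _ w := GRing.isLinear.Build K (tabspace K D n)
  (tabspace K D n) *:%R (@lact K D n w) (lact_is_linear w).

Lemma lact_tabvec w T : lact w (tabvec K T) = tabvec K (perm_tab w T).
Proof.
rewrite /lact (bigD1 T) //= ffunE eqxx scale1r big1 ?addr0 // => U /negPf UT.
by rewrite ffunE UT scale0r.
Qed.

Lemma lactM w w' a : lact w (lact w' a) = lact (w' * w) a.
Proof.
apply/ffunP => U; rewrite !lactE; congr (a _).
by apply/val_inj/ffunP => x; do 3!rewrite /= ?ffunE; rewrite invMg permM.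
Qed.

Lemma lact1 a : lact 1 a = a.
Proof.
apply/ffunP => U; rewrite lactE; congr (a _).
by apply/val_inj/ffunP => x; do 3!rewrite /= ?ffunE; rewrite invg1 perm1.
Qed.

Lemma perm_tab_perm w T s : tab_perm (perm_tab w T) s = perm_tab w (tab_perm T s).
Proof. by apply/val_inj/ffunP => x; do 3!rewrite /= ?ffunE. Qed.

Lemma tabs_linear_ext (V : lmodType K) (f g : {linear tabspace K D n -> V}) :
  (forall T, f (tabvec K T) = g (tabvec K T)) -> f =1 g.
Proof.
move=> fg a; rewrite [a]tabs_expand !linear_sum; apply: eq_bigr => T _.
by rewrite !linearZ fg.
Qed.

Lemma mulCR_lact w a : mulCR (lact w a) = lact w (mulCR a).
Proof.
apply: (@tabs_linear_ext _ (@mulCR K D n \o @lact K D n w) (@lact K D n w \o @mulCR K D n)).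
move=> T; rewrite /= lact_tabvec !mulCR_tabvec linear_sum; apply: eq_bigr => s _.
rewrite linear_sum; apply: eq_bigr => t _.
by rewrite linearZ /= lact_tabvec !perm_tab_perm.
Qed.

End Fixed.

Variables (D : diagram) (n : nat) (b : box).

Lemma restrictD (u v : tabspace K D n.+1) : restrict b (u + v) = restrict b u + restrict b v.
Proof. exact: linearD. Qed.

Lemma extend_perm (w : 'S_n) (T : itab (D `\ b)%fset n) :
  extend (perm_tab w T) = perm_tab (emb_perm w) (extend T).
Proof.
apply/val_inj/ffunP => x; rewrite /= !ffunE /=.
case: insubP => [y _ _|_] /=; last by rewrite lift_perm_id.
by rewrite ffunE lift_perm_lift.
Qed.

Lemma emb_permV (w : 'S_n) : ((emb_perm w)^-1 = emb_perm w^-1)%g.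
Proof. exact: lift_permV. Qed.

Lemma restrict_lact (w : 'S_n) (a : tabspace K D n.+1) :
  restrict b (lact (emb_perm w) a) = lact w (restrict b a).
Proof. by apply/ffunP => U; rewrite !(lactE, ffunE) emb_permV extend_perm. Qed.

Lemma last_at_lact (w : 'S_n) (a : tabspace K D n.+1) :
  a \in last_at K D n b -> lact (emb_perm w) a \in last_at K D n b.
Proof.
suff : (linfun (lact (emb_perm w)) @: last_at K D n b <= last_at K D n b)%VS.
  by move=> /subvP sub al; rewrite -[lact _ _](lfunE (lact (emb_perm w))) sub // memv_img.
rewrite /last_at !limg_span -map_comp; apply/span_subvP => _ /mapP[_ /imageP[T _ ->] ->].
rewrite /= !lfunE /= -mulCR_lact lact_tabvec -extend_perm; apply: memv_span.
by apply/mapP; exists (tabvec K (extend (perm_tab w T))); rewrite ?lfunE //; apply: image_f.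
Qed.

End LeftAction.

Section Maschke.

Variables (K : numFieldType) (D : diagram) (n : nat).

(** Maschke's average of a projection onto [W]. *)
Definition avg_proj (W : {vspace tabspace K D n.+1}) (v : tabspace K D n.+1) :
    tabspace K D n.+1 :=
  #|{: 'S_n}|%:R^-1 *: \sum_(w : 'S_n) lact (emb_perm w) (projv W (lact (emb_perm w^-1) v)).

Fact avg_proj_is_linear W : linear (avg_proj W).
Proof.
move=> k u v; rewrite /avg_proj scalerA mulrC -scalerA -scalerDr; congr (_ *: _).
rewrite scaler_sumr -big_split; apply: eq_bigr => w _ /=.
by rewrite !linearP.
Qed.
HB.instance Definition _ W := GRing.isLinear.Build K (tabspace K D n.+1)
  (tabspace K D n.+1) *:%R (avg_proj W) (avg_proj_is_linear W).

Variable W : {vspace tabspace K D n.+1}.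
Hypothesis stW : forall w v, v \in W -> lact (@emb_perm n w) v \in W.

Lemma emb_permM (w w' : 'S_n) : (emb_perm (w * w') = emb_perm w * emb_perm w')%g.
Proof. by rewrite /emb_perm (lift_permM _ ord_max). Qed.

Lemma emb_perm1 : emb_perm (1%g : 'S_n) = 1%g.
Proof. exact: lift_perm1. Qed.

Lemma avg_proj_in v : avg_proj W v \in W.
Proof. by apply/rpredZ/rpred_sum => w _; apply: stW; apply: memv_proj. Qed.

Lemma avg_proj_id v : v \in W -> avg_proj W v = v.
Proof.
move=> vW; rewrite /avg_proj (eq_bigr (fun=> v)) => [|w _]; last first.
  by rewrite projv_id ?stW // lactM -emb_permM mulVg emb_perm1 lact1.
rewrite sumr_const -scaler_nat scalerA mulVf ?scale1r // pnatr_eq0 -lt0n.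
by apply/card_gt0P; exists 1%g.
Qed.

Lemma avg_proj_lact g v :
  avg_proj W (lact (emb_perm g) v) = lact (emb_perm g) (avg_proj W v).
Proof.
rewrite /avg_proj linearZ; congr (_ *: _); rewrite linear_sum.
rewrite (reindex_inj (mulIg g)) /=; apply: eq_bigr => w _.
by rewrite !lactM -!emb_permM invMg mulgA mulgV mul1g.
Qed.

End Maschke.

(** Equality of dimensions forces the filtration of S^D by the spans
[span_from l], over the tails [l] of [s], to have the factors S^(D minus x), by
restriction at [x].  Restriction is equivariant but maps into S^(D minus x) only
on the step that starts at [x]; composing it with an equivariant projection onto
that step gives the component [f x] of the isomorphism. *)

Section DimIso.

Variables (K : numFieldType) (D : diagram) (n : nat).
Variables (I J : finType) (r : posnat -> I) (c : posnat -> J).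
Hypotheses (rI : row_inj r D) (cI : col_inj c D).
Variables (e : 'I_n.+1 -> D) (e' : D -> 'I_n.+1).
Hypotheses (eK : cancel e e') (e'K : cancel e' e).
Variables (B : {fset box}) (s : seq B).
Hypotheses (sU : uniq s) (sB : forall x, x \in s).
Hypothesis BD : {subset B <= D}.
Hypothesis sp : pairwise (cross_free D) [seq fsval x | x <- s].
Hypothesis dimE :
  (\dim (specht K D n.+1) = \sum_(x <- s) \dim (specht K (D `\ fsval x)%fset n))%N.

Let span_from (l : seq B) : {vspace tabspace K D n.+1} := (\sum_(x <- l) last_at K D n (fsval x))%VS.

Let span_from_sub l : (span_from l <= specht K D n.+1)%VS.
Proof. exact: sum_last_at_sub. Qed.

Let span_from_stable l w v : v \in span_from l -> lact (@emb_perm n w) v \in span_from l.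
Proof.
elim: l v => [|x l IH] v; rewrite /span_from ?big_nil ?big_cons.
  by rewrite !memv0 => /eqP->; rewrite linear0.
case/memv_addP => v1 v1x [v2 v2l ->]; rewrite linearD memv_add //.
  exact: last_at_lact.
exact: IH.
Qed.

Let bD (x : B) : fsval x \in D.
Proof. exact/BD/fsvalP. Qed.

Let span_from_lower l : pairwise (cross_free D) [seq fsval x | x <- l] ->
  (\sum_(x <- l) \dim (specht K (D `\ fsval x)%fset n) <= \dim (span_from l))%N.
Proof.
move=> spl.
have := lower_bound0 K rI cI eK e'K _ spl; rewrite !big_map; apply.
by move=> _ /mapP[x _ ->]; apply: bD.
Qed.

Let restrict_span_from x l : pairwise (cross_free D) [seq fsval x | x <- x :: l] ->
  (linfun (@restrict K D n (fsval x)) @: span_from l)%VS = 0%VS.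
Proof.
move=> /= /andP[/allP xl _]; rewrite /span_from limg_sum big_seq big1 // => y yl.
apply: (restrict_last_at0 _ rI cI eK e'K); rewrite ?bD //.
by apply: xl; apply: map_f.
Qed.

Let dim_span_from l0 l : s = l0 ++ l ->
  (\dim (span_from l) = \sum_(x <- l) \dim (specht K (D `\ fsval x)%fset n))%N /\
  (l0 = [::] -> span_from l = specht K D n.+1).
Proof.
elim/last_ind: l0 l => [|l0 x IH] l; rewrite ?cat_rcons => sE.
  rewrite /= in sE; have low := span_from_lower sp; rewrite -dimE sE in low.
  have e1 : span_from l = specht K D n.+1 by apply/eqP; rewrite eqEdim span_from_sub low.
  by rewrite e1 dimE sE.
have [dxl _] := IH _ sE.
split=> [|/eqP]; last by rewrite -size_eq0 size_rcons.
have spl : pairwise (cross_free D) [seq fsval x | x <- x :: l].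
  by move: sp; rewrite sE map_cat pairwise_cat => /and3P[].
have spl' : pairwise (cross_free D) [seq fsval x | x <- l] by move: spl => /= /andP[].
apply/eqP; rewrite eqn_leq span_from_lower // andbT.
have := dim_add_kernel (last_at K D n (fsval x)) (restrict_span_from spl).
rewrite (restrict_last_at K rI cI eK e'K) ?bD // addvC.
rewrite -[(_ + span_from l)%VS](_ : span_from (x :: l) = _); last by rewrite /span_from big_cons.
by rewrite dxl big_cons addnC leq_add2l.
Qed.

(* The kernel of the restriction on one step of the filtration is the next
   step, by dimensions. *)
Let span_from_ker l0 x l v : s = l0 ++ x :: l -> v \in span_from (x :: l) ->
  restrict (fsval x) v = 0 -> v \in span_from l.
Proof.
move=> sE vx rv.
have spl : pairwise (cross_free D) [seq fsval x | x <- x :: l].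
  by move: sp; rewrite sE map_cat pairwise_cat => /and3P[].
have [d1 _] := dim_span_from sE.
have sE' : s = rcons l0 x ++ l by rewrite cat_rcons.
have [d2 _] := dim_span_from sE'.
pose f := linfun (@restrict K D n (fsval x)).
have sub : (span_from l <= span_from (x :: l) :&: lker f)%VS.
  rewrite subv_cap {1}/span_from [span_from (x :: l)]/span_from big_cons addvSr /=.
  by apply/subvP => u ul; rewrite memv_ker -memv0 -(restrict_span_from spl) memv_img.
suff -> : span_from l = (span_from (x :: l) :&: lker f)%VS.
  by rewrite memv_cap vx memv_ker lfunE /= rv eqxx.
apply/eqP; rewrite eqEdim sub /=.
rewrite -(leq_add2r (\dim (f @: span_from (x :: l)))) limg_ker_dim d1 d2 big_cons addnC leq_add2l.
rewrite -(restrict_last_at K rI cI eK e'K) ?bD //; apply/dimvS/limgS.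
by rewrite /span_from big_cons addvSl.
Qed.

Let f (x : B) : 'Hom(tabspace K D n.+1, tabspace K (D `\ fsval x)%fset n) :=
  (linfun (@restrict K D n (fsval x)) \o linfun (avg_proj (span_from (drop (index x s) s))))%VF.

Let fE x v : f x v = restrict (fsval x) (avg_proj (span_from (drop (index x s) s)) v).
Proof. by rewrite comp_lfunE !lfunE. Qed.

Let drop_s l0 x l : s = l0 ++ x :: l -> drop (index x s) s = x :: l.
Proof.
move=> sE; have := sU; rewrite sE cat_uniq /= => /and3P[_ xl0 _].
have xn : x \notin l0 by apply: contra xl0 => xl0; rewrite xl0.
by rewrite index_cat (negPf xn) /= eqxx addn0 drop_size_cat.
Qed.

Let fE' l0 x l v : s = l0 ++ x :: l -> v \in span_from (x :: l) -> f x v = restrict (fsval x) v.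
Proof. by move=> sE vl; rewrite fE (drop_s sE) avg_proj_id // => *; apply: span_from_stable. Qed.

Let f_inj l0 l v : s = l0 ++ l -> v \in span_from l -> {in l, forall x, f x v = 0} -> v = 0.
Proof.
elim: l l0 => [|x l IH] l0 sE vl v0.
  by move: vl; rewrite /span_from big_nil memv0 => /eqP.
apply: (IH (rcons l0 x)); first by rewrite cat_rcons.
  by apply: (span_from_ker sE vl); rewrite -(fE' sE vl) v0 ?mem_head.
by move=> y yl; rewrite v0 // inE yl orbT.
Qed.

Let f_in x v : f x v \in specht K (D `\ fsval x)%fset n.
Proof.
have [l0 [l sE]] : exists l0 l, s = l0 ++ x :: l.
  exists (take (index x s) s), (drop (index x s).+1 s).
  by rewrite -[x in x :: _](nth_index x (sB x)) -drop_nth ?index_mem ?cat_take_drop.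
have spl : pairwise (cross_free D) [seq fsval x | x <- x :: l].
  by move: sp; rewrite sE map_cat pairwise_cat => /and3P[].
rewrite fE (drop_s sE) -(restrict_last_at K rI cI eK e'K (bD x)).
have : avg_proj (span_from (x :: l)) v \in span_from (x :: l).
  by apply: avg_proj_in => *; apply: span_from_stable.
rewrite {2}/span_from big_cons => /memv_addP[v1 v1x [v2 v2l ->]]; rewrite restrictD.
suff -> : restrict (fsval x) v2 = 0.
  by rewrite addr0; apply/memv_imgP; exists v1; rewrite ?lfunE.
apply/eqP; rewrite -memv0 -(restrict_span_from spl).
by apply/memv_imgP; exists v2; rewrite ?lfunE.
Qed.

Let f_surj l0 l (u : forall x : B, tabspace K (D `\ fsval x)%fset n) :
  s = l0 ++ l -> (forall x, u x \in specht K (D `\ fsval x)%fset n) ->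
  exists2 v, v \in span_from l & {in l, forall x, f x v = u x}.
Proof.
elim: l l0 u => [|x l IH] l0 u sE uS; first by exists 0; rewrite ?rpred0.
have := uS x; rewrite -(restrict_last_at K rI cI eK e'K (bD x)) => /memv_imgP[v1 v1x ux0].
have ux : u x = restrict (fsval x) v1 := etrans ux0 (lfunE _ _).
have v1us : v1 \in span_from (x :: l).
  by rewrite /span_from big_cons -[v1]addr0 memv_add ?rpred0.
have sE' : s = rcons l0 x ++ l by rewrite cat_rcons.
have [|v2 v2l v2u] := IH (rcons l0 x) (fun y => u y - f y v1) sE'.
  by move=> y; apply: rpredB; [apply: uS|apply: f_in].
have v2us : v2 \in span_from (x :: l).
  by rewrite /span_from big_cons -[v2]add0r memv_add ?rpred0.
have spl : pairwise (cross_free D) [seq fsval x | x <- x :: l].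
  by move: sp; rewrite sE map_cat pairwise_cat => /and3P[].
exists (v1 + v2); first exact: rpredD.
move=> y; rewrite inE => /orP[/eqP->|yl]; last first.
  have fD : f y (v1 + v2) = f y v1 + f y v2 := linearD _ _ _.
  apply: etrans fD _; rewrite (v2u y yl).
  exact: etrans (addrC _ _) (subrK _ _).
rewrite (fE' sE) ?rpredD // restrictD -ux.
suff -> : restrict (fsval x) v2 = 0 by rewrite addr0.
apply/eqP; rewrite -memv0 -(restrict_span_from spl).
by apply/memv_imgP; exists v2; rewrite ?lfunE.
Qed.

Lemma dim_branching_iso : branching_iso K D B n.
Proof.
exists f; split=> [x v _|x w v _|u uS]; first exact: f_in.
  rewrite !fE avg_proj_lact ?restrict_lact // => *; exact: span_from_stable.
have [v vs vu] := @f_surj [::] s u erefl uS.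
have [_ /(_ erefl) us_full] := @dim_span_from [::] s erefl.
exists v; split=> [|v' [v'S v'u]].
  by split=> [|x]; [rewrite -us_full|apply: vu].
apply/eqP; rewrite -subr_eq0; apply/eqP/(@f_inj [::] s) => //.
  by rewrite rpredB // us_full.
by move=> x _; rewrite linearB /= v'u vu // subrr.
Qed.

End DimIso.

(** * Garnir relations *)

Section Span.

Variables (K : fieldType) (V : vectType K) (P : V -> Prop).

Definition in_span (v : V) := exists2 s : seq V, (forall u, u \in s -> P u) & v \in <<s>>%VS.

Lemma in_span_base v : P v -> in_span v.
Proof.
move=> Pv; exists [:: v]; last by rewrite memv_span ?mem_head.
by move=> u; rewrite inE => /eqP->.
Qed.

Lemma in_span0 : in_span 0.
Proof. by exists [::]; rewrite ?rpred0. Qed.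

Lemma in_spanD u v : in_span u -> in_span v -> in_span (u + v).
Proof.
move=> [s sP span_from] [t tP vt]; exists (s ++ t).
  by move=> w; rewrite mem_cat => /orP[/sP|/tP].
by rewrite span_cat memv_add.
Qed.

Lemma in_spanZ k v : in_span v -> in_span (k *: v).
Proof. by move=> [s sP vs]; exists s => //; apply: rpredZ. Qed.

Lemma in_span_sum (T : Type) (r : seq T) (C : pred T) (F : T -> V) :
  (forall i, C i -> in_span (F i)) -> in_span (\sum_(i <- r | C i) F i).
Proof.
by move=> FP; elim/big_ind: _ => //; [apply: in_span0|apply: in_spanD].
Qed.

End Span.

Lemma card_disjoint_bigcup (I T : finType) (G : I -> {set T}) :
  (forall i k, i != k -> [disjoint G i & G k]%B) -> #|\bigcup_i G i| = (\sum_i #|G i|)%N.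
Proof.
move=> disG; rewrite -sum1_card partition_disjoint_bigcup //.
by apply: eq_bigr => i _; rewrite sum1_card.
Qed.

Section Soundness.

Variables (K : numFieldType) (D : diagram) (n : nat).

Lemma card_box_set (P : pred box) :
  #|` [fset b in D | P b]%fset| = #|[set x : D | P (fsval x)]|.
Proof.
have -> : [fset b in D | P b]%fset = [fset fsval x | x in [set x : D | P (fsval x)]]%fset.
  apply/fsetP => b; rewrite !inE /=; apply/andP/imfsetP => [[bD Pb]|[x /=]].
    by exists [` bD]%fset; rewrite //= inE.
  by rewrite inE => Px ->; rewrite fsvalP.
by rewrite card_imfset //=; [rewrite -cardE|apply: val_inj].
Qed.

(** Fewer boxes of the columns of the family are outside [s^-1 A] than there are
common rows.  So in some common row all the [m + 1] boxes are in the [m] sets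
[s^-1 (A i)], and two of them are in the same set. *)
Lemma garnir_pigeonhole m (A : 'I_m -> {set D}) (s : {perm D}) :
  garnir_family A -> s \in col_group D ->
  exists i x y, [/\ x != y, row_of x = row_of y, s x \in A i & s y \in A i].
Proof.
case=> m0 dis [j [jI Aj lt]]; rewrite inE => /forallP sC.
pose F k := [set x : D | col_of x == j k].
pose Cols := \bigcup_k F k; pose U := \bigcup_i (s @^-1: A i).
have cCols : #|Cols| = (\sum_k col_size D (j k))%N.
  rewrite card_disjoint_bigcup => [|k k' kk']; last first.
    rewrite disjoint_subset; apply/subsetP => x; rewrite !inE => /eqP->.
    by rewrite (inj_eq jI).
  by apply: eq_bigr => k _; rewrite /col_size card_box_set.
have cU : #|U| = (\sum_i #|A i|)%N.
  rewrite card_disjoint_bigcup => [|k k' kk']; last first.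
    rewrite disjoint_subset; apply/subsetP => x; rewrite !inE => xA.
    by rewrite (disjointFr (dis _ _ kk') xA).
  apply: eq_bigr => i _; rewrite -[RHS](card_imset _ (@perm_inj _ s^-1%g)).
  apply: eq_card => x; rewrite inE -{2}[x](permK s) mem_imset //; exact: perm_inj.
have UC : U \subset Cols.
  apply/subsetP => x /bigcupP[i _]; rewrite inE => /Aj; rewrite (eqP (sC x)) => cx.
  by case: cx => cx; apply/bigcupP; [exists (widen_ord (leqnSn m) i)|exists (lift ord0 i)];
    rewrite // inE cx.
have VC : (#|Cols :\: U| < common_rows D j)%N.
  have le : (\sum_i #|A i| <= \sum_k col_size D (j k))%N by rewrite -cU -cCols subset_leq_card.
  rewrite cardsD (setIidPr UC) cU cCols ltnNge; apply: contraL lt.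
  rewrite leq_subRL // -leqNgt => le2.
  by rewrite leq_subRL ?(leq_trans (leq_addl _ _) le2) // addnC.
have [rho rhoC rhoV] : exists2 rho, rho \in [fset i in [fset b.1 | b in D] | [forall k, (i, j k) \in D]]%fset
    & rho \notin [fset row_of x | x in Cols :\: U]%fset.
  apply/fsubsetPn; apply: contraL VC => /fsubset_leq_card le; rewrite -leqNgt.
  apply: leq_trans le _; apply: leq_trans (leq_imfset_card _ _ _) _.
  by rewrite -cardE.
move: rhoC; rewrite !inE /= => /andP[_ /forallP rhoC].
pose x k : D := [` rhoC k]%fset.
have /fin_all_exists[g gP] : forall k, exists i, s (x k) \in A i.
  move=> k.
  have : x k \in U.
    apply: contraR rhoV => xU; apply/imfsetP; exists (x k) => //=.
    rewrite inE xU /=; apply/bigcupP; exists k => //.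
    by rewrite inE.
  by case/bigcupP => i _; rewrite inE; exists i.
have /injectivePn[k [k' kk' gk]] : ~~ injectiveb g.
  apply: contraT; rewrite negbK => /injectiveP/leq_card.
  by rewrite !card_ord ltnn.
exists (g k), (x k), (x k'); split=> //; last by rewrite gk.
by apply: contra kk' => /eqP[/jI->].
Qed.

Lemma garnir_stab_tperm m (A : 'I_m -> {set D}) (u v : D) (i : 'I_m) :
  u \in A i -> v \in A i -> (forall i k, i != k -> [disjoint A i & A k]%B) ->
  tperm u v \in garnir_stab A.
Proof.
move=> ui vi dis; rewrite inE; apply/andP; split.
  apply/forallP => k; rewrite eqEcard (card_imset _ (@perm_inj _ _)) leqnn andbT.
  apply/subsetP => _ /imsetP[z zk ->]; case: tpermP => [zu|zv|//]; apply: contraT => nk.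
    have ik : i != k by apply: contra nk => /eqP<-.
    by move: zk; rewrite zu (disjointFr (dis _ _ ik) ui).
  have ik : i != k by apply: contra nk => /eqP<-.
  by move: zk; rewrite zv (disjointFr (dis _ _ ik) vi).
apply/subsetP => z; rewrite inE => zuv; apply/bigcupP; exists i => //.
by move: zuv; case: tpermP => [->|->|_ _]; rewrite ?eqxx.
Qed.

Lemma garnir_stabM m (A : 'I_m -> {set D}) (p q : {perm D}) :
  p \in garnir_stab A -> q \in garnir_stab A -> (p * q)%g \in garnir_stab A.
Proof.
rewrite !inE => /andP[/forallP pA pU] /andP[/forallP qA qU]; rewrite perm_onM // andbT.
apply/forallP => i; rewrite -[X in _ == X](eqP (qA i)) -{2}(eqP (pA i)) -imset_comp.
by apply/eqP/eq_imset => z; rewrite permM.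
Qed.

(** For each column permutation [s], the transposition of two boxes as in
[garnir_pigeonhole] is in the row group, and its conjugate by [s] is in the
stabilizer of the family: the sum over both groups equals its opposite. *)
Lemma garnir_mulCR (v : tabspace K D n) : garnir_relation v -> mulCR v = 0.
Proof.
case=> T [m [A [Agar ->]]].
have dis : forall i k, i != k -> [disjoint A i & A k]%B by case: Agar.
rewrite linear_sum /=.
transitivity (\sum_(p in garnir_stab A) \sum_(s in col_group D) \sum_(t in row_group D)
   ((-1) ^+ s * (-1) ^+ p) *: tabvec K (tab_perm (tab_perm (tab_perm T p) s) t)).
  apply: eq_bigr => p _; rewrite linearZ /= mulCR_tabvec scaler_sumr; apply: eq_bigr => s _.
  by rewrite scaler_sumr; apply: eq_bigr => t _; rewrite scalerA mulrC.
rewrite exchange_big big1 //= => s sC; rewrite exchange_big /=.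
have [i [x [y [xy rxy sx sy]]]] := garnir_pigeonhole Agar sC.
set tt := tperm x y; set tt' := tperm (s x) (s y).
have tR z : row_of (tt z) = row_of z by case: tpermP => [->|->|//].
have stA : tt' \in garnir_stab A by apply: garnir_stab_tperm sx sy dis.
pose X (p t : {perm D}) := tabvec K (tab_perm (tab_perm (tab_perm T p) s) t).
pose S := \sum_(t in row_group D) \sum_(p in garnir_stab A) ((-1) ^+ s * (-1) ^+ p) *: X p t.
suff : S = - S.
  by move/eqP; rewrite -addr_eq0 -mulr2n -scaler_nat scaler_eq0 pnatr_eq0 => /eqP.
rewrite {1}/S (reindex_inj (mulIg tt)) -sumrN; apply: eq_big => t.
  by rewrite !inE; apply: eq_forallb => z; rewrite permM tR.
move=> _; rewrite (reindex_inj (mulgI tt')) -sumrN; apply: eq_big => p.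
  apply/idP/idP => pA; last exact: garnir_stabM.
  by rewrite -[p]mul1g -(tperm2 (s x) (s y)) -mulgA garnir_stabM.
move=> _; rewrite odd_mul_tperm (inj_eq perm_inj) xy /= -scaleNr; congr (_ *: _).
  by rewrite signrN mulrN.
congr (tabvec _ _); apply/val_inj/ffunP => z; do 6!rewrite /= ?ffunE.
congr (val T _); rewrite !permM; congr (p _); apply: (@perm_inj _ tt').
rewrite tpermK /tt /tt'.
case: (tpermP x y (t z)) => [->|->|zx zy]; rewrite ?tpermL ?tpermR //.
by rewrite tpermD // (inj_eq perm_inj) eq_sym; apply/eqP.
Qed.

End Soundness.

Lemma tensor_expand (K : fieldType) (J O : finType) n (coef : 'I_n -> O -> K)
    (u : 'I_n -> O -> J -> K) :
  tensor (fun l j => \sum_o coef l o * u l o j) =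
  \sum_(k : {ffun 'I_n -> O}) (\prod_l coef l (k l)) *: tensor (fun l => u l (k l)).
Proof.
apply/ffunP => phi; rewrite ffunE bigA_distr_bigA sum_ffunE; apply: eq_bigr => k _.
by rewrite ffunE ffunE big_split.
Qed.

Section Completeness.

Variables (K : numFieldType) (I J : finType) (r : posnat -> I) (c : posnat -> J).
Variables (D : diagram) (n : nat) (e : 'I_n -> D) (e' : D -> 'I_n).
Hypotheses (eK : cancel e e') (e'K : cancel e' e).
Hypotheses (rI : row_inj r D) (cI : col_inj c D).

Notation d := (boxes r c e).
Notation tabs := (tabspace K D n).
Notation N := (in_span (fun v : tabs => one_column_relation v \/ garnir_relation v)).

Lemma one_column_mulCR (v : tabs) : one_column_relation v -> mulCR v = 0.
Proof.
case=> T [s sC ->]; apply/eqP.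
suff : to_words r c eK (tabvec K (tab_perm T s) - (-1) ^+ s *: tabvec K T) = 0.
  move=> t0; apply/eqP/ffunP => U; rewrite (mulCR_pairing_map eK e'K rI cI) t0 linear0.
  by rewrite !ffunE.
rewrite linearB linearZ /= !to_words_tabvec.
have -> : col_word r c eK (tab_perm T s) = col_word r c eK T.
  by apply/eqP; rewrite (col_word_tab_perm _ eK e'K cI).
rewrite /tab_sign (odd_label_perm eK e'K) signr_addb scalerA subrr //.
Qed.

Lemma of_words_to_words_tabvec T : of_words r c eK (to_words r c eK (tabvec K T)) =
  \sum_(s in col_group D) (-1) ^+ s *: tabvec K (tab_perm T s).
Proof.
apply/ffunP => U; rewrite ffunE to_words_tabvec ffunE tensor_word sum_ffunE.
have [t _ Kt] := tab_perm_bij eK e'K T; rewrite -[U]Kt; set u := t U.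
rewrite (col_word_tab_perm r eK e'K cI) /tab_sign (odd_label_perm eK e'K).
have [uC|uC] := boolP (u \in col_group D); last first.
  rewrite scaler0 mulr0 big1 // => s sC; rewrite ffunE [tabvec _ _ _]ffunE.
  rewrite (inj_eq (tab_perm_inj eK e'K (T := T))).
  by have [span_from|] := eqVneq; [rewrite span_from sC in uC|rewrite scaler0].
rewrite (bigD1 u) //= big1 ?addr0 => [|s /andP[_ su]]; last first.
  rewrite ffunE [tabvec _ _ _]ffunE (inj_eq (tab_perm_inj eK e'K (T := T))).
  by rewrite eq_sym (negPf su) scaler0.
rewrite ffunE [tabvec _ _ _]ffunE eqxx /GRing.scale /= !mulr1.
by rewrite signr_addb -mulrA -signr_addb addbb mulr1.
Qed.

(** Modulo one-column relations each tableau is the signed average of its orbit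
under the column group. *)
Lemma of_words_to_words_span (v : tabs) :
  N (v - #|col_group D|%:R^-1 *: of_words r c eK (to_words r c eK v)).
Proof.
have C0 : #|col_group D|%:R != 0 :> K.
  rewrite pnatr_eq0 -lt0n; apply/card_gt0P; exists 1%g.
  by rewrite inE; apply/forallP => x; rewrite perm1.
have -> : of_words r c eK (to_words r c eK v) =
    \sum_T v T *: of_words r c eK (to_words r c eK (tabvec K T)).
  have -> : to_words r c eK v = \sum_T v T *: to_words r c eK (tabvec K T).
    rewrite {1}[v]tabs_expand linear_sum; apply: eq_bigr => T _; exact: linearZ.
  rewrite linear_sum; apply: eq_bigr => T _; exact: linearZ.
rewrite {1}[v]tabs_expand scaler_sumr -sumrB; apply: in_span_sum => T _.
have -> : v T *: tabvec K T -
    #|col_group D|%:R^-1 *: (v T *: of_words r c eK (to_words r c eK (tabvec K T))) =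
  (- v T / #|col_group D|%:R) *:
  \sum_(s in col_group D) (-1) ^+ s *: (tabvec K (tab_perm T s) - (-1) ^+ s *: tabvec K T).
  rewrite of_words_to_words_tabvec; under [in RHS]eq_bigr do rewrite scalerBr scalerA -signr_addb addbb scale1r.
  rewrite sumrB sumr_const scalerBr -[tabvec K T *+ _]scaler_nat [in RHS]scalerA mulfVK //.
  by rewrite scaleNr opprK [RHS]addrC mulNr scaleNr scalerA [_^-1 * _]mulrC.
apply/in_spanZ/in_span_sum => s sC; apply/in_spanZ/in_span_base; left.
by exists T, s.
Qed.

(** A tensor in which the labels of class [a] carry one vector, supported on the
columns [jj a] and [jj (a + 1)], and the labels without a class are fixed.  The
coefficient function of [of_words (tensor w)] is multiplied by the sign under the
group [G] of label permutations that preserve the classes.  For a fixed tableau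
[T] in the support, [G] corresponds to the stabilizer of the family of boxes
[A T] that contain the classes, so the translates of [T] make up a Garnir relation. *)

Section Average.

Variables (m : nat) (cls : 'I_n -> option 'I_m) (w : 'I_n -> J -> K) (jj : 'I_m.+1 -> posnat).
Hypotheses (m0 : (0 < m)%N) (jjI : injective jj).
Hypothesis jjD : forall k, exists x : D, col_of x = jj k.
Hypothesis w_cls : forall l l', cls l = cls l' -> cls l -> w l =1 w l'.
Hypothesis w_supp : forall l a j, cls l = Some a -> w l j != 0 ->
  j = c (jj (widen_ord (leqnSn m) a)) \/ j = c (jj (lift ord0 a)).
Hypothesis count : (\sum_k col_size D (jj k) - common_rows D jj < #|[set l | isSome (cls l)]|)%N.

Let A (T : itab D n) (a : 'I_m) : {set D} := [set x | cls (val T x) == Some a].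
Let gar (T : itab D n) : tabs :=
  \sum_(p in garnir_stab (A T)) (-1) ^+ p *: tabvec K (tab_perm T p).
Let G := [set p : 'S_n | [forall l, cls (p l) == cls l] &&
                        perm_on [set l | isSome (cls l)] p].

Let box_at (T : itab D n) l := e ((label_perm eK T)^-1%g l).

Let box_atK (T : itab D n) : cancel (val T) (box_at T).
Proof.
move=> x; rewrite /box_at; have -> : ((label_perm eK T)^-1)%g (val T x) = e' x.
  by apply/eqP; rewrite (canF_eq (permKV _)) label_permE e'K.
by rewrite e'K.
Qed.

Let box_at'K (T : itab D n) : cancel (box_at T) (val T).
Proof. by move=> l; rewrite /box_at -(label_permE eK) permKV. Qed.

Let col_word_val (T : itab D n) x : col_word r c eK T (val T x) = c (col_of x).
Proof. by rewrite ffunE /= -/(box_at T (val T x)) box_atK. Qed.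

Let dis_A (T : itab D n) i k : i != k -> [disjoint A T i & A T k]%B.
Proof.
move=> ik; rewrite disjoint_subset; apply/subsetP => x; rewrite !inE => /eqP->.
by apply: contra ik => /eqP[->].
Qed.

Let garA (T : itab D n) : of_words r c eK (tensor w) T != 0 -> garnir_family (A T).
Proof.
rewrite ffunE mulf_eq0 negb_or => /andP[_]; rewrite ffunE => wT.
have wl l : w l (col_word r c eK T l) != 0.
  by apply: contraNneq wT => wl; rewrite (bigD1 l) //= wl mul0r.
split=> // [i k|]; first exact: dis_A.
exists jj; split=> // [i x|].
  rewrite inE => /eqP kx; have := wl (val T x); rewrite col_word_val => /(w_supp kx).
  have inj k : c (col_of x) = c (jj k) -> col_of x = jj k.
    by case: (jjD k) => y <- /(cI (fsvalP _) (fsvalP _)).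
  by case=> /inj; [left|right].
apply: leq_trans count _; rewrite -card_disjoint_bigcup => [|i k]; last exact: dis_A.
rewrite -(card_imset _ (can_inj (box_at'K T))).
apply/subset_leq_card/subsetP => x /imsetP[l]; rewrite inE => kl ->.
by case kE: (cls l) kl => [a|//] _; apply/bigcupP; exists a; rewrite // inE box_at'K kE.
Qed.

Let hatT (T : itab D n) := transport_perm (box_atK T) (@box_at'K T).

Let hatT_bij (T : itab D n) : bijective (hatT T).
Proof.
exists (transport_perm (@box_at'K T) (box_atK T)) => p; apply/permP => x; rewrite !transport_permE.
  by rewrite !box_atK.
by rewrite !box_at'K.
Qed.

Let hatT_G (T : itab D n) p : (hatT T p \in G) = (p \in garnir_stab (A T)).
Proof.
rewrite !inE; apply/andP/andP => -[/forallP h1 h2]; split.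
- apply/forallP => a; rewrite eqEcard (card_imset _ (@perm_inj _ _)) leqnn andbT.
  apply/subsetP => _ /imsetP[x xa ->]; have := h1 (val T x).
  by rewrite transport_permE box_atK !inE => /eqP->; move: xa; rewrite inE.
- apply/subsetP => x; rewrite inE => px.
  have : val T x \in [set l | isSome (cls l)].
    apply: (subsetP h2); rewrite inE transport_permE box_atK; apply: contra px => /eqP.
    by move/(can_inj (box_atK T))->.
  rewrite inE; case kE: (cls (val T x)) => [a|//] _.
  by apply/bigcupP; exists a; rewrite // inE kE.
- apply/forallP => l; rewrite -[l](@box_at'K T) transport_permE box_atK; set x := box_at T l.
  case kE: (cls (val T x)) => [a|].
    have : p x \in A T a by rewrite -(eqP (h1 a)) imset_f // inE kE.
    by rewrite inE.
  rewrite (out_perm h2) ?kE //; apply/bigcupP => -[a _]; by rewrite inE kE.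
- apply/subsetP => l; rewrite !inE -[l](@box_at'K T) transport_permE box_atK; set x := box_at T l.
  rewrite (can_eq (box_atK T)) => px.
  have /bigcupP[a _] : x \in \bigcup_a A T a by apply: (subsetP h2); rewrite inE.
  by rewrite inE => /eqP->.
Qed.

Let gar_sum (T : itab D n) : gar T = \sum_(p in G) (-1) ^+ p *: tabvec K (perm_tab p T).
Proof.
rewrite (reindex _ (onW_bij _ (hatT_bij T))); apply: eq_big => p; first by rewrite hatT_G.
move=> _; rewrite odd_transport_perm; congr (_ *: tabvec _ _); apply/val_inj/ffunP => x.
by do 2!rewrite /= ?ffunE; rewrite transport_permE box_atK.
Qed.

Let of_words_perm (T : itab D n) p : p \in G ->
  of_words r c eK (tensor w) (perm_tab p T) = (-1) ^+ p * of_words r c eK (tensor w) T.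
Proof.
rewrite inE => /andP[/forallP pk pon].
have labp : label_perm eK (perm_tab p T) = (label_perm eK T * p)%g.
  by apply/permP => l; rewrite permM !label_permE /= ffunE.
rewrite ffunE [in RHS]ffunE mulrA; congr (_ * _).
  by rewrite /tab_sign labp odd_permM signr_addb mulrC.
rewrite !ffunE (reindex_inj (@perm_inj _ p)); apply: eq_bigr => l _.
rewrite !ffunE labp invMg permM permK.
have [kl|kl] := boolP (isSome (cls l)).
  by apply: w_cls; rewrite ?(eqP (pk l)).
by rewrite (out_perm pon) // inE.
Qed.

(** The sum over [G] of the translates is the order of [G] times the original;
grouped by [T], it is a combination of Garnir relations. *)
Lemma garnir_average : N (of_words r c eK (tensor w)).
Proof.
have G1 : 1%g \in G.
  rewrite inE perm_on1 andbT; apply/forallP => l; by rewrite perm1.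
have G0 : #|G|%:R != 0 :> K by rewrite pnatr_eq0 -lt0n; apply/card_gt0P; exists 1%g.
set X := of_words r c eK (tensor w).
suff -> : X = #|G|%:R^-1 *: \sum_T X T *: gar T.
  apply/in_spanZ/in_span_sum => T _.
  have [->|XT] := eqVneq (X T) 0; first by rewrite scale0r; apply: in_span0.
  apply/in_spanZ/in_span_base; right; exists T, m, (A T); split=> //.
  exact: garA.
suff -> : \sum_T X T *: gar T = #|G|%:R *: X by rewrite scalerA mulVf ?scale1r.
under eq_bigr do rewrite gar_sum scaler_sumr.
rewrite exchange_big /= scaler_nat -sumr_const; apply: eq_bigr => p pG.
have bij : bijective (@perm_tab D n p).
  exists (@perm_tab D n p^-1) => T; apply/val_inj/ffunP => x; do 2!rewrite /= ?ffunE.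
    by rewrite permK.
  by rewrite permKV.
rewrite [RHS]tabs_expand [RHS](reindex _ (onW_bij _ bij)); apply: eq_bigr => T _.
by rewrite scalerA mulrC /X (of_words_perm T pG).
Qed.

End Average.

End Completeness.

Section Presentation.

Variables (K : numFieldType) (I J : finType) (r : posnat -> I) (c : posnat -> J).
Variables (D : diagram) (n : nat) (e : 'I_n -> D) (e' : D -> 'I_n).
Hypotheses (eK : cancel e e') (e'K : cancel e' e).
Hypotheses (rI : row_inj r D) (cI : col_inj c D).

Notation d := (boxes r c e).
Notation tabs := (tabspace K D n).
Notation N := (in_span (fun v : tabs => one_column_relation v \/ garnir_relation v)).

Lemma col_word_not_overfull (T : itab D n) : ~~ overfull d (col_word r c eK T).
Proof.
rewrite negb_exists; apply/forallP => j; rewrite -leqNgt /count_boxes.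
rewrite -(card_imset _ (@perm_inj _ (label_perm eK T)^-1%g)).
apply/subset_leq_card/subsetP => k /imsetP[l].
by rewrite !inE ffunE => /eqP <- ->.
Qed.

Lemma telescope_steps (m p : nat) (F : nat -> K) : (p <= m)%N ->
  F p - F m = \sum_(a < m) (p <= a)%:R * (F a - F a.+1).
Proof.
elim: m => [|m IH]; first by rewrite leqn0 => /eqP->; rewrite big_ord0 subrr.
rewrite leq_eqVlt => /orP[/eqP->|pm].
  rewrite subrr big1 // => a _; by rewrite leqNgt ltn_ord mul0r.
by rewrite big_ord_recr /= -ltnS pm mul1r -IH // addrA subrK.
Qed.

Lemma of_wordsZ a g : of_words r c eK (a *: g) = a *: of_words r c eK g :> tabs.
Proof. exact: linearZ. Qed.

Lemma of_words_sum (S : Type) (s : seq S) F :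
  of_words r c eK (\sum_(i <- s) F i) = \sum_(i <- s) of_words r c eK (F i) :> tabs.
Proof. exact: linear_sum. Qed.

(** Enumerating [P] as j_0, ..., j_m, write each difference of two columns of [P]
in terms of consecutive differences, and expand the tensor.  If no row is full on
[P], more labels are confined to [P] than there are boxes, and the tensor has no
coordinate at a column word of a tableau. *)
Lemma of_words_balanced phi chi (X : {set 'I_n}) :
  balanced d phi chi X -> N (of_words r c eK (tensor (diff_vec K phi chi X))).
Proof.
case/existsP => P /and3P[P0 /forall_inP XP lt].
have [C0|/set0Pn[i0 i0C]] := eqVneq (full_rows d P) set0.
  suff -> : of_words r c eK (tensor (diff_vec K phi chi X)) = 0 by apply: in_span0.
  apply/ffunP => T; rewrite ffunE [RHS]ffunE; apply/eqP; rewrite mulf_eq0; apply/orP; right.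
  rewrite ffunE prodf_seq_eq0 /=; apply: contraTT lt.
  rewrite -all_predC => /allP nz; rewrite C0 cards0 addn0 -leqNgt.
  rewrite -(not_overfull_content (col_word_not_overfull T)).
  apply: subset_leq_card; apply/subsetP => l lX; rewrite inE.
  have := nz l (mem_index_enum _); rewrite /=; apply: contraNT => flP.
  by have /andP[p q] := XP l lX; rewrite (diff_vec_out _ _ p q).
have /set0Pn[j0 j0P] := P0.
have [m mE] : exists m, #|P| = m.+1.
  by exists #|P|.-1; rewrite prednK // card_gt0.
pose j k := nth j0 (enum P) k.
have jP k : (k < m.+1)%N -> j k \in P.
  by move=> km; rewrite -mem_enum mem_nth // -cardE mE.
have jI (k k' : 'I_m.+1) : j k = j k' -> k = k'.
  move=> /eqP; rewrite nth_uniq ?enum_uniq -?cardE ?mE ?ltn_ord // => /eqP.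
  exact: val_inj.
have X0 : (0 < #|X|)%N.
  have le : (#|full_rows d P| <= count_boxes d P)%N.
    apply: leq_trans (leq_imset_card (fun k => (d k).1) [set k | (d k).2 \in P]).
    apply/subset_leq_card/subsetP => i; rewrite inE => /forall_inP/(_ _ j0P)/codomP[k dk].
    by apply/imsetP; exists k; rewrite ?inE -dk.
  by rewrite lt0n; apply: contraL lt => /eqP->; rewrite add0n -leqNgt.
have /card_gt0P[l0 l0X] := X0.
have /fin_all_exists[jn jnP] : forall k : 'I_m.+1, exists p : posnat,
    c p = j k /\ exists x : D, col_of x = p.
  move=> k; move: i0C; rewrite inE => /forall_inP/(_ _ (jP _ (ltn_ord k)))/codomP[x dx].
  exists (col_of (e x)); split; last by exists (e x).
  by move: dx; case.
have jnI : injective jn.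
  by move=> k k' kk'; apply: jI; rewrite -(jnP k).1 -(jnP k').1 kk'.
have cnt : (\sum_k col_size D (jn k) - common_rows D jn < #|X|)%N.
  have e1 : (\sum_k col_size D (jn k) = count_boxes d P)%N.
    rewrite /count_boxes -(sum_card_fibers (fun k => (d k).2)) -[RHS]big_enum [RHS](big_nth j0) /=.
    rewrite -cardE mE big_mkord; apply: eq_bigr => k _.
    rewrite /col_size card_box_set -(card_imset _ (can_inj e'K)); apply: eq_card => l.
    rewrite -[l]eK mem_imset ?inE; last exact: can_inj e'K.
    rewrite /boxes /= e'K -/(j k) -(jnP k).1; have [x <-] := (jnP k).2.
    apply/eqP/eqP => [/(congr1 c)//|/(cI (fsvalP _) (fsvalP _))//].
  have e2 : (#|full_rows d P| <= common_rows D jn)%N.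
    rewrite /common_rows; set C := [fset i in _ | _]%fset.
    apply: leq_trans (_ : #|[set r (fsval x) | x in [set: C]]| <= _)%N; last first.
      by apply: leq_trans (leq_imset_card _ _) _; rewrite cardsT cardfE.
    apply/subset_leq_card/subsetP => i; rewrite inE => /forall_inP iP.
    have /codomP[k0 [ik0 _]] := iP _ j0P.
    have kC : row_of (e k0) \in C.
      rewrite !inE /=; apply/andP; split.
        by apply/imfsetP; exists (fsval (e k0)) => //=; apply: fsvalP.
      apply/forallP => k; have /codomP[k1 [ik1 jk1]] := iP _ (jP _ (ltn_ord k)).
      have [x xk] := (jnP k).2.
      have cx : col_of (e k1) = jn k.
        by rewrite -xk; apply: (cI (fsvalP _) (fsvalP _)); rewrite -[RHS]/(c (col_of x)) xk (jnP k).1.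
      have rx : row_of (e k1) = row_of (e k0).
        by apply: (rI (fsvalP _) (fsvalP _)); rewrite -[LHS]ik1 ik0.
      by rewrite -cx -rx -surjective_pairing fsvalP.
    by apply/imsetP; exists [` kC]%fset.
  rewrite e1 ltn_psubLR // addnC; apply: leq_trans lt _; by rewrite leq_add2l.
pose idx l := index (phi l) (enum P); pose idx' l := index (chi l) (enum P).
(* None stands for the basis vector of a label outside X. *)
pose coef l (o : option 'I_m) : K := if l \in X then
    (if o is Some a then (idx l <= a)%:R - (idx' l <= a)%:R else 0) else (o == None)%:R.
pose u l (o : option 'I_m) (x : J) : K :=
  if o is Some a then (x == j a)%:R - (x == j a.+1)%:R else (x == phi l)%:R.
have sum_option (F : option 'I_m -> K) : \sum_o F o = F None + \sum_a F (Some a).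
  rewrite (bigD1 None) //=; congr (_ + _).
  rewrite (reindex_omap Some id) => [|[]//]; apply: eq_bigl => a.
  by rewrite eqxx.
have diffE : tensor (diff_vec K phi chi X) = tensor (fun l x => \sum_o coef l o * u l o x).
  apply/ffunP => f; rewrite !ffunE; apply: eq_bigr => l _.
  rewrite sum_option /diff_vec /coef; have [lX|lX] := boolP (l \in X); last first.
    by rewrite !mul0r subr0 mul1r big1 ?addr0 // => a _; rewrite mul0r.
  have /andP[pP cP] := XP l lX.
  have le q : q \in P -> (index q (enum P) <= m)%N.
    by move=> qP; rewrite -ltnS -mE cardE index_mem mem_enum.
  pose F k : K := (f l == j k)%:R.
  rewrite !mul0r !mul1r add0r.
  transitivity ((F (idx l) - F m) - (F (idx' l) - F m)).
    by rewrite opprB addrA subrK /F /j !nth_index ?mem_enum.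
  rewrite !telescope_steps ?le // -sumrB; apply: eq_bigr => a _.
  by rewrite mulrBl.
rewrite diffE tensor_expand of_words_sum; apply: in_span_sum => k _; rewrite of_wordsZ.
have [->|nz] := eqVneq (\prod_l coef l (k l)) 0; first by rewrite scale0r; apply: in_span0.
apply: in_spanZ.
have kX l : isSome (k l) = (l \in X).
  have : coef l (k l) != 0 by apply: contraNneq nz => z; rewrite (bigD1 l) //= z mul0r.
  rewrite /coef; case: ifP => _; case: (k l) => //=; rewrite eqxx //.
have m0 : (0 < m)%N.
  by have := kX l0; rewrite l0X; case: (k l0) => // a _; apply: leq_ltn_trans (ltn_ord a).
apply: (@garnir_average K I J r c D n e e' eK e'K cI m k (fun l => u l (k l)) jn) => //.
- by move=> x; have [_ [y <-]] := jnP x; exists y.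
- by move=> l l' kk; rewrite /u -kk; case: (k l).
- move=> l a x ka; rewrite /u ka (jnP _).1 (jnP _).1 /=.
  have [->|_] := eqVneq x (j a); first by left.
  have [->|_] := eqVneq x (j a.+1); last by rewrite subrr eqxx.
  by right.
- by rewrite (_ : [set l | isSome (k l)] = X) //; apply/setP => l; rewrite inE kX.
Qed.

Lemma of_words_relations v : v \in word_relations K d -> N (of_words r c eK v).
Proof.
have spanN (s : seq {ffun {ffun 'I_n -> J} -> K^o}) x :
    {in s, forall y, N (of_words r c eK y)} -> x \in <<s>>%VS -> N (of_words r c eK x).
  move=> sN xs; rewrite (coord_span (X := in_tuple s) xs) of_words_sum.
  apply: in_span_sum => i _; rewrite of_wordsZ; apply/in_spanZ/sN.
  exact: mem_nth.
case/memv_addP => v1 v1s [v2 v2s ->]; rewrite linearD; apply: in_spanD.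
  apply: spanN v1s => _ /imageP[[[phi chi] X] bal ->]; exact: of_words_balanced.
apply: spanN v2s => _ /imageP[phi ov ->].
suff -> : of_words r c eK (tensor (word_vec K phi)) = 0 by apply: in_span0.
apply/ffunP => T; rewrite ffunE tensor_word [RHS]ffunE.
have [e0|_] := eqVneq; last by rewrite mulr0.
by have := col_word_not_overfull T; rewrite e0 => /negP[].
Qed.

Lemma spanned_relations :
  lker (linfun (pairing_map d)) = word_relations K d ->
  spanned_by (lker (linfun (@mulCR K D n)))
    (fun v => one_column_relation v \/ garnir_relation v).
Proof.
move=> kerE v; split=> [|[s sP vs]].
  rewrite (lker_mulCR eK e'K rI cI) kerE => /of_words_relations thN.
  rewrite -[v](subrK (#|col_group D|%:R^-1 *: of_words r c eK (to_words r c eK v))).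
  apply: in_spanD; first exact: of_words_to_words_span.
  exact: in_spanZ.
apply: subvP vs; apply/span_subvP => u span_from; rewrite memv_ker lfunE /=.
by apply/eqP; case: (sP u span_from) => [/(one_column_mulCR eK e'K rI cI)|/garnir_mulCR].
Qed.

End Presentation.

(** * Branching and exact hitting sets *)

Lemma pairwise_or (T : eqType) (R : rel T) (s : seq T) x y :
  pairwise R s -> x \in s -> y \in s -> x != y -> R x y || R y x.
Proof.
elim: s => //= z s IH /andP[/allP zs ps]; rewrite !inE.
case/orP=> [/eqP->|xs]; case/orP=> [/eqP->|ys]; rewrite ?eqxx //.
- by rewrite zs.
- by rewrite zs ?orbT.
- exact: IH.
Qed.

Section Rectangles.

Variables (I J : finType) (r : posnat -> I) (c : posnat -> J).
Variables (D : diagram) (n : nat) (e : 'I_n.+1 -> D) (e' : D -> 'I_n.+1).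
Hypotheses (eK : cancel e e') (e'K : cancel e' e).
Hypotheses (rI : row_inj r D) (cI : col_inj c D).
Local Open Scope fset_scope.

Notation d := (boxes r c e).

(** Two elements of a special transversal are never in the same rectangle, and
[unhit_dim] excludes that a maximal rectangle is missed. *)
Lemma dim_exact_hitting (K : numFieldType) (B : {fset box}) (s : seq box) :
  B `<=` D -> s =i B -> pairwise (cross_free D) s ->
  (\dim (specht K D n.+1) <= \sum_(b <- s) \dim (specht K (D `\ b) n))%N ->
  exact_hitting_set D B.
Proof.
move=> BD sB sp dimE; split=> // E [[ED [p1 [p2 Ep]]] Emax].
have sD : {subset s <= D} by move=> x; rewrite sB; apply: (fsubsetP BD).
(* Maximality: a product of row and column sets that lies in D and covers E
   is contained in E. *)
have rectE (E' : {fset box}) (q1 q2 : pred posnat) :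
    (forall i j, q1 i -> q2 j -> (i, j) \in D) ->
    (forall b, b \in E -> q1 b.1 && q2 b.2) ->
    forall b, b \in D -> q1 b.1 -> q2 b.2 -> b \in E.
  move=> qD Eq b bD b1 b2.
  rewrite -(Emax [fset x in D | q1 x.1 && q2 x.2]); first by rewrite !inE bD b1.
    split; first exact: fset_sub.
    exists q1, q2 => x; rewrite !inE /=.
    apply/andP/andP => [[_ /andP]//|[x1 x2]]; rewrite x1 x2.
    by rewrite [x]surjective_pairing qD.
  by apply/fsubsetP => x xE; rewrite !inE /= (fsubsetP ED) ?Eq.
have [b0 b0E] : exists b0, b0 \in E.
  apply/fset0Pn; apply/eqP => E0.
  have bD : fsval (e ord0) \in D := fsvalP _.
  suff : fsval (e ord0) \in E by rewrite E0 inE.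
  apply: (@rectE E (pred1 (fsval (e ord0)).1) (pred1 (fsval (e ord0)).2)) => //=.
    by move=> i j /eqP-> /eqP->; rewrite -surjective_pairing.
  by move=> b; rewrite E0 inE.
have Erect i j : p1 i -> p2 j -> (i, j) \in D.
  by move=> i1 j2; apply: (fsubsetP ED); rewrite Ep /= i1.
have /andP[b01 b02] : p1 b0.1 && p2 b0.2 by rewrite -Ep.
have mx1 (b : box) : b \in D -> p2 b.2 -> ~~ p1 b.1 -> exists2 j, p2 j & (b.1, j) \notin D.
  move=> bD b2 b1; case: (boolP [exists x : E, (b.1, (fsval x).2) \notin D]).
    case/existsP => x xD; exists (fsval x).2 => //.
    by have := fsvalP x; rewrite Ep => /andP[].
  rewrite negb_exists => /forallP all_in; case/negP: b1.
  suff : b \in E by rewrite Ep => /andP[].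
  apply: (@rectE E [pred i | p1 i || (i == b.1)] p2) => //=; last by rewrite eqxx orbT.
    move=> i j /orP[i1|/eqP->] j2; first exact: Erect.
    have jE : (b0.1, j) \in E by rewrite Ep /= b01.
    by have := all_in [` jE]; rewrite negbK.
  by move=> x; rewrite Ep => /andP[-> ->].
have mx2 (b : box) : b \in D -> p1 b.1 -> ~~ p2 b.2 -> exists2 i, p1 i & (i, b.2) \notin D.
  move=> bD b1 b2; case: (boolP [exists x : E, ((fsval x).1, b.2) \notin D]).
    case/existsP => x xD; exists (fsval x).1 => //.
    by have := fsvalP x; rewrite Ep => /andP[].
  rewrite negb_exists => /forallP all_in; case/negP: b2.
  suff : b \in E by rewrite Ep => /andP[].
  apply: (@rectE E p1 [pred j | p2 j || (j == b.2)]) => //=; last by rewrite eqxx orbT.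
    move=> i j i1 /orP[j2|/eqP->]; first exact: Erect.
    have iE : (i, b0.2) \in E by rewrite Ep /= i1.
    by have := all_in [` iE]; rewrite negbK.
  by move=> x; rewrite Ep => /andP[-> ->].
have /hasP[b bs /andP[b1 b2]] : has (fun b : box => p1 b.1 && p2 b.2) s.
  apply: contraLR dimE => /hasPn un; rewrite -ltnNge.
  exact: (@unhit_dim K D n I J r c rI cI e e' eK e'K s p1 p2 b0 (fsubsetP ED _ b0E) b01 b02
    Erect mx1 mx2 sD sp un).
suff -> : B `&` E = [fset b] by rewrite cardfs1.
apply/fsetP => x; rewrite !inE -sB Ep; apply/andP/eqP => [[xs /andP[x1 x2]]|->]; last first.
  by rewrite bs b1.
apply/eqP; apply: contraT => xb; have := pairwise_or sp xs bs xb.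
by rewrite /cross_free !Erect.
Qed.

(** The rows full on [P] and the columns that contain them span a maximal
rectangle. *)
Lemma exact_hitting_hits (B : {fset box}) (sI : seq 'I_n.+1) :
  exact_hitting_set D B -> [seq fsval (e k) | k <- sI] =i B -> hits d sI.
Proof.
move=> [BD hitB] sIB P /set0Pn[j0 j0P] /set0Pn[i0 i0C].
have colP j : j \in P -> exists k, d k = (i0, j).
  by move=> jP; move: i0C; rewrite inE => /forall_inP/(_ _ jP)/codomP[k ->]; exists k.
have [k0 dk0] := colP _ j0P.
pose p1 (b : box) := r b.1 \in full_rows d P.
pose p2 (b : box) := [forall i in full_rows d P, (i, c b.2) \in codom d].
pose E := [fset b in D | p1 b && p2 b].
have rowC i : i \in full_rows d P -> exists k, d k = (i, j0).
  by rewrite inE => /forall_inP/(_ _ j0P)/codomP[k ->]; exists k.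
have EP (b b' : box) : b \in D -> b' \in D -> p1 b -> p2 b' -> (b.1, b'.2) \in E.
  move=> bD b'D b1 b2; have := forall_inP b2 _ b1; rewrite (codom_boxes e'K rI cI) // => bb'.
  by apply/imfsetP; exists (b.1, b'.2) => //; apply/and3P.
have p2col k j : j \in P -> (d k).2 = j -> p2 (fsval (e k)).
  move=> jP kj; apply/forall_inP => i; rewrite inE => /forall_inP/(_ _ jP).
  by rewrite -kj.
have maxE : is_max_rectangle D E.
  split; first split.
  - exact: fset_sub.
  - exists (fun i => [exists k, (row_of (e k) == i) && p1 (fsval (e k))]).
    exists (fun j => [exists k, (col_of (e k) == j) && p2 (fsval (e k))]).
    move=> b; apply/idP/andP => [|[/existsP[k /andP[/eqP k1 kp]] /existsP[k' /andP[/eqP k'2 k'p]]]].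
      rewrite !inE => /and3P[bD b1 b2].
      by split; apply/existsP; exists (e' [` bD]); rewrite e'K eqxx.
    by rewrite [b]surjective_pairing -k1 -k'2; apply: EP => //; apply: fsvalP.
  - move=> E' [E'D [q1 [q2 E'q]]] EE'; apply/eqP; rewrite eqEfsubset EE' andbT.
    have qE b : b \in E -> q1 b.1 && q2 b.2 by move/(fsubsetP EE'); rewrite E'q.
    have k0p1 : p1 (fsval (e k0)) by rewrite /p1; move: i0C; rewrite -[i0]/((i0, j0).1) -dk0.
    have k0p2 : p2 (fsval (e k0)) by apply: (p2col _ j0) => //; rewrite dk0.
    apply/fsubsetP => x; rewrite E'q => /andP[x1 x2].
    have xD : x \in D by apply: (fsubsetP E'D); rewrite E'q x1.
    rewrite !inE xD /=; apply/andP; split.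
      rewrite /p1 inE; apply/forall_inP => j jP; have [k dk] := colP _ jP.
      have kE : (row_of (e k0), col_of (e k)) \in E.
        by apply: EP; rewrite ?fsvalP //; apply: (p2col _ j) => //; rewrite dk.
      have /andP[_ /= kq2] := qE _ kE.
      have -> : j = c (fsval (e k)).2 by move: dk; case.
      rewrite (codom_boxes e'K rI cI) ?fsvalP //; apply: (fsubsetP E'D).
      by rewrite E'q /= x1.
    apply/forall_inP => i1 /[dup] iC /rowC[k dk].
    have kE : (row_of (e k), col_of (e k0)) \in E.
      by apply: EP; rewrite ?fsvalP // /p1; move: iC; rewrite -[i1]/((i1, j0).1) -dk.
    have /andP[/= kq1 _] := qE _ kE.
    have -> : i1 = r (fsval (e k)).1 by move: dk; case.
    rewrite (codom_boxes e'K rI cI) ?fsvalP //; apply: (fsubsetP E'D).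
    by rewrite E'q /= kq1.
have /eqP/cardfs1P[b bBE] : #|` B `&` E| = 1%N := hitB _ maxE.
have : b \in B `&` E by rewrite bBE inE.
rewrite !inE -sIB => /and4P[/mapP[k ks ->] kD k1 k2].
by exists k => //; split=> // i; move/forall_inP: k2; apply.
Qed.

End Rectangles.

Lemma enum_diagram (D : diagram) n : #|` D| = n ->
  exists (e : 'I_n -> D) (e' : D -> 'I_n), cancel e e' /\ cancel e' e.
Proof.
rewrite cardfE => Dn; exists (fun l => enum_val (cast_ord (esym Dn) l)).
exists (fun x => cast_ord Dn (enum_rank x)).
by split=> x; rewrite ?enum_valK ?cast_ordKV // cast_ordK enum_rankK.
Qed.

Lemma fset_lift_seq (T : choiceType) (A : {fset T}) (s : seq T) : {subset s <= A} ->
  exists s' : seq A, [seq fsval x | x <- s'] = s.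
Proof.
elim: s => [|x s IH] sA; first by exists [::].
have [y ys|s' s'E] := IH; first by apply: sA; rewrite inE ys orbT.
have xA : x \in A by apply: sA; rewrite mem_head.
by exists ([` xA]%fset :: s'); rewrite /= s'E.
Qed.

Section Induction.

Variables (K : numFieldType) (I J : finType) (r : posnat -> I) (c : posnat -> J).
Local Open Scope fset_scope.

Definition kernel_is_relations (D : diagram) n := forall (e : 'I_n -> D) (e' : D -> 'I_n),
  cancel e e' -> cancel e' e ->
  lker (linfun (pairing_map (boxes r c e))) = word_relations K (boxes r c e).

(** The upper bound, the lower bound and the inclusion of the word relations in
the radical form a chain of inequalities whose ends agree. *)
Lemma hitting_branches (D : diagram) n (B : {fset box}) (s : seq box)
    (e : 'I_n.+1 -> D) (e' : D -> 'I_n.+1) :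
  row_inj r D -> col_inj c D -> cancel e e' -> cancel e' e ->
  exact_hitting_set D B -> s =i B -> pairwise (cross_free D) s ->
  (forall b, b \in s -> kernel_is_relations (D `\ b) n) ->
  lker (linfun (pairing_map (boxes r c e))) = word_relations K (boxes r c e) /\
  (\dim (specht K D n.+1) = \sum_(b <- s) \dim (specht K (D `\ b) n))%N.
Proof.
move=> rI cI eK e'K hitB sB sp kerb; set d := boxes r c e.
have sD : {subset s <= D}.
  by move=> x; rewrite sB; case: hitB => BD _; apply: (fsubsetP BD).
have [sI sIE] : exists sI, [seq fsval (e k) | k <- sI] = s.
  have [s' s'E] := fset_lift_seq sD; exists [seq e' x | x <- s'].
  by rewrite -map_comp -s'E; apply: eq_map => x /=; rewrite e'K.
have dI : injective d := boxes_inj eK rI cI.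
have hits_s : hits d sI by apply: (exact_hitting_hits e'K rI cI hitB); rewrite sIE.
have sp_s : special_order d sI.
  move: sp; rewrite -sIE pairwise_map; apply: sub_pairwise => k k'.
  by rewrite /cross_free /= /d /boxes /= (codom_boxes e'K rI cI) ?fsvalP.
have relb k : k \in sI -> (\dim {: {ffun {ffun 'I_n -> J} -> K^o}} -
    \dim (word_relations K (drop_box d k)) = \dim (specht K (D `\ fsval (e k)) n))%N.
  move=> ks; have [e1 [e1' [e1K e1'K e1E]]] := drop_enum eK e'K k.
  have -> : drop_box d k = boxes r c e1.
    by apply: boolp.funext => l; rewrite (boxes_drop _ _ e1E).
  have bs : fsval (e k) \in s by rewrite -sIE; apply/mapP; exists k.
  rewrite -(kerb _ bs _ _ e1K e1'K).
  rewrite -(dim_specht_ker K e1K e1'K (row_injD rI) (col_injD cI)).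
  by rewrite addnK.
have up := codim_word_relations K dI hits_s sp_s.
have sumE : (\sum_(k <- sI) (\dim {: {ffun {ffun 'I_n -> J} -> K^o}} -
    \dim (word_relations K (drop_box d k))) = \sum_(b <- s) \dim (specht K (D `\ b) n))%N.
  by rewrite -sIE big_map; apply: eq_big_seq.
rewrite sumE -(dim_specht_ker K eK e'K rI cI) addnC in up.
have low : (\sum_(b <- s) \dim (specht K (D `\ b) n) <= \dim (specht K D n.+1))%N.
  apply: leq_trans (lower_bound0 K rI cI eK e'K sD sp) (dimvS _).
  exact: sum_last_at_sub.
have relK := word_relations_sub_ker K dI; have relKd := dimvS relK.
split.
  apply/esym/eqP; rewrite eqEdim relK /=.
  by rewrite -(leq_add2r (\dim (specht K D n.+1))) (leq_trans up) // leq_add2l.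
apply/eqP; rewrite eqn_leq low andbT.
rewrite -(leq_add2l (\dim (word_relations K d))); apply: leq_trans up.
by rewrite leq_add2r.
Qed.

Lemma branches_completely_wrtP (D : diagram) B : branches_completely_wrt K D B ->
  [/\ D != fset0, branching_set K D B &
      forall b, b \in B -> branches_completely K (D `\ b)].
Proof. by case. Qed.

Lemma branches_completelyP (D : diagram) : branches_completely K D ->
  D = fset0 \/ exists B, branches_completely_wrt K D B.
Proof. by case=> [|D' B]; [left|right; exists B]. Qed.

Lemma branching_set_hitting (D : diagram) (B : {fset box}) :
  row_inj r D -> col_inj c D -> branching_set K D B -> exact_hitting_set D B.
Proof.
move=> rI cI [[BD [s [sU sB sp]]] [n Dn iso]].
have [e [e' [eK e'K]]] := enum_diagram Dn.
apply: (dim_exact_hitting eK e'K rI cI (K := K) BD sB sp).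
rewrite (branching_iso_dim iso).
have <- : (\sum_(b <- B) \dim (specht K (D `\ b) n) =
    \sum_(x : B) \dim (specht K (D `\ fsval x) n))%N by rewrite big_seq_fsetE.
have pBs : perm_eq B s by apply: uniq_perm => // x; rewrite sB.
by rewrite (perm_big s pBs).
Qed.

(** By induction on the number of boxes: a branching set hits all the maximal
rectangles, so [hitting_branches] applies. *)
Lemma branching_ker n (D : diagram) : row_inj r D -> col_inj c D -> #|` D| = n ->
  branches_completely K D -> kernel_is_relations D n.
Proof.
elim: n D => [|n IH] D rI cI Dn bc e e' eK e'K.
  apply/esym/eqP; rewrite eqEsubv (word_relations_sub_ker K (boxes_inj eK rI cI)) /=.
  apply/subvP => v; rewrite memv_ker lfunE /= => /eqP/ffunP v0.
  suff -> : v = 0 by apply: rpred0.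
  apply/ffunP => phi; rewrite [RHS]ffunE.
  have := v0 [ffun l : 'I_0 => match l with Ordinal _ l0 => match notF l0 with end end].
  rewrite ffunE [RHS]ffunE (bigD1 phi) //= big1 => [|f /eqP[]]; last by apply/ffunP => -[].
  by rewrite addr0 /pairing det_mx00 mulr1.
case: (branches_completelyP bc) => [D0|[B /branches_completely_wrtP[D0 bset sub]]].
  by have : #|` D| = 0%N; [rewrite D0 cardfs0|rewrite Dn].
have hitB := branching_set_hitting rI cI bset.
have [[BD [s [sU sB sp]]] _] := bset.
have [|//] := hitting_branches rI cI eK e'K hitB sB sp.
move=> b bs; have bB : b \in B by rewrite -sB.
have bD : b \in D := fsubsetP BD _ bB.
apply: IH (sub b bB).
- exact: row_injD.
- exact: col_injD.
- by have := cardfsD1 b D; rewrite bD Dn => -[].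
Qed.

End Induction.

Lemma coordinates (D : diagram) : exists M (r : posnat -> 'I_M.+1),
  row_inj r D /\ col_inj r D.
Proof.
pose M := (\sum_(b <- D) (val b.1 + val b.2))%N; exists M, (fun i => inord (val i)).
have le (b : box) : b \in D -> (val b.1 <= M)%N /\ (val b.2 <= M)%N.
  move=> bD; rewrite /M (big_rem b) //=.
  by split; rewrite -?addnA ?leq_addr // addnCA leq_addr.
split=> x y /le[x1 x2] /le[y1 y2] /(congr1 (@nat_of_ord _)); rewrite !inordK ?ltnS //.
  exact: val_inj.
exact: val_inj.
Qed.

Local Open Scope fset_scope.

Theorem theorem4p5 (R : realType) (D : diagram) (B : {fset box})
    (D_nonempty : D != fset0) (B_special : special_transversal D B) :
  (branches_completely_wrt R[i] D B <->
     (forall b, b \in B -> branches_completely R[i] (D `\ b)) /\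
     exact_hitting_set D B)
  /\
  (branches_completely R[i] D ->
   spanned_by (lker (linfun (@mulCR R[i] D #|` D|)))
     (fun v => one_column_relation v \/ garnir_relation v)).
Proof.
have [M [r [rI cI]]] := coordinates D.
split; first split.
- by move=> /branches_completely_wrtP[_ bset sub]; split=> //; apply: branching_set_hitting rI cI bset.
- move=> [sub hitB]; apply: Branches_completely_wrt => //; split=> //.
  have [BD [s [sU sB sp]]] := B_special.
  have Dn : #|` D| = #|` D|.-1.+1 by rewrite prednK // cardfs_gt0.
  exists #|` D|.-1 => //; set n := #|` D|.-1 in Dn *.
  have [e [e' [eK e'K]]] := enum_diagram Dn.
  have [|_ dimE] := hitting_branches (K := R[i]) rI cI eK e'K hitB sB sp.
    move=> b bs; have bB : b \in B by rewrite -sB.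
    have bD : b \in D := fsubsetP BD _ bB.
    apply: branching_ker (sub b bB).
    - exact: row_injD rI.
    - exact: col_injD cI.
    - by have := cardfsD1 b D; rewrite bD Dn => -[].
  have [|s' s'E] := @fset_lift_seq _ B s; first by move=> x; rewrite sB.
  apply: (dim_branching_iso rI cI eK e'K (s := s')); rewrite ?s'E //.
  + by rewrite -(map_inj_uniq val_inj) s'E.
  + move=> x; have : fsval x \in s by rewrite sB fsvalP.
    by rewrite -s'E => /mapP[y ys /val_inj->].
  + exact: fsubsetP.
  + by rewrite dimE -s'E big_map.
- move=> bc; have [e [e' [eK e'K]]] := enum_diagram (erefl #|` D|).
  apply: (spanned_relations eK e'K rI cI).
  exact: (branching_ker rI cI _ bc).
Qed.
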